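(* Let $\Omega_0,\Omega_1$ be nonempty open, bounded subsets of $\mathbb{R}^n$. Let $t\in[0,1]$ and set $$\Omega_t=(1-t)\Omega_0+t\Omega_1.$$ Then $$\lambda_\gamma(\Omega_t)\le(1-t)\lambda_\gamma(\Omega_0)+t\lambda_\gamma(\Omega_1).$$
   Context: For $A,B\subset\mathbb{R}^n$ and real $a,b$, $aA+bB=\{ax+by:\ x\in A,\ y\in B\}$ (Minkowski combination). $\gamma$ is the Gaussian measure on $\mathbb{R}^n$, $d\gamma(x)=(2\pi)^{-n/2}e^{-|x|^2/2}\,dx$. For a nonempty open bounded set $\Omega\subset\mathbb{R}^n$, the Gaussian principal frequency (first Dirichlet eigenvalue of the Ornstein-Uhlenbeck operator $Lu=\Delta u-\langle\nabla u,x\rangle$) is $$\lambda_\gamma(\Omega)=\inf\left\{\frac{\int_\Omega|\nabla v|^2\,d\gamma}{\int_\Omega v^2\,d\gamma}:\ v\in W^{1,2}_0(\Omega,\gamma),\ v\not\equiv0\right\},$$ where $W^{1,2}_0(\Omega,\gamma)$ is the closure of $C_c^\infty(\Omega)$ in the Sobolev space $W^{1,2}(\Omega,\gamma)$ with respect to the measure $\gamma$. *)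

(* Defs.v *)
From HB Require Import structures.
From mathcomp Require Import all_boot all_order all_algebra.
From mathcomp Require Import all_classical all_reals all_analysis.
From mathcomp Require Import measurable_realfun.
Set Implicit Arguments.
Unset Strict Implicit.
Unset Printing Implicit Defensive.
Import Order.TTheory GRing.Theory Num.Theory.
Import numFieldNormedType.Exports.

Local Open Scope classical_set_scope.
Local Open Scope ring_scope.

(* R^n is the type 'rV[R]_n of row vectors. The library norm on it is the sup
   norm; it is only used here through the topology and the bounded sets, which
   are the Euclidean ones. *)

Definition measure_rV_display : measure_display -> measure_display.
Proof. exact. Qed.

Section measurable_rV.
Context {R : realType} (n : nat).

Let coors : 'I_n -> 'rV[R]_n -> measurableTypeR R := fun i x => x ord0 i.

Let rV_set0 : g_sigma_preimage coors set0.
Proof. exact: sigma_algebra0. Qed.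

Let rV_setC A : g_sigma_preimage coors A -> g_sigma_preimage coors (~` A).
Proof. exact: sigma_algebraC. Qed.

Let rV_bigcup (F : _^nat) : (forall i, g_sigma_preimage coors (F i)) ->
  g_sigma_preimage coors (\bigcup_i (F i)).
Proof. exact: sigma_algebra_bigcup. Qed.

(* The sigma-algebra generated by the coordinates, as the library does for
   tuples; this is the Borel sigma-algebra. *)
HB.instance Definition _ :=
  @isMeasurable.Build (measure_rV_display (R.-ocitv.-measurable).-sigma)
    'rV[R]_n (g_sigma_preimage coors) rV_set0 rV_setC rV_bigcup.

End measurable_rV.

Lemma measurable_coord (R : realType) n (i : 'I_n) :
  measurable_fun [set: 'rV[R]_n] (fun x => x ord0 i : measurableTypeR R).
Proof.
move=> _ Y mY; rewrite setTI; apply: sub_sigma_algebra => /=.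
rewrite -bigcup_seq/=; exists i => /=; first by rewrite mem_index_enum.
by exists Y => //; rewrite setTI.
Qed.

Lemma measurable_fun_coordP d (T : measurableType d) (R : realType) n
    (f : T -> 'rV[R]_n) :
  (forall i, measurable_fun [set: T] (fun x => f x ord0 i : measurableTypeR R)) ->
  measurable_fun [set: T] f.
Proof.
move=> mf _ A; rewrite setTI /measurable/= => mA.
pose coors i (x : 'rV[R]_n) : measurableTypeR R := x ord0 i.
have : g_sigma_preimage (fun i => coors i \o f) (f @^-1` A).
  by rewrite g_sigma_preimage_comp; exists A => //; rewrite setTI.
apply: smallest_sub; first exact: sigma_algebra_measurable.
by apply: (big_ind (fun X => X `<=` measurable)) => //;
  [move=> X Y XS YS B [/XS|/YS]|move=> i _ B [C mC <-]; exact: mf].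
Qed.

Section lebesgue_rV.
Context {R : realType}.

Definition cons_rV n (p : measurableTypeR R * 'rV[R]_n) : 'rV[R]_n.+1 :=
  row_mx (p.1)%:M p.2.

Definition uncons_rV n (x : 'rV[R]_n.+1) : measurableTypeR R * 'rV[R]_n :=
  (x ord0 ord0, \row_i x ord0 (lift ord0 i)).

Lemma cons_rV0 n (p : measurableTypeR R * 'rV[R]_n) :
  cons_rV p ord0 ord0 = p.1.
Proof.
rewrite /cons_rV (_ : ord0 = lshift n ord0 :> 'I_(1 + n)); last exact: val_inj.
by rewrite (row_mxEl (p.1)%:M p.2) mxE eqxx.
Qed.

Lemma cons_rVS n (p : measurableTypeR R * 'rV[R]_n) i :
  cons_rV p ord0 (lift ord0 i) = p.2 ord0 i.
Proof.
rewrite /cons_rV (_ : lift ord0 i = rshift 1 i); last exact: val_inj.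
exact: (row_mxEr (p.1)%:M p.2).
Qed.

Lemma cons_rVK n : cancel (@cons_rV n) (@uncons_rV n).
Proof.
move=> [a v]; rewrite /uncons_rV cons_rV0; congr (_, _).
by apply/rowP => i; rewrite mxE cons_rVS.
Qed.

Lemma uncons_rVK n : cancel (@uncons_rV n) (@cons_rV n).
Proof.
move=> x; apply/rowP => i; have [j|] := unliftP ord0 i => ->.
  by rewrite cons_rVS mxE.
by rewrite cons_rV0.
Qed.

Lemma measurable_cons_rV n : measurable_fun [set: _] (@cons_rV n).
Proof.
apply: measurable_fun_coordP => i; have [j|] := unliftP ord0 i => ->.
- under eq_fun do rewrite cons_rVS.
  apply: (measurableT_comp (measurable_coord j)); exact: measurable_snd.
- under eq_fun do rewrite cons_rV0.
  exact: measurable_fst.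
Qed.

Lemma measurable_uncons_rV n : measurable_fun [set: _] (@uncons_rV n).
Proof.
apply/measurable_fun_pair; first exact: measurable_coord.
apply: measurable_fun_coordP => i.
under eq_fun do rewrite mxE.
exact: measurable_coord.
Qed.

Section lebesgue_step.
Context n (m : {sigma_finite_measure set 'rV[R]_n -> \bar R}).

Definition lebesgue_step : set 'rV[R]_n.+1 -> \bar R :=
  pushforward (@lebesgue_measure R \x m)%E (@cons_rV n).

Let mcons := @measurable_cons_rV n.

Let lebesgue_step0 : lebesgue_step set0 = 0%E.
Proof. exact: measure0. Qed.

Let lebesgue_step_ge0 A : (0 <= lebesgue_step A)%E.
Proof. exact: measure_ge0. Qed.

Let lebesgue_step_sigma_additive : semi_sigma_additive lebesgue_step.
Proof. exact: measure_semi_sigma_additive. Qed.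

HB.instance Definition _ := isMeasure.Build _ _ _ lebesgue_step
  lebesgue_step0 lebesgue_step_ge0 lebesgue_step_sigma_additive.

Let lebesgue_step_sigma_finite : sigma_finite setT lebesgue_step.
Proof.
have /sigma_finiteP[F [TF ndF Foo]] := sigma_finiteT (@lebesgue_measure R).
have /sigma_finiteP[G [TG ndG Goo]] := sigma_finiteT m.
exists (fun k => @uncons_rV n @^-1` (F k `*` G k)).
  apply/esym; rewrite -subTset => x _.
  have [i _ Fi] : (\bigcup_i F i) (uncons_rV x).1 by rewrite -TF.
  have [j _ Gj] : (\bigcup_j G j) (uncons_rV x).2 by rewrite -TG.
  exists (maxn i j) => //; split.
  - by move: Fi; exact/subsetPset/ndF/leq_maxl.
  - by move: Gj; exact/subsetPset/ndG/leq_maxr.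
move=> k; have [mF Fk] := Foo k; have [mG Gk] := Goo k.
have mFG : measurable (F k `*` G k) by exact: measurableX.
split.
  rewrite -[X in measurable X]setTI; exact: measurable_uncons_rV.
rewrite /lebesgue_step /pushforward -comp_preimage.
rewrite (_ : _ \o _ = id); last by apply/funext => p; exact: cons_rVK.
by rewrite preimage_id product_measure1E// lte_mul_pinfty// ge0_fin_numE.
Qed.

HB.instance Definition _ := Measure_isSigmaFinite.Build _ _ _ lebesgue_step
  lebesgue_step_sigma_finite.

End lebesgue_step.

(* Lebesgue measure on R^n: the n-fold product of lebesgue_measure, the
   measure on the one-point space R^0 being the unit mass. *)
Fixpoint lebesgue_rV n : {sigma_finite_measure set 'rV[R]_n -> \bar R} :=
  match n with
  | 0 => dirac (0 : 'rV[R]_0)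
  | k.+1 => lebesgue_step (lebesgue_rV k)
  end.

End lebesgue_rV.

Section gaussian.
Context {R : realType} (n : nat).
Implicit Types x : 'rV[R]_n.

(* |x|^2 for the Euclidean norm *)
Definition sqnorm x : R := \sum_(i < n) x ord0 i ^+ 2.

Definition gaussian_pdf x : R :=
  (2 * pi) `^ (- (n%:R / 2)) * expR (- (sqnorm x / 2)).

Lemma gaussian_pdf_ge0 x : 0 <= gaussian_pdf x.
Proof. by rewrite mulr_ge0 ?powR_ge0 ?expR_ge0. Qed.

Lemma measurable_sqnorm : measurable_fun [set: 'rV[R]_n] sqnorm.
Proof.
apply: measurable_sum => i.
by apply: measurable_funX; exact: measurable_coord.
Qed.

Lemma measurable_gaussian_pdf : measurable_fun [set: 'rV[R]_n] gaussian_pdf.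
Proof.
apply: measurable_funM => //; apply: measurableT_comp => //.
apply: measurableT_comp => //; apply: measurable_funM => //.
exact: measurable_sqnorm.
Qed.

Definition gaussian (A : set 'rV[R]_n) : \bar R :=
  (\int[@lebesgue_rV R n]_(x in A) (gaussian_pdf x)%:E)%E.

Let gaussian0 : gaussian set0 = 0%E.
Proof. by rewrite /gaussian integral_set0. Qed.

Let gaussian_ge0 A : (0 <= gaussian A)%E.
Proof. by apply: integral_ge0 => x _; rewrite lee_fin gaussian_pdf_ge0. Qed.

Let gaussian_sigma_additive : semi_sigma_additive gaussian.
Proof.
move=> F mF tF mUF; rewrite /gaussian ge0_integral_bigcup//=.
- by apply: is_cvg_ereal_nneg_natsum_cond => k _ _; exact: gaussian_ge0.
- by apply/measurable_EFinP/measurable_funTS; exact: measurable_gaussian_pdf.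
- by move=> x _; rewrite lee_fin gaussian_pdf_ge0.
Qed.

HB.instance Definition _ := isMeasure.Build _ _ _ gaussian
  gaussian0 gaussian_ge0 gaussian_sigma_additive.

End gaussian.
Arguments gaussian {R} n.

Section sobolev.
Context {R : realType} (n : nat).
Implicit Types (Omega : set 'rV[R]_n) (v phi : 'rV[R]_n -> R).
Implicit Types (g : 'rV[R]_n -> 'rV[R]_n).

Definition partial (i : 'I_n) phi : 'rV[R]_n -> R :=
  'D_(delta_mx ord0 i) phi.

Definition grad phi : 'rV[R]_n -> 'rV[R]_n := fun x => \row_i partial i phi x.

Definition smooth phi := forall s : seq 'I_n,
  continuous (foldr partial phi s) /\
  forall i x, derivable (foldr partial phi s) x (delta_mx ord0 i).

Definition test_function Omega phi :=
  [/\ smooth phi, compact (closure [set x | phi x != 0]) &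
      closure [set x | phi x != 0] `<=` Omega].

Definition L2 Omega v :=
  measurable_fun Omega v /\
  (\int[gaussian n]_(x in Omega) (v x ^+ 2)%:E < +oo)%E.

Definition weak_gradient Omega v g :=
  forall phi, test_function Omega phi -> forall i : 'I_n,
    \int[@lebesgue_rV R n]_(x in Omega) (v x * partial i phi x) =
    - \int[@lebesgue_rV R n]_(x in Omega) (g x ord0 i * phi x).

(* v is in W^{1,2}(Omega, gamma) with weak gradient g. The gradient, unique up to
   a null set, is carried along with v instead of being chosen from v. *)
Definition W12 Omega v g :=
  [/\ L2 Omega v, forall i : 'I_n, L2 Omega (fun x => g x ord0 i) &
      weak_gradient Omega v g].

Definition W12_norm Omega v g : R :=
  Num.sqrt (\int[gaussian n]_(x in Omega) v x ^+ 2 +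
            \int[gaussian n]_(x in Omega) sqnorm (g x)).

(* closure of the test functions in W^{1,2}(Omega, gamma) *)
Definition W12_0 Omega v g :=
  W12 Omega v g /\
  forall e : R, 0 < e -> exists2 phi, test_function Omega phi &
    W12_norm Omega (v \- phi) (g \- grad phi) < e.

(* The infimum is taken in the extended reals, so that no default value is
   involved; the ratios themselves are finite real numbers. *)
Definition gaussian_frequency Omega : \bar R :=
  ereal_inf [set q | exists v g, [/\ W12_0 Omega v g,
    ~ ae_eq (gaussian n) Omega v (cst 0) &
    q = ((\int[gaussian n]_(x in Omega) sqnorm (g x)) /
         (\int[gaussian n]_(x in Omega) v x ^+ 2))%:E]].

Definition minkowski_combination (a b : R) (A B : set 'rV[R]_n) :=
  [set a *: x + b *: y | x in A & y in B].

End sobolev.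

(* Main.v *)
(* The substitution u = v exp(-|x|^2/4) turns the Gaussian Rayleigh quotient into
   that of the Schroedinger operator - Laplacian + |x|^2/4 - n/2, to which the
   argument of Brascamp and Lieb applies, with the heat semigroup replaced by the
   operators A f(x) = w(x) \int p(x - y) w(y) f(y) dy, where p is a smooth
   log-concave kernel of radius d, w(x) = exp(-h |x|^2/8), and h is of order d^2.
   Up to O(h d), <f, A f> / \int p equals |f|^2 - h D(f), where D is the Dirichlet
   form |grad f|^2 + |x|^2 f^2/4; for rough f this holds as a bound on D of the
   convolution of f with a second kernel. By Prekopa-Leindler the iterates of A
   restricted to compact sets K0, K1 and Kt = (1-t) K0 + t K1, started from the
   indicators, form a log-concave triple, so the growth rate on Kt is at least the
   weighted geometric mean of those on K0 and K1. Taking for K0 and K1 the supports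
   of near-minimizers, one gets f supported in Kt with <f, A f> at least this
   geometric mean times |f|^2; mollifying f gives a test function of Omega_t, and
   d tends to 0. *)
Require Import Defs.
From mathcomp Require Import all_boot all_order all_algebra.
From mathcomp Require Import all_classical all_reals all_analysis.
From mathcomp Require Import measurable_realfun ring lra.
Set Implicit Arguments.
Unset Strict Implicit.
Unset Printing Implicit Defensive.
Import Order.TTheory GRing.Theory Num.Theory.
Import numFieldNormedType.Exports.
Local Open Scope classical_set_scope.
Local Open Scope ring_scope.

(** * Borel sets and translation invariance *)

(** No ground state and no spectral theorem enter: only growth rates of iterates are compared, so
    bounded measurable functions with bounded support suffice and all integrals are finite. A
    compactly supported kernel, unlike the heat kernel, keeps the mollified competitor within
    distance [d] of Kt, hence inside Omega_t. Convexity tolerates no lost factor in front of the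
    gradient, so the lower bound for smooth functions and the upper bound for rough ones must share
    the constant [step d]. Both rest on the second moments of [ker 2]: Taylor's formula brings them
    in on one side, Bessel's inequality on the other. A multiplicative inequality yields an additive
    one because the rates are 1 - h L + O(h d): the geometric mean of 1 - h L0 and 1 - h L1 is 1 - h
    ((1 - t) L0 + t L1) up to O(h^2), and h is at most d^2. The error constants are fixed before
    [d], since the competitor depends on [d] and nothing beyond its support is controlled uniformly.
    The shift n/2 is common to all three sets and cancels because the weights sum to 1. *)

Section rV_borel.
Context {R : realType} {n : nat}.
Implicit Types (x : 'rV[R]_n).

Lemma ler_coord_norm x i : `|x ord0 i| <= `|x|.
Proof.
rewrite /Num.norm/= mx_normrE.
exact: (le_bigmax_cond _ (fun ij : 'I_1 * 'I_n => `|x ij.1 ij.2|) (j := (ord0, i))).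
Qed.

Lemma rV_norm_le x (M : R) : 0 <= M -> (forall i, `|x ord0 i| <= M) -> `|x| <= M.
Proof.
move=> M0 H; rewrite /Num.norm/= mx_normrE; apply/bigmax_leP; split => // -[i j] _ /=.
by rewrite (ord1 i).
Qed.

Lemma rV_norm_lt x (M : R) : 0 < M -> (forall i, `|x ord0 i| < M) -> `|x| < M.
Proof.
move=> M0 H; rewrite /Num.norm/= mx_normrE; apply/bigmax_ltP; split => // -[i j] _ /=.
by rewrite (ord1 i).
Qed.

Lemma ball_rVE x e : 0 < e ->
  ball x e = \bigcap_(i in [set: 'I_n]) [set y | `|x ord0 i - y ord0 i| < e].
Proof.
move=> e0; rewrite -ball_normE; apply/seteqP; split => y /=.
  move=> h i _; apply: le_lt_trans h.
  by have := ler_coord_norm (x - y) i; rewrite !mxE.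
by move=> h; apply: rV_norm_lt => // i; rewrite !mxE; exact: h.
Qed.

Lemma measurable_ball_rV x e : 0 < e -> measurable (ball x e).
Proof.
move=> e0; rewrite ball_rVE//; apply: fin_bigcap_measurable => // i _.
rewrite -[X in measurable X]setTI.
have : measurable_fun [set: 'rV[R]_n] (fun y => `|x ord0 i - y ord0 i| : measurableTypeR R).
  apply: measurableT_comp => //; apply: measurable_funB => //.
  exact: measurable_coord.
move=> /(_ measurableT [set r | r < e]); apply.
by rewrite (_ : [set r | r < e] = `]-oo, e[%classic)// set_itvE.
Qed.

(** The sigma-algebra is generated by the coordinates, not by open sets, so openness has to be
    turned into a countable union: the balls with rational centre and radius 1/(k+1) contained in
    [U]. *)
Lemma open_measurable_rV (U : set 'rV[R]_n) : open U -> measurable U.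
Proof.
move=> oU.
pose q2r (q : 'rV[rat]_n) : 'rV[R]_n := map_mx ratr q.
pose B (p : 'rV[rat]_n * nat) := ball (q2r p.1) (p.2.+1%:R^-1 : R).
pose D := [set p | B p `<=` U].
have -> : U = \bigcup_(p in D) B p.
  apply/seteqP; split=> [x Ux|x [p Dp]]; last exact: Dp.
  have /nbhs_ballP[e /= e0 xeU] : nbhs x U by exact: open_nbhs_nbhs.
  (* Twice the radius stays below [e], so a ball whose rational centre lies within its radius of [x]
     is contained in the ball of radius [e] around [x]. *)
  have [k ke] : exists k : nat, (k.+1%:R^-1 : R) < e / 2.
    have := near_infty_natSinv_lt (PosNum (divr_gt0 e0 (ltr0n R 2))).
    by case=> k _ /(_ k); rewrite /= leqnn => /(_ isT) ?; exists k.
  have k0 : 0 < (k.+1%:R^-1 : R) by rewrite invr_gt0.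
  have /choice[f fP] : forall i, exists q : rat, `|x ord0 i - ratr q| < (k.+1%:R^-1 : R).
    move=> i.
    have /rat_in_itvoo[q] : x ord0 i - k.+1%:R^-1 < x ord0 i + k.+1%:R^-1.
      by rewrite ltrBlDr -addrA ltrDl addr_gt0.
    by rewrite in_itv/= => qx; exists q; rewrite ltr_distlC.
  exists (\row_i f i, k).
    move=> y /=; rewrite /B/= => qy; apply: xeU.
    move: qy; rewrite !ball_rVE//= => qy i _; have := qy i I; rewrite /= !mxE => h.
    have := fP i => h'.
    rewrite -(subrKA (ratr (f i))) (le_lt_trans (ler_normD _ _))//.
    by rewrite (splitr e) ltrD//; [exact: lt_trans h' ke|exact: lt_trans h ke].
  rewrite /B/= ball_rVE// => i _ /=; rewrite !mxE distrC; exact: fP.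
rewrite bigcup_mkcond; apply: countable_bigcupT_measurable => // p.
by case: ifPn => // _; apply: measurable_ball_rV; rewrite invr_gt0.
Qed.

Lemma continuous_measurable_rV (f : 'rV[R]_n -> R) :
  continuous f -> measurable_fun [set: 'rV[R]_n] f.
Proof.
move=> cf; apply: (measurability _ (RGenOpens.measurableE R)) => //.
move=> _ [_ [a [b ->] <-]]; rewrite setTI; apply: open_measurable_rV.
by apply: open_comp => // x _; exact: cf.
Qed.

End rV_borel.

Definition pushforward_measure d1 d2 (T1 : measurableType d1)
    (T2 : measurableType d2) (R : realType) (m : {measure set T1 -> \bar R})
    (f : T1 -> T2) (mf : measurable_fun setT f) : {measure set T2 -> \bar R} :=
  @measure_function_pushforward__canonical__measure_function_Measure
    _ _ _ _ _ m f mf.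

(** The pushforward under x -> c x + a, scaled by c, gives each half-open interval its length, and
    Lebesgue measure is determined by these intervals. *)
Lemma lebesgue_measure_affine {R : realType} (c a : R) (A : set R) : 0 < c ->
  measurable A ->
  lebesgue_measure A =
  (c%:E * lebesgue_measure ((fun x => c * x + a)%R @^-1` A))%E.
Proof.
move=> c0 mA.
pose phi (x : measurableTypeR R) : measurableTypeR R := c * x + a.
have mphi : measurable_fun setT phi.
  by apply: measurable_funD => //; apply: measurable_funM.
have c0' : 0 <= c by exact: ltW.
pose m := mscale (NngNum c0') (pushforward_measure lebesgue_measure mphi).
suff H : forall X, ocitv X -> lebesgue_measure X = m X.
  exact: (lebesgue_measure_unique H mA).
move=> X [[u v] _ <-].
rewrite /m /mscale/= /pushforward/=.
have -> : (fun x : R => c * x + a) @^-1` `]u, v]%classic =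
    `](u - a) / c, (v - a) / c]%classic.
  apply/seteqP; split=> x /=; rewrite !in_itv/= => /andP[h1 h2]; apply/andP; split.
  - by rewrite ltr_pdivrMr//; lra.
  - by rewrite ler_pdivlMr//; lra.
  - by move: h1; rewrite ltr_pdivrMr//; lra.
  - by move: h2; rewrite ler_pdivlMr//; lra.
rewrite !lebesgue_measure_itv/= !lte_fin ltr_pM2r ?invr_gt0// ltrBlDr subrK.
case: ifPn => _; last by rewrite mule0.
by rewrite -!EFinB -EFinM; congr EFin; field; exact: lt0r_neq0.
Qed.

Section translation.
Context {R : realType}.

Lemma measurable_shift_rV n (a : 'rV[R]_n) :
  measurable_fun [set: 'rV[R]_n] (fun x => x + a).
Proof.
apply: measurable_fun_coordP => i; under eq_fun do rewrite mxE.
by apply: measurable_funD => //; exact: measurable_coord.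
Qed.

(** Induction on the dimension: on rectangles the shifted product measure splits into two shifted
    factors, and the product measure is determined by its rectangles. *)
Lemma lebesgue_rV_shift n (a : 'rV[R]_n) (A : set 'rV[R]_n) : measurable A ->
  lebesgue_rV n ((fun x => x + a) @^-1` A) = lebesgue_rV n A.
Proof.
elim: n a A => [|n IH] a A mA.
  congr (lebesgue_rV 0 _); apply/funext => x /=; congr A.
  by apply/rowP => -[].
rewrite /= /lebesgue_step /pushforward.
pose a0 := (uncons_rV a).1; pose a1 := (uncons_rV a).2.
pose s (p : measurableTypeR R * 'rV[R]_n) : measurableTypeR R * 'rV[R]_n :=
  (p.1 + a0, p.2 + a1).
have ms : measurable_fun setT s.
  apply/measurable_fun_pair => /=.
    by apply: measurable_funD => //; exact: measurable_fst.
  exact: (measurableT_comp (measurable_shift_rV a1) measurable_snd).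
have mA' : measurable (@cons_rV R n @^-1` A).
  by rewrite -[X in measurable X]setTI; exact: measurable_cons_rV.
have -> : @cons_rV R n @^-1` ((fun x => x + a) @^-1` A) =
    s @^-1` (@cons_rV R n @^-1` A).
  apply/funext => p /=; congr A; apply/rowP => i; have [j|] := unliftP ord0 i => ->.
    by rewrite mxE !cons_rVS !mxE.
  by rewrite mxE !cons_rV0.
apply/esym.
apply: (@product_measure_unique _ _ _ _ _ lebesgue_measure (lebesgue_rV n)
  (pushforward_measure (lebesgue_measure \x lebesgue_rV n)%E ms)) => // X Y mX mY.
rewrite [LHS](_ : _ = (lebesgue_measure \x lebesgue_rV n)%E
  (((fun x => x + a0) @^-1` X) `*` ((fun x => x + a1) @^-1` Y)))//.
have mX' : measurable ((fun x : measurableTypeR R => x + a0 : measurableTypeR R) @^-1` X).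
  rewrite -[X in measurable X]setTI.
  have : measurable_fun [set: measurableTypeR R]
    (fun x : measurableTypeR R => x + a0 : measurableTypeR R) by exact: measurable_funD.
  by apply.
rewrite product_measure1E//; last first.
  by rewrite -[X in measurable X]setTI; exact: measurable_shift_rV.
rewrite IH//; congr (_ * _)%E.
rewrite [RHS](@lebesgue_measure_affine R 1 a0)// mul1e.
by under [in RHS]eq_fun do rewrite mul1r.
Qed.

End translation.

(** * Integrals of bounded functions with bounded support *)

Section locally_bounded.
Context d {T : measurableType d} {R : realType} (N : T -> R).
Implicit Types (f g : T -> R).

(* N plays the role of a norm: [lbm] means locally bounded and measurable,
   [bcs] moreover that the support is bounded. *)
Definition lbm f := measurable_fun [set: T] f /\
  forall M, exists C, forall x, N x <= M -> `|f x| <= C.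

Definition bcs f := lbm f /\ exists M, forall x, M < N x -> f x = 0.

Lemma lbm_cst c : lbm (fun=> c).
Proof. by split => // M; exists `|c|. Qed.

Lemma lbmD f g : lbm f -> lbm g -> lbm (fun x => f x + g x).
Proof.
move=> [mf bf] [mg bg]; split; first exact: measurable_funD.
move=> M; have [C fC] := bf M; have [C' gC'] := bg M; exists (C + C') => x xM.
by rewrite (le_trans (ler_normD _ _))// lerD ?fC ?gC'.
Qed.

Lemma lbmN f : lbm f -> lbm (fun x => - f x).
Proof.
move=> [mf bf]; split; first exact: measurableT_comp.
by move=> M; have [C fC] := bf M; exists C => x /fC; rewrite normrN.
Qed.

Lemma lbmB f g : lbm f -> lbm g -> lbm (fun x => f x - g x).
Proof. by move=> lf lg; apply: lbmD => //; exact: lbmN. Qed.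

Lemma lbmM f g : lbm f -> lbm g -> lbm (fun x => f x * g x).
Proof.
move=> [mf bf] [mg bg]; split; first exact: measurable_funM.
move=> M; have [C fC] := bf M; have [C' gC'] := bg M; exists (C * C') => x xM.
by rewrite normrM ler_pM ?fC ?gC'.
Qed.

Lemma lbmX f k : lbm f -> lbm (fun x => f x ^+ k).
Proof.
move=> lf; elim: k => [|k IH]; first exact: lbm_cst.
by under eq_fun do rewrite exprS; exact: lbmM.
Qed.

Lemma lbm_norm f : lbm f -> lbm (fun x => `|f x|).
Proof.
move=> [mf bf]; split; first exact: measurableT_comp.
by move=> M; have [C fC] := bf M; exists C => x /fC; rewrite normr_id.
Qed.

Lemma bcs_lbm f : bcs f -> lbm f. Proof. by case. Qed.

Lemma bcsMl f g : lbm f -> bcs g -> bcs (fun x => f x * g x).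
Proof.
move=> lf [lg [M gM]]; split; first exact: lbmM.
by exists M => x /gM ->; rewrite mulr0.
Qed.

Lemma bcsMr f g : bcs f -> lbm g -> bcs (fun x => f x * g x).
Proof. by move=> bf lg; under eq_fun do rewrite mulrC; exact: bcsMl. Qed.

Lemma bcsZ c f : bcs f -> bcs (fun x => c * f x).
Proof. by apply: bcsMl; exact: lbm_cst. Qed.

Lemma bcs0 : bcs (fun=> 0).
Proof. by split; [exact: lbm_cst|exists 0]. Qed.

Lemma bcsD f g : bcs f -> bcs g -> bcs (fun x => f x + g x).
Proof.
move=> [lf [M fM]] [lg [M' gM']]; split; first exact: lbmD.
by exists (Num.max M M') => x; rewrite gt_max => /andP[/fM -> /gM' ->]; rewrite addr0.
Qed.

Lemma bcsN f : bcs f -> bcs (fun x => - f x).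
Proof.
move=> [lf [M fM]]; split; first exact: lbmN.
by exists M => x /fM ->; rewrite oppr0.
Qed.

Lemma bcsB f g : bcs f -> bcs g -> bcs (fun x => f x - g x).
Proof. by move=> lf lg; apply: bcsD => //; exact: bcsN. Qed.

Lemma bcs_norm f : bcs f -> bcs (fun x => `|f x|).
Proof.
move=> [lf [M fM]]; split; first exact: lbm_norm.
by exists M => x /fM ->; rewrite normr0.
Qed.

Lemma bcsX f k : bcs f -> bcs (fun x => f x ^+ k.+1).
Proof. by move=> bf; under eq_fun do rewrite exprS; apply: bcsMr => //; apply/lbmX/bcs_lbm. Qed.

Lemma bcs_sum (I : Type) (s : seq I) (P : pred I) (F : I -> T -> R) :
  (forall i, bcs (F i)) -> bcs (fun x => \sum_(i <- s | P i) F i x).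
Proof.
move=> lF; elim: s => [|i s IH]; first by under eq_fun do rewrite big_nil; exact: bcs0.
under eq_fun do rewrite big_cons; case: (P i) => //.
by apply: bcsD.
Qed.

Lemma bcs_bounded f : bcs f -> exists2 C, 0 < C & forall x, `|f x| <= C.
Proof.
move=> [[_ bf] [M fM]]; have [C fC] := bf M; exists (Num.max C 1).
  by rewrite lt_max ltr01 orbT.
move=> x; rewrite le_max; have [/fC ->//|/fM ->] := leP (N x) M.
by rewrite normr0 ler01 orbT.
Qed.

Lemma bcs_le f g : measurable_fun setT f -> bcs g -> (forall x, `|f x| <= `|g x|) -> bcs f.
Proof.
move=> mf [[_ bg] [M gM]] fg; split; first split => //.
  by move=> K; have [C gC] := bg K; exists C => x /gC; exact: le_trans (fg x).
by exists M => x /gM g0; apply/eqP; rewrite -normr_le0 (le_trans (fg x))// g0 normr0.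
Qed.

End locally_bounded.

(** What [N] must satisfy for [bcs] functions to be integrable. The instances are the absolute
    value, the norm [nrm] and their maxima on products. *)
Definition sized d (T : measurableType d) (R : realType)
    (mu : {measure set T -> \bar R}) (N : T -> R) :=
  measurable_fun setT N /\ forall M, (mu [set x | (N x <= M)%R] < +oo)%E.

Section sized_integral.
Context d {T : measurableType d} {R : realType} (mu : {measure set T -> \bar R}).
Variable N : T -> R.
Hypothesis sN : sized mu N.
Implicit Types (f g : T -> R).

Lemma measurable_sublevel M : measurable [set x | N x <= M].
Proof.
have [mN _] := sN; have := mN measurableT `]-oo, M]%classic (measurable_itv _).
by rewrite setTI; congr measurable; apply/funext => x /=; rewrite in_itv.
Qed.

Lemma bcs_integrable f : bcs N f -> mu.-integrable setT (EFin \o f).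
Proof.
move=> bf; have [[mf _] [M fM]] := bf; have [C C0 fC] := bcs_bounded bf.
have mB := measurable_sublevel M.
have : mu.-integrable [set x | N x <= M] (EFin \o f).
  apply: (measurable_bounded_integrable mB); [exact: sN.2|exact: measurable_funTS|].
  by exists C; split; [exact: num_real|move=> y Cy x _; exact: le_trans (ltW Cy)].
rewrite (integrable_mkcond _ mB) => h; apply: eq_integrable h => // x _.
rewrite patchE; case: ifPn => // /negP; rewrite inE /= => /negP.
by rewrite -ltNge /= => /fM ->.
Qed.

Local Notation I := (Rintegral mu setT).

Lemma intD f g : bcs N f -> bcs N g -> I (fun x => f x + g x) = I f + I g.
Proof. by move=> bf bg; apply: RintegralD => //; exact: bcs_integrable. Qed.

Lemma intB f g : bcs N f -> bcs N g -> I (fun x => f x - g x) = I f - I g.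
Proof. by move=> bf bg; apply: RintegralB => //; exact: bcs_integrable. Qed.

Lemma intZ c f : bcs N f -> I (fun x => c * f x) = c * I f.
Proof. by move=> bf; apply: RintegralZl => //; exact: bcs_integrable. Qed.

Lemma intZr c f : bcs N f -> I (fun x => f x * c) = I f * c.
Proof. by move=> bf; apply: RintegralZr => //; exact: bcs_integrable. Qed.

Lemma intN f : bcs N f -> I (fun x => - f x) = - I f.
Proof. by move=> bf; under eq_fun do rewrite -mulN1r; rewrite intZ// mulN1r. Qed.

Lemma int0 : I (fun=> 0) = 0.
Proof. by rewrite Rintegral_cst// mul0r. Qed.

Lemma int_sum (J : Type) (s : seq J) (P : pred J) (F : J -> T -> R) :
  (forall i, bcs N (F i)) ->
  I (fun x => \sum_(i <- s | P i) F i x) = \sum_(i <- s | P i) I (F i).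
Proof.
move=> bF; elim: s => [|i s IH].
  by under eq_fun do rewrite big_nil; rewrite int0 big_nil.
rewrite big_cons; under eq_fun do rewrite big_cons; case: (P i) => //.
by rewrite intD ?IH//; exact: bcs_sum.
Qed.

Lemma int_ge0 f : (forall x, 0 <= f x) -> 0 <= I f.
Proof. by move=> f0; apply: Rintegral_ge0. Qed.

Lemma le_int f g : bcs N f -> bcs N g -> (forall x, f x <= g x) -> I f <= I g.
Proof. by move=> bf bg fg; apply: le_Rintegral => //; exact: bcs_integrable. Qed.

Lemma EFin_int f : bcs N f -> (I f)%:E = (\int[mu]_x (f x)%:E)%E.
Proof.
by move=> bf; rewrite fineK//; apply: integrable_fin_num => //; exact: bcs_integrable.
Qed.

Lemma int_norm f : bcs N f -> `|I f| <= I (fun x => `|f x|).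
Proof. by move=> bf; apply: le_normr_Rintegral => //; exact: bcs_integrable. Qed.

End sized_integral.

(** * Fubini for bounded functions with bounded support *)

Section sized_prod.
Context d1 d2 {T1 : measurableType d1} {T2 : measurableType d2} {R : realType}.
Variables (m1 : {sigma_finite_measure set T1 -> \bar R})
  (m2 : {sigma_finite_measure set T2 -> \bar R}).
Variables (N1 : T1 -> R) (N2 : T2 -> R).
Hypotheses (s1 : sized m1 N1) (s2 : sized m2 N2).

(** The maximum makes the sublevel sets rectangles, so that [sized] passes to products. *)
Definition maxN (p : T1 * T2) := Num.max (N1 p.1) (N2 p.2).

Lemma sized_prod : sized (m1 \x m2)%E maxN.
Proof.
split.
  have [h1 _] := s1; have [h2 _] := s2.
  apply: measurable_maxr; first exact: (measurableT_comp h1 measurable_fst).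
  exact: (measurableT_comp h2 measurable_snd).
move=> M.
rewrite (_ : [set _ | _] = [set x | N1 x <= M] `*` [set x | N2 x <= M]); last first.
  by apply/seteqP; split => -[x y]/=; rewrite /maxN/= ge_max => /andP.
have m1M := measurable_sublevel s1 M; have m2M := measurable_sublevel s2 M.
rewrite [X in (X < _)%E](product_measure1E m1 m2 m1M m2M); apply: lte_mul_pinfty => //; last exact: s2.2.
by rewrite ge0_fin_numE//; exact: s1.2.
Qed.

Local Notation J1 := (Rintegral m1 setT).
Local Notation J2 := (Rintegral m2 setT).

Lemma bcs_xsection k x : bcs maxN k -> bcs N2 (fun y => k (x, y)).
Proof.
move=> [[mk bk] [M kM]]; split; first split.
- exact: measurableT_comp.
- move=> L; have [C kC] := bk (Num.max L (N1 x)); exists C => y yL; apply: kC.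
  by rewrite /maxN/= ge_max !le_max yL lexx orbT.
- by exists M => y My; apply: kM; rewrite /maxN/= lt_max My orbT.
Qed.

Lemma bcs_ysection k y : bcs maxN k -> bcs N1 (fun x => k (x, y)).
Proof.
move=> [[mk bk] [M kM]]; split; first split.
- exact: measurableT_comp.
- move=> L; have [C kC] := bk (Num.max L (N2 y)); exists C => x xL; apply: kC.
  by rewrite /maxN/= ge_max !le_max xL lexx orbT.
- by exists M => x My; apply: kM; rewrite /maxN/= lt_max My.
Qed.

(** Measurability of the partial integral comes from Fubini, its bound from the uniform bound on [k]
    times the measure of one sublevel set of [N2]. *)
Lemma bcs_int k : bcs maxN k -> bcs N1 (fun x => J2 (fun y => k (x, y))).
Proof.
move=> bk; have ik := bcs_integrable sized_prod bk.
have mF := measurable_fubini_F ik.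
have [[_ bdk] [M kM]] := bk; have [C C0 kC] := bcs_bounded bk.
split; first split.
- exact: (measurableT_comp (fine_measurable measurableT) mF).
- move=> L; pose B := [set y | N2 y <= M].
  exists (C * fine (m2 B)) => x _.
  have bx := bcs_xsection x bk.
  have h : Rintegral m2 setT (fun y => k (x, y)) = \int[m2]_(y in B) k (x, y).
    rewrite [RHS]Rintegral_mkcond; congr Rintegral; apply/funext => y.
    rewrite patchE; case: ifPn => // /negP; rewrite inE /= => /negP; rewrite -ltNge => My.
    by apply: kM; rewrite /maxN/= lt_max My orbT.
  have mB : measurable B by exact: measurable_sublevel s2 M.
  have iB : m2.-integrable B (EFin \o (fun y => k (x, y))).
    by apply: integrableS (bcs_integrable s2 bx).
  rewrite h (le_trans (le_normr_Rintegral mB iB))// -Rintegral_cst//.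
  apply: le_Rintegral => //; first exact: (integrable_norm iB).
  apply: (measurable_bounded_integrable mB); [exact: s2.2|by []|].
  by exists C; split; [exact: num_real|move=> z Cz y _; rewrite /cst ger0_norm ltW].
- exists M => x Mx; rewrite -(int0 m2); congr Rintegral; apply/funext => y.
  by apply: kM; rewrite /maxN/= lt_max Mx.
Qed.

Lemma bcs_swap k : bcs maxN k ->
  bcs (fun p : T2 * T1 => Num.max (N2 p.1) (N1 p.2)) (fun p => k (p.2, p.1)).
Proof.
move=> [[mk bk] [M kM]]; split; first split.
- by apply: measurableT_comp mk _; exact: measurable_swap.
- move=> L; have [C kC] := bk L; exists C => -[x y]/= h; apply: kC.
  by rewrite /maxN/= maxC.
- by exists M => -[x y]/= h; apply: kM; rewrite /maxN/= maxC.
Qed.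

Lemma int_prod k : bcs maxN k ->
  Rintegral (m1 \x m2)%E setT k = J1 (fun x => J2 (fun y => k (x, y))).
Proof.
move=> bk; have ik := bcs_integrable sized_prod bk.
rewrite /Rintegral -integral12_prod_meas1//; congr fine.
apply: eq_integral => x _.
by rewrite -/(Rintegral _ _ _) (EFin_int s2)//; exact: bcs_xsection.
Qed.

Lemma int_fubini k : bcs maxN k ->
  J1 (fun x => J2 (fun y => k (x, y))) = J2 (fun y => J1 (fun x => k (x, y))).
Proof.
move=> bk; have ik := bcs_integrable sized_prod bk.
rewrite -int_prod// /Rintegral -integral21_prod_meas1//; congr fine.
apply: eq_integral => x _.
by rewrite -/(Rintegral _ _ _) (EFin_int s1)//; exact: bcs_ysection.
Qed.

End sized_prod.

Lemma lbm_fst d1 d2 (T1 : measurableType d1) (T2 : measurableType d2)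
    (R : realType) (N1 : T1 -> R) (N2 : T2 -> R) f :
  lbm N1 f -> lbm (maxN N1 N2) (fun p => f p.1).
Proof.
move=> [mf bf]; split; first exact: (measurableT_comp mf measurable_fst).
move=> M; have [C fC] := bf M; exists C => -[x y]; rewrite /maxN/= ge_max.
by move=> /andP[xM _]; exact: fC.
Qed.

Lemma lbm_snd d1 d2 (T1 : measurableType d1) (T2 : measurableType d2)
    (R : realType) (N1 : T1 -> R) (N2 : T2 -> R) f :
  lbm N2 f -> lbm (maxN N1 N2) (fun p => f p.2).
Proof.
move=> [mf bf]; split; first exact: (measurableT_comp mf measurable_snd).
move=> M; have [C fC] := bf M; exists C => -[x y]; rewrite /maxN/= ge_max.
by move=> /andP[_ yM]; exact: fC.
Qed.

Definition nrm {R : realType} {n} (x : 'rV[R]_n) : R := `|x|.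

Notation Int f := (Rintegral (lebesgue_rV _) setT f).

(** * Integration over row vectors *)

Section rV_integral.
Context {R : realType}.

Lemma norm_cons_rV n (p : measurableTypeR R * 'rV[R]_n) :
  `|cons_rV p| = Num.max `|p.1 : R| `|p.2|.
Proof.
apply/eqP; rewrite eq_le; apply/andP; split.
  apply: rV_norm_le; first by rewrite le_max normr_ge0.
  move=> i; have [j|] := unliftP ord0 i => ->.
    by rewrite cons_rVS le_max ler_coord_norm orbT.
  by rewrite cons_rV0 le_max lexx.
rewrite ge_max; apply/andP; split.
  by rewrite -(cons_rV0 p); exact: ler_coord_norm.
apply: rV_norm_le => // i; rewrite -(cons_rVS p); exact: ler_coord_norm.
Qed.

Lemma sized_lebesgue :
  sized (@lebesgue_measure R) (fun x : measurableTypeR R => `|x : R|).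
Proof.
split; first exact: measurableT_comp.
move=> M; have -> : [set x : measurableTypeR R | `|x : R| <= M] = `[-M, M]%classic.
  by apply/seteqP; split => x /=; rewrite in_itv/= ler_norml.
by rewrite /= lebesgue_measure_itv/=; case: ifPn => // _; rewrite -EFinB ltry.
Qed.

Lemma measurable_norm_rV n : measurable_fun [set: 'rV[R]_n] nrm.
Proof. by apply: continuous_measurable_rV; exact: norm_continuous. Qed.

Lemma sized_rV n : sized (@lebesgue_rV R n) nrm.
Proof.
elim: n => [|n IH]; split; try exact: measurable_norm_rV.
  by move=> M; rewrite /= diracE ltry.
move=> M; rewrite /= /lebesgue_step /pushforward.
have -> : @cons_rV R n @^-1` [set x | nrm x <= M] =
   [set x | maxN (fun x : measurableTypeR R => `|x : R|) nrm x <= M].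
  by apply/funext => p /=; rewrite /nrm norm_cons_rV.
exact: (sized_prod sized_lebesgue IH).2.
Qed.

Lemma lbm_coord n (i : 'I_n) : lbm (@nrm R n) (fun x => x ord0 i).
Proof.
split; first exact: measurable_coord.
by move=> M; exists M => x; apply: le_trans; exact: ler_coord_norm.
Qed.

Lemma lbm_shift n f (a : 'rV[R]_n) : lbm nrm f -> lbm nrm (fun x => f (x + a)).
Proof.
move=> [mf bf]; split; first exact: (measurableT_comp mf (measurable_shift_rV a)).
move=> M; have [C fC] := bf (M + `|a|); exists C => x xM; apply: fC.
by rewrite /nrm (le_trans (ler_normD _ _))// lerD2r.
Qed.

Lemma bcs_shift n f (a : 'rV[R]_n) : bcs nrm f -> bcs nrm (fun x => f (x + a)).
Proof.
move=> [lf [M fM]]; split; first exact: lbm_shift.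
exists (M + `|a|) => x; rewrite -ltrBrDr => xM; apply: fM; apply: (lt_le_trans xM).
by rewrite lerBlDr; have := ler_normB (x + a) a; rewrite addrK.
Qed.

Lemma measurable_subp n :
  measurable_fun [set: 'rV[R]_n * 'rV[R]_n] (fun p => p.1 - p.2).
Proof.
apply: measurable_fun_coordP => i; under eq_fun do rewrite !mxE.
apply: measurable_funB.
  exact: (measurableT_comp (measurable_coord i) measurable_fst).
exact: (measurableT_comp (measurable_coord i) measurable_snd).
Qed.

Lemma lbm_sub n (f : 'rV[R]_n -> R) : lbm nrm f -> lbm (maxN nrm nrm) (fun p => f (p.1 - p.2)).
Proof.
move=> [mf bf]; split; first exact: (measurableT_comp mf (@measurable_subp n)).
move=> M; have [C fC] := bf (M + M); exists C => -[x y].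
rewrite /maxN/= ge_max => /andP[xM yM]; apply: fC.
by rewrite /nrm (le_trans (ler_normB _ _))// lerD.
Qed.

(** Neither factor alone has bounded support in the product; together they do, since |y| <= |x - y|
    + |x|. *)
Lemma bcs_sub1 n (k f : 'rV[R]_n -> R) : bcs nrm k -> bcs nrm f ->
  bcs (maxN nrm nrm) (fun p => k (p.1 - p.2) * f p.1).
Proof.
move=> [lk [K kK]] [lf [M fM]]; split.
  by apply: lbmM; [exact: lbm_sub|exact: lbm_fst].
exists (K + M + M) => -[x y]; rewrite /maxN/= => h.
have [Mx|xM] := ltP M (nrm x); first by rewrite fM ?mulr0.
have [Kx|xK] := ltP K (nrm (x - y)); first by rewrite kK ?mul0r.
move: h; rewrite ltNge ge_max; have := normr_ge0 (x - y); have := normr_ge0 x.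
rewrite -/(nrm x) -/(nrm (x - y)) => x0 xy0.
have yx : nrm y <= nrm (x - y) + nrm x.
  by have := ler_normB x (x - y); rewrite subKr addrC.
by move=> /negP[]; apply/andP; split; lra.
Qed.

Lemma bcs_sub2 n (k f : 'rV[R]_n -> R) : bcs nrm k -> bcs nrm f ->
  bcs (maxN nrm nrm) (fun p => k (p.1 - p.2) * f p.2).
Proof.
move=> [lk [K kK]] [lf [M fM]]; split.
  by apply: lbmM; [exact: lbm_sub|exact: lbm_snd].
exists (K + M + M) => -[x y]; rewrite /maxN/= => h.
have [Mx|xM] := ltP M (nrm y); first by rewrite fM ?mulr0.
have [Kx|xK] := ltP K (nrm (x - y)); first by rewrite kK ?mul0r.
move: h; rewrite ltNge ge_max; have := normr_ge0 (x - y); have := normr_ge0 y.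
rewrite -/(nrm y) -/(nrm (x - y)) => x0 xy0.
have yx : nrm x <= nrm (x - y) + nrm y.
  by have := ler_normD (x - y) y; rewrite subrK.
by move=> /negP[]; apply/andP; split; lra.
Qed.

Lemma lbm_continuous n (f : 'rV[R]_n -> R) : continuous f -> lbm nrm f.
Proof.
move=> cf; split; first exact: continuous_measurable_rV.
move=> M; have cB : compact [set x : 'rV[R]_n | `|x| <= M].
  apply: bounded_closed_compact.
    by exists M; split; [exact: num_real|move=> r Mr x /= /le_trans; apply; exact: ltW].
  rewrite (_ : [set _ | _] = (fun x : 'rV[R]_n => `|x|) @^-1` [set r | r <= M])//.
  apply: closed_comp; last exact: closed_le.
  by move=> x _; exact: norm_continuous.
have /compact_bounded[C [_ hC]] : compact (f @` [set x | `|x| <= M]).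
  by apply: continuous_compact cB; exact: continuous_subspaceT.
exists (C + 1) => x xM; apply: (hC (C + 1)); first by rewrite ltrDl ltr01.
by exists x.
Qed.

Lemma int_shift n (f : 'rV[R]_n -> R) a : bcs nrm f -> Int (fun x => f (x + a)) = Int f.
Proof.
move=> bf; have bfa := bcs_shift a bf; have [[mf _] _] := bf.
have i1 := bcs_integrable (sized_rV n) bfa.
rewrite /Rintegral; congr fine; apply/esym.
rewrite [LHS](eq_measure_integral
    (pushforward_measure (lebesgue_rV n) (measurable_shift_rV a))).
  rewrite [LHS](@integral_pushforward _ _ _ _ _ _ (measurable_shift_rV a)
    (lebesgue_rV n) _ (EFin \o f))//; exact/measurable_EFinP.
by move=> A mA _; rewrite -[LHS](lebesgue_rV_shift a mA).
Qed.

Lemma bcs_cons n (f : 'rV[R]_n.+1 -> R) : bcs nrm f ->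
  bcs (maxN (fun x : measurableTypeR R => `|x : R|) nrm) (fun p => f (cons_rV p)).
Proof.
move=> [[mf bf] [M fM]]; split; first split.
- exact: (measurableT_comp mf (@measurable_cons_rV _ n)).
- move=> K; have [C fC] := bf K; exists C => p pK; apply: fC.
  by rewrite /nrm norm_cons_rV.
- by exists M => p Mp; apply: fM; rewrite /nrm norm_cons_rV.
Qed.

Lemma int_cons n (f : 'rV[R]_n.+1 -> R) : bcs nrm f ->
  Int f = Rintegral (@lebesgue_measure R) setT (fun a => Int (fun y => f (cons_rV (a, y)))).
Proof.
move=> bf; have bfc := bcs_cons bf; have [[mf _] _] := bf.
have sp := sized_prod sized_lebesgue (sized_rV n).
rewrite -[RHS](int_prod sized_lebesgue (sized_rV n) bfc).
rewrite /Rintegral; congr fine.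
have ii := bcs_integrable sp bfc.
apply: (@integral_pushforward _ _ _ _ _ _ (@measurable_cons_rV R n)
  (lebesgue_measure \x lebesgue_rV n)%E _ (EFin \o f)) => //.
exact/measurable_EFinP.
Qed.

Lemma bcs_indic n (K : set 'rV[R]_n) M : measurable K -> (forall x, K x -> nrm x <= M) ->
  bcs nrm (\1_K : 'rV[R]_n -> R).
Proof.
move=> mK KM; split; first split; first by exact: measurable_indic.
  by move=> L; exists 1 => x _; rewrite indicE ger0_norm ?lern1 ?leq_b1.
exists M => x Mx; rewrite indicE memNset//= => /KM; by rewrite leNgt Mx.
Qed.

End rV_integral.

(** * The Prekopa-Leindler inequality *)

Section brunn_minkowski.
Context {R : realType}.
Notation leb := (@lebesgue_measure R).
Implicit Types A B C : set R.

Lemma lebesgue_measure_addr (a : R) A : measurable A ->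
  leb ((fun x => x + a) @^-1` A) = leb A.
Proof.
move=> mA; rewrite [RHS](@lebesgue_measure_affine R 1 a)// mul1e.
by under [in RHS]eq_fun do rewrite mul1r.
Qed.

Lemma measurable_addr (a : R) A : measurable A -> measurable ((fun x => x + a) @^-1` A).
Proof.
move=> mA; rewrite -[X in measurable X]setTI.
have : measurable_fun [set: R] (fun x : R => x + a) by exact: measurable_funD.
by apply.
Qed.

(** Translating [A] by min [B] and [B] by max [A] puts both into [C], with [A] to the left. The
    translates share at most the point max [A] + min [B], which is why the maximum is removed from
    [A], at no cost in measure. *)
Lemma brunn_minkowski_compact A B C : compact A -> compact B -> measurable C ->
  A !=set0 -> B !=set0 -> (forall x y, A x -> B y -> C (x + y)) ->
  (leb A + leb B <= leb C)%E.
Proof.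
move=> cA cB mC A0 B0 ABC.
have cid (X : set R) : {within X, continuous (@id R)}.
  by apply: continuous_subspaceT => x; exact: cvg_id.
have [m Am mP] := compact_EVT_max A0 cA (cid A).
have [l Bl lP] := compact_EVT_min B0 cB (cid B).
move: Am Bl => /set_mem Am /set_mem Bl.
have mA := compact_measurable cA; have mB := compact_measurable cB.
have mAm : measurable (A `\` [set m]) by exact: measurableD.
have -> : leb A = leb (A `\` [set m]).
  rewrite (measureDI leb mA (measurable_set1 m)).
  rewrite (@subset_measure0 _ _ _ leb (A `&` [set m]) [set m]) ?adde0//.
  - exact: measurableI.
  - by have := lebesgue_measure_set1 m.
rewrite -(lebesgue_measure_addr (- l) mAm) -(lebesgue_measure_addr (- m) mB).
have m1 := measurable_addr (- l) mAm; have m2 := measurable_addr (- m) mB.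
rewrite -measureU//.
  apply: le_measure; rewrite ?inE//; first exact: measurableU.
  move=> x [[/= Ax _]|/= Bx]; first by have := ABC _ _ Ax Bl; rewrite subrK.
  by have := ABC _ _ Am Bx; rewrite addrC subrK.
apply/seteqP; split => // x [[/= Ax xm] /= Bx]; apply: xm.
have := mP _ (mem_set Ax); have := lP _ (mem_set Bx); move=> /= h1 h2.
by apply/eqP; rewrite eq_le h2 /=; lra.
Qed.

Lemma brunn_minkowski1 A B C : measurable A -> measurable B -> measurable C ->
  (leb A < +oo)%E -> (leb B < +oo)%E ->
  A !=set0 -> B !=set0 -> (forall x y, A x -> B y -> C (x + y)) ->
  (leb A + leb B <= leb C)%E.
Proof.
move=> mA mB mC fA fB [a Aa] [b Bb] ABC; apply/lee_addgt0Pr => e e0.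
have e2 : 0 < e / 2 by rewrite divr_gt0.
have [V [cV VA Ve]] := lebesgue_regularity_inner mA fA e2.
have [W [cW WB We]] := lebesgue_regularity_inner mB fB e2.
(* A compact inner approximation may be empty; adding a point of the set keeps it compact and makes
   it nonempty. *)
have aux X (Y : set R) x : measurable X -> compact Y -> (leb (X `\` Y) < (e / 2)%:E)%E ->
    (leb X <= leb (Y `|` [set x]) + (e / 2)%:E)%E.
  move=> mX cY Xe; have mY := compact_measurable cY.
  have mYx : measurable (Y `|` [set x]) by exact: measurableU.
  rewrite (measureDI leb mX mYx) addeC; apply: leeD.
    by apply: le_measure; rewrite ?inE//; exact: measurableI.
  apply: le_trans (ltW Xe); apply: le_measure; rewrite ?inE//.
  - exact: measurableD.
  - exact: measurableD.
  - by move=> z [Xz nz]; split => // Yz; apply: nz; left.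
have := leeD (aux A V a mA cV Ve) (aux B W b mB cW We).
rewrite addeACA -EFinD -splitr => /le_trans; apply; rewrite leeD2r//.
apply: brunn_minkowski_compact => //.
- by apply: compactU => //; exact: compact_set1.
- by apply: compactU => //; exact: compact_set1.
- by exists a; right.
- by exists b; right.
- by move=> x y [/VA Ax|->] [/WB By|->]; exact: ABC.
Qed.

End brunn_minkowski.

(** Averages the tangent inequality m (1 + ln x - ln m) <= x at x = a and x = b, where m is the
    geometric mean: the logarithms then cancel. *)
Lemma amgm (R : realType) (t a b : R) : 0 < t < 1 -> 0 <= a -> 0 <= b ->
  a `^ (1 - t) * b `^ t <= (1 - t) * a + t * b.
Proof.
move=> /andP[t0 t1]; have t1' : 0 < 1 - t by rewrite subr_gt0.
rewrite le0r => /orP[/eqP->|a0] b0.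
  by rewrite powR0 ?gt_eqF// mul0r mulr0 add0r mulr_ge0// ltW.
move: b0; rewrite le0r => /orP[/eqP->|b0].
  by rewrite powR0 ?gt_eqF// !mulr0 addr0 mulr_ge0// ltW.
set m := a `^ (1 - t) * b `^ t.
have m0 : 0 < m by rewrite mulr_gt0 ?powR_gt0.
have lnm : ln m = (1 - t) * ln a + t * ln b.
  by rewrite lnM ?posrE ?powR_gt0// !ln_powR.
have H x : 0 < x -> m * (1 + (ln x - ln m)) <= x.
  move=> x0; rewrite -[leRHS](@divfK _ m) ?gt_eqF// [leRHS]mulrC ler_pM2l//.
  by rewrite -[leRHS]lnK ?posrE ?divr_gt0// ln_div ?posrE// expR_ge1Dx.
have := H _ a0; have := H _ b0 => Hb Ha.
have -> : m = (1 - t) * (m * (1 + (ln a - ln m))) + t * (m * (1 + (ln b - ln m))).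
  by rewrite lnm; ring.
by rewrite lerD// ler_pM2l.
Qed.

(** * The one-dimensional inequality through superlevel sets *)

Section layer_cake.
Context {R : realType}.
Notation mR := (measurableTypeR R).
Notation leb := (@lebesgue_measure R).
Definition absR (x : mR) : R := `|x : R|.
Implicit Types (f g h : mR -> R).

(** Levels are measured relative to [A] and confined to the interval from 0 to 1. Integrating over
    the level gives the truncation min 1 (f / A), which is f / A when [A] is the supremum;
    integrating over the point gives the measure of a superlevel set. *)
Definition subgraph (A : R) f : set (mR * mR) :=
  [set p | [/\ (0 : R) < p.2, (p.2 : R) < 1 & (p.2 : R) * A < f p.1]].

Lemma measurable_subgraph A f : measurable_fun setT f -> measurable (subgraph A f).
Proof.
move=> mf; have ms : measurable_fun [set: mR * mR] snd by exact: measurable_snd.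
have md : measurable_fun [set: mR * mR] (fun p => f p.1 - (p.2 : R) * A).
  apply: measurable_funB; first exact: (measurableT_comp mf measurable_fst).
  exact: measurable_funM.
have -> : subgraph A f = snd @^-1` `]0, 1[%classic `&`
    (fun p => f p.1 - (p.2 : R) * A) @^-1` `]0, +oo[%classic.
  apply/seteqP; split => p /=; rewrite !in_itv/= andbT subr_gt0.
    by move=> [a b c]; rewrite a b c.
  by move=> [/andP[a b] c].
apply: measurableI; rewrite -[X in measurable X]setTI; [exact: ms|exact: md].
Qed.

Lemma bcs_subgraph A f : 0 < A -> bcs absR f ->
  bcs (maxN absR absR) (\1_(subgraph A f)).
Proof.
move=> A0 [[mf _] [M fM]]; split; first split.
- by apply: measurable_indic; exact: measurable_subgraph.
- by move=> K; exists 1 => p _; rewrite indicE ger0_norm ?lern1 ?leq_b1.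
- exists (Num.max M 1) => -[x s]; rewrite /maxN/= => h.
  rewrite indicE memNset//= => -[/= s0 s1 sA].
  move: h; rewrite lt_max !gt_max /absR (gtr0_norm s0) (lt_gtF s1) andbF orbF.
  by move=> /andP[/fM f0 _]; move: sA; rewrite f0 ltNge mulr_ge0// ltW.
Qed.

Lemma layer_cake A f x : 0 < A -> 0 <= f x ->
  Rintegral leb setT (fun s => \1_(subgraph A f) (x, s)) = Num.min 1 (f x / A).
Proof.
move=> A0 f0.
have -> : (fun s => \1_(subgraph A f) (x, s) : R) = \1_(`]0, Num.min 1 (f x / A)[%classic).
  apply/funext => s; rewrite !indicE; congr (_ _)%:R.
  apply/idP/idP => /set_mem/=; rewrite ?in_itv/= => h; apply/mem_set => /=.
    by case: h => /= s0 s1 sA; rewrite in_itv/= s0 lt_min s1 ltr_pdivlMr.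
  by move: h; rewrite lt_min => /and3P[s0 s1]; rewrite ltr_pdivlMr.
rewrite /Rintegral integral_indic//= setIT lebesgue_measure_itv/= lte_fin.
case: ifPn => [_|]; first by rewrite -EFinB/= subr0.
rewrite -leNgt => h; apply/eqP; rewrite eq_le h andbT le_min ler01/=.
by rewrite divr_ge0// ltW.
Qed.

Lemma superlevelE A f s : measurable_fun setT f -> 0 < s < 1 ->
  Rintegral leb setT (fun x => \1_(subgraph A f) (x, s)) =
  fine (leb [set x | s * A < f x]).
Proof.
move=> mf /andP[s0 s1].
have -> : (fun x => \1_(subgraph A f) (x, s) : R) = \1_[set x | s * A < f x].
  apply/funext => x; rewrite !indicE; congr (_ _)%:R.
  by apply/idP/idP => /set_mem/=; [move=> [/= _ _] h|move=> h]; apply/mem_set.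
rewrite /Rintegral integral_indic//= ?setIT//.
have := mf measurableT `]s * A, +oo[%classic (measurable_itv _).
by rewrite setTI; congr measurable; apply/funext => x /=; rewrite in_itv/= andbT.
Qed.

Lemma measurable_superlevel f c : measurable_fun setT f -> measurable [set x | c < f x].
Proof.
move=> mf; have := mf measurableT `]c, +oo[%classic (measurable_itv _).
by rewrite setTI; congr measurable; apply/funext => x /=; rewrite in_itv/= andbT.
Qed.

Lemma superlevel_lty f c : 0 <= c -> bcs absR f -> (leb [set x | (c < f x)%R] < +oo)%E.
Proof.
move=> c0 [[mf _] [M fM]].
apply: le_lt_trans ((@sized_lebesgue R).2 M); apply: le_measure; rewrite ?inE.
- exact: measurable_superlevel.
- exact: (measurable_sublevel (@sized_lebesgue R)).
- move=> x /= cx; rewrite leNgt; apply/negP => /fM f0.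
  by move: cx; rewrite f0 ltNge c0.
Qed.

(** The dilates (1 - t) A and t B are preimages under division, and [lebesgue_measure_affine] gives
    their measures. *)
Lemma brunn_minkowski_convex (t : R) (A B C : set mR) : 0 < t < 1 ->
  measurable A -> measurable B -> measurable C ->
  (leb A < +oo)%E -> (leb B < +oo)%E -> (leb C < +oo)%E ->
  A !=set0 -> B !=set0 -> (forall x y : R, A x -> B y -> C ((1 - t) * x + t * y)) ->
  (1 - t) * fine (leb A) + t * fine (leb B) <= fine (leb C).
Proof.
move=> /andP[t0 t1] mA mB mC fA fB fC [a Aa] [b Bb] ABC.
have t1' : 0 < 1 - t by rewrite subr_gt0.
have aux (c : R) (X : set mR) : 0 < c -> measurable X -> (leb X < +oo)%E ->
    [/\ measurable ((fun x : R => c^-1 * x + 0) @^-1` X),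
      leb ((fun x : R => c^-1 * x + 0) @^-1` X) = (c%:E * leb X)%E &
      (leb ((fun x : R => (c^-1 * x + 0)%R) @^-1` X) < +oo)%E].
  move=> c0 mX fX.
  have e : leb ((fun x : R => c^-1 * x + 0) @^-1` X) = (c%:E * leb X)%E.
    rewrite (@lebesgue_measure_affine R c^-1 0 X) ?invr_gt0// muleA -EFinM.
    by rewrite divff ?mul1e// gt_eqF.
  split=> //.
    rewrite -[X in measurable X]setTI.
    have : measurable_fun [set: R] (fun x : R => c^-1 * x + 0).
      by apply: measurable_funD => //; exact: measurable_funM.
    by apply.
  by rewrite e lte_mul_pinfty// ltW.
have [mA' eA fA'] := aux _ _ t1' mA fA; have [mB' eB fB'] := aux _ _ t0 mB fB.
have H : (leb ((fun x : R => (1 - t)^-1 * x + 0)%R @^-1` A) +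
    leb ((fun x : R => t^-1 * x + 0)%R @^-1` B) <= leb C)%E.
  apply: brunn_minkowski1 => //.
  - by exists ((1 - t) * a); rewrite /= addr0 mulKf// gt_eqF.
  - by exists (t * b); rewrite /= addr0 mulKf// gt_eqF.
  - move=> x y /= Ax By; have := ABC _ _ Ax By.
    by rewrite !addr0 !mulrA !divff ?gt_eqF// !mul1r.
have finA : leb A \is a fin_num by rewrite ge0_fin_numE.
have finB : leb B \is a fin_num by rewrite ge0_fin_numE.
have finC : leb C \is a fin_num by rewrite ge0_fin_numE.
by move: H; rewrite eA eB -(fineK finA) -(fineK finB) -(fineK finC) -!EFinM -EFinD lee_fin.
Qed.

(** After division by their suprema, [f] and [g] have nonempty superlevel sets at every relative
    level s < 1, so Brunn-Minkowski applies level by level. Integrating over s gives the inequality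
    with an arithmetic mean of the normalized integrals, and AM-GM passes to the geometric mean. *)
Lemma prekopa_leindler1 (t : R) f g h : 0 < t < 1 ->
  bcs absR f -> bcs absR g -> bcs absR h ->
  (forall x, 0 <= f x) -> (forall x, 0 <= g x) -> (forall x, 0 <= h x) ->
  (forall x y : R, f x `^ (1 - t) * g y `^ t <= h ((1 - t) * x + t * y)) ->
  Rintegral leb setT f `^ (1 - t) * Rintegral leb setT g `^ t <=
    Rintegral leb setT h.
Proof.
move=> t01 bf bg bh f0 g0 h0 fgh; have /andP[t0 t1] := t01.
have t1' : 0 < 1 - t by rewrite subr_gt0.
(* A function that vanishes identically cannot be normalized; in that case the left side is 0
   because the exponents are positive. *)
have supP (k : mR -> R) : bcs absR k -> (forall x, 0 <= k x) ->
    (forall x, k x = 0) \/ exists A : R, [/\ 0 < A, forall x, k x <= A &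
      forall s, s < 1 -> exists x, s * A < k x].
  move=> bk k0; have [C C0 kC] := bcs_bounded bk.
  have hs : has_sup (range k).
    split; first by exists (k (0:R)), (0:R).
    by exists C => _ [x _ <-]; rewrite (le_trans _ (kC x))// ler_norm.
  have kle x : k x <= sup (range k) by apply: sup_ubound => //; exact: hs.2.
  have := le_trans (k0 (0:R)) (kle (0:R)); rewrite le0r => /orP[/eqP s0|s0].
    by left => x; apply/eqP; rewrite eq_le k0 andbT -s0.
  right; exists (sup (range k)); split => // s s1.
  have e0 : 0 < sup (range k) - s * sup (range k) by rewrite subr_gt0 gtr_pMl.
  have [_ [x _ <-]] := sup_adherent e0 hs.
  by rewrite opprB addrCA subrr addr0; exists x.
have [fz|[A [A0 fA fs]]] := supP f bf f0.
  rewrite (_ : f = fun=> 0); last exact/funext.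
  by rewrite int0 powR0 ?gt_eqF// mul0r Rintegral_ge0.
have [gz|[B [B0 gB gs]]] := supP g bg g0.
  rewrite (_ : g = fun=> 0); last exact/funext.
  by rewrite int0 powR0 ?gt_eqF// mulr0 Rintegral_ge0.
pose D := A `^ (1 - t) * B `^ t.
have D0 : 0 < D by rewrite mulr_gt0 ?powR_gt0.
have sR : sized leb absR := @sized_lebesgue R.
have cake (k : mR -> R) (c : R) : 0 < c -> bcs absR k -> (forall x, 0 <= k x) ->
    Rintegral leb setT (fun x => Num.min 1 (k x / c)) =
    Rintegral leb setT (fun s => Rintegral leb setT (fun x => \1_(subgraph c k) (x, s))).
  move=> c0 bk k0; rewrite -(int_fubini sR sR (bcs_subgraph c0 bk)).
  by congr Rintegral; apply/funext => x; rewrite layer_cake.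
have bcake (k : mR -> R) (c : R) : 0 < c -> bcs absR k ->
    bcs absR (fun s => Rintegral leb setT (fun x => \1_(subgraph c k) (x, s))).
  by move=> c0 bk; exact: (bcs_int sR sR (bcs_swap (bcs_subgraph c0 bk))).
have nz (k : mR -> R) (c : R) x : 0 < c -> 0 <= k x -> k x <= c -> Num.min 1 (k x / c) = c^-1 * k x.
  by move=> c0 k0 kc; rewrite [RHS]mulrC; apply: min_r; rewrite ler_pdivrMr// mul1r.
have If : Rintegral leb setT f = A * Rintegral leb setT (fun x => Num.min 1 (f x / A)).
  under [in RHS]eq_fun do rewrite nz//.
  by rewrite (intZ sR)// mulVKf// gt_eqF.
have Ig : Rintegral leb setT g = B * Rintegral leb setT (fun x => Num.min 1 (g x / B)).
  under [in RHS]eq_fun do rewrite nz//.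
  by rewrite (intZ sR)// mulVKf// gt_eqF.
have bmin : bcs absR (fun x => Num.min 1 (h x / D)).
  apply: (bcs_le _ (bcsMr bh (lbm_cst absR D^-1))).
    by apply: measurable_minr => //; apply: measurable_funM => //; exact: bh.1.1.
  have hD x : 0 <= h x / D by rewrite divr_ge0// ltW.
  move=> x; rewrite !ger0_norm//; last by rewrite le_min ler01 hD.
  by rewrite ge_min lexx orbT.
(* [D] need not be the supremum of [h], so truncating h / D at 1 gives only an inequality, in the
   useful direction. *)
have Ih : D * Rintegral leb setT (fun x => Num.min 1 (h x / D)) <= Rintegral leb setT h.
  rewrite -(intZ sR)//; apply: (le_int sR) => //.
    exact: bcsZ.
  move=> x; rewrite mulrC -ler_pdivlMr//.
  by rewrite ge_min lexx orbT.
have key : (1 - t) * Rintegral leb setT (fun x => Num.min 1 (f x / A)) +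
    t * Rintegral leb setT (fun x => Num.min 1 (g x / B)) <=
    Rintegral leb setT (fun x => Num.min 1 (h x / D)).
  rewrite !cake// -!(intZ sR) -?(intD sR);
    [|by do ?[exact: bcake|apply: bcsZ] ..].
  apply: (le_int sR); first apply: bcsD;
    [by do ?[exact: bcake|apply: bcsZ] ..|].
  move=> s; have [s01|] := boolP (0 < s < 1); last first.
    move=> ns; have z k c : Rintegral leb setT (fun x => \1_(subgraph c k) (x, s)) = 0.
      rewrite -[RHS](int0 leb); congr Rintegral; apply/funext => x.
      rewrite indicE memNset//= => -[/= s0 s1 _].
      by move: ns; rewrite s0 s1.
    by rewrite !z !mulr0 addr0.
  have /andP[s0 s1] := s01.
  rewrite !superlevelE//; [|exact: bh.1.1|exact: bg.1.1|exact: bf.1.1].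
  apply: brunn_minkowski_convex => //;
    do ?[by apply: measurable_superlevel; (exact: bf.1.1 || exact: bg.1.1 || exact: bh.1.1)
        |by apply: superlevel_lty => //; rewrite mulr_ge0// ltW];
    [exact: fs|exact: gs|].
  move=> x y /= fx gy; apply: lt_le_trans (fgh x y).
  (* The exponents add up to 1, so one relative level s serves all three functions. *)
  have -> : s * D = (s * A) `^ (1 - t) * (s * B) `^ t.
    rewrite !powRM ?(ltW s0) ?(ltW A0) ?(ltW B0)// mulrACA -powRD ?(lt0r_neq0 s0) ?implybT//.
    by rewrite subrK powRr1// ltW.
  have sA : 0 < s * A by rewrite mulr_gt0.
  have sB : 0 < s * B by rewrite mulr_gt0.
  by apply: ltr_pM; rewrite ?powR_ge0//; apply: gt0_ltr_powR;
    rewrite ?nnegrE// ?(ltW sA)// ?(ltW sB)//.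
apply: le_trans Ih; apply: le_trans (_ : _ <= D * _) (ler_wpM2l (ltW D0) key).
have pf : 0 <= Rintegral leb setT (fun x => Num.min 1 (f x / A)).
  by apply: Rintegral_ge0 => x _; rewrite le_min ler01 divr_ge0// ltW.
have pg : 0 <= Rintegral leb setT (fun x => Num.min 1 (g x / B)).
  by apply: Rintegral_ge0 => x _; rewrite le_min ler01 divr_ge0// ltW.
rewrite If Ig !powRM ?(ltW A0) ?(ltW B0)// mulrACA -/D ler_pM2l//.
exact: amgm.
Qed.

End layer_cake.

Lemma int_rV0 (R : realType) (f : 'rV[R]_0 -> R) : measurable_fun setT f -> Int f = f 0.
Proof.
move=> mf; rewrite /Rintegral/= integral_dirac//= //=; last first.
  exact/measurable_EFinP.
by rewrite indicT mul1r.
Qed.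

(** Tensorization: integrating out all coordinates but the first leaves functions of one variable.
    Their one-dimensional hypothesis at a and b is the inequality in one dimension less for the
    slices at a, b and (1 - t) a + t b. *)
Theorem prekopa_leindler (R : realType) n (t : R) (f g h : 'rV[R]_n -> R) :
  0 < t < 1 -> bcs nrm f -> bcs nrm g -> bcs nrm h ->
  (forall x, 0 <= f x) -> (forall x, 0 <= g x) -> (forall x, 0 <= h x) ->
  (forall x y, f x `^ (1 - t) * g y `^ t <= h ((1 - t) *: x + t *: y)) ->
  Int f `^ (1 - t) * Int g `^ t <= Int h.
Proof.
move=> t01; elim: n f g h => [|n IH] f g h bf bg bh f0 g0 h0 fgh.
  rewrite !int_rV0; [|exact: bh.1.1|exact: bg.1.1|exact: bf.1.1].
  by have := fgh 0 0; rewrite !scaler0 addr0.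
rewrite !int_cons//; apply: prekopa_leindler1 => //.
- exact: (bcs_int (@sized_lebesgue R) (sized_rV n) (bcs_cons bf)).
- exact: (bcs_int (@sized_lebesgue R) (sized_rV n) (bcs_cons bg)).
- exact: (bcs_int (@sized_lebesgue R) (sized_rV n) (bcs_cons bh)).
- by move=> x; apply: Rintegral_ge0.
- by move=> x; apply: Rintegral_ge0.
- by move=> x; apply: Rintegral_ge0.
move=> a b; apply: IH => //.
- exact: (bcs_xsection a (bcs_cons bf)).
- exact: (bcs_xsection b (bcs_cons bg)).
- exact: (bcs_xsection _ (bcs_cons bh)).
move=> x y; apply: le_trans (fgh _ _) _; rewrite le_eqVlt; apply/orP; left; apply/eqP.
congr h; apply/rowP => i; have [j|] := unliftP ord0 i => ->.
  by rewrite cons_rVS/= [LHS]mxE [X in X + _]mxE [X in _ + X]mxE !cons_rVS !mxE.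
by rewrite cons_rV0/= [LHS]mxE [X in X + _]mxE [X in _ + X]mxE !cons_rV0.
Qed.

(** * Smooth functions and convolutions *)

(** Derivatives arrive here through quadratic remainders: Taylor bounds survive integration, and
    flatness at an endpoint is a bound of this kind. *)
Lemma is_derive_quad (R : realType) (V : normedModType R) (f : V -> R) x v l C :
  (forall s : R, `|f (x + s *: v) - f x - s * l| <= C * s ^+ 2) -> is_derive x v f l.
Proof.
move=> H.
have C0 : 0 <= C by have := H 1; rewrite expr1n mulr1; exact: le_trans.
have cv : (fun h : R => h^-1 *: ((f \o shift x) (h *: v) - f x)) @ 0^' --> l.
  apply/cvgrPdist_le => /= e e0; near=> h.
  have h0 : h != 0 by near: h; exact: nbhs_dnbhs_neq.
  have -> : l - h^-1 *: (f (h *: v + x) - f x) =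
      - (h^-1 * (f (x + h *: v) - f x - h * l)).
    by rewrite [h *: v + x]addrC /GRing.scale/=; field.
  rewrite normrN normrM normfV ler_pdivrMl ?normr_gt0// (le_trans (H h))//.
  rewrite -[h ^+ 2]ger0_norm ?sqr_ge0// normrX expr2 mulrCA ler_wpM2l//.
  rewrite (@le_trans _ _ ((C + 1) * `|h|))// ?ler_wpM2r ?lerDl//.
  rewrite mulrC -ler_pdivlMr ?ltr_wpDl//.
  near: h; apply/dnbhs0_le; rewrite divr_gt0 ?ltr_wpDl//.
have L := cvg_lim (@Rhausdorff R) cv.
by split; [apply/cvg_ex; exists l|exact: L].
Unshelve. all: by end_near. Qed.

Section partial_derivatives.
Context {R : realType} {n : nat}.
Implicit Types (f phi : 'rV[R]_n -> R) (x z v : 'rV[R]_n).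
Notation e_ i := (delta_mx (ord0 : 'I_1) i : 'rV[R]_n).

Lemma is_derive_line f x v (s : R) : derivable f (s *: v + x) v ->
  is_derive s 1 (fun r : R => f (r *: v + x)) ('D_v f (s *: v + x)).
Proof.
move=> df.
have E : (fun h : R => h^-1 *: (((fun r : R => f (r *: v + x)) \o shift s) (h *: 1)
    - f (s *: v + x))) =
    (fun h : R => h^-1 *: ((f \o shift (s *: v + x)) (h *: v) - f (s *: v + x))).
  apply/funext => h /=; congr (_ *: (f _ - _)).
  by rewrite addrA -scalerDl /GRing.scale/= mulr1.
by split; rewrite /derivable ?/derive E.
Qed.

Lemma line_mvt f x v (s : R) : (forall y, derivable f y v) ->
  exists2 c : R, `|c| <= `|s| & f (s *: v + x) - f x = s * 'D_v f (c *: v + x).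
Proof.
move=> df; have dl r := is_derive_line (df (r *: v + x)).
have cl a b : {within `[a, b], continuous (fun r : R => f (r *: v + x))}.
  by apply: derivable_within_continuous => r _; have [] := dl r.
have [s0|s0] := leP 0 s.
  have [c] := MVT_segment s0 (fun r _ => dl r) (cl _ _).
  rewrite in_itv/= scale0r add0r subr0 => /andP[c0 cs] ->; exists c; last by rewrite mulrC.
  by rewrite !ger0_norm.
have [c] := MVT_segment (ltW s0) (fun r _ => dl r) (cl _ _).
rewrite in_itv/= scale0r add0r sub0r => /andP[c0 cs] h; exists c.
  by rewrite (ltr0_norm s0) ler0_norm// lerN2.
by rewrite -[LHS]opprB h mulrN opprK mulrC.
Qed.

(** Only derivatives along the axes are available, so the segment from x to x + z is replaced by a
    path parallel to the axes, whose corners are the [x + tr k], with one mean value point on each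
    edge. *)
Lemma coord_mvt f x z : (forall i y, derivable f y (e_ i)) ->
  exists w : 'I_n -> 'rV[R]_n, (forall i, `|w i| <= `|z|) /\
    f (x + z) - f x = \sum_i z ord0 i * partial i f (x + w i).
Proof.
move=> df; pose tr (k : nat) : 'rV[R]_n := \row_i (if (i < k)%N then z ord0 i else 0).
have tr0 : tr 0 = 0 by apply/rowP => i; rewrite !mxE.
have trn : tr n = z by apply/rowP => i; rewrite !mxE ltn_ord.
have trS (i : 'I_n) : tr i.+1 = z ord0 i *: e_ i + tr i.
  apply/rowP => j; rewrite !mxE eqxx/= ltnS leq_eqVlt.
  have [->|ji] := eqVneq j i; first by rewrite eqxx ltnn/= mulr1 addr0.
  by rewrite (_ : (j == i :> nat) = false) ?mulr0 ?add0r//; exact: negbTE.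
have /choice[w wP] : forall i : 'I_n, exists w, `|w| <= `|z| /\
    f (x + tr i.+1) - f (x + tr i) = z ord0 i * partial i f (x + w).
  move=> i; have [c ci h] := line_mvt (x + tr i) (z ord0 i) (df i).
  exists (c *: e_ i + tr i); split; last by rewrite trS addrCA h [x + (_ + _)]addrCA.
  apply: rV_norm_le => // j; rewrite !mxE eqxx/=; have [->|ji] := eqVneq j i.
    by rewrite ltnn mulr1 addr0 (le_trans ci)// ler_coord_norm.
  by rewrite mulr0 add0r; case: ifPn => _; rewrite ?normr0 ?ler_coord_norm.
exists w; split => [i|]; first exact: (wP i).1.
under eq_bigr => i _ do rewrite -(wP i).2.
rewrite -(big_mkord xpredT (fun i => f (x + tr i.+1) - f (x + tr i))).
by rewrite telescope_sumr// tr0 trn addr0.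
Qed.

Definition ctest phi := smooth phi /\ exists M, forall x, M < nrm x -> phi x = 0.

Lemma smooth_partial i phi : smooth phi -> smooth (partial i phi).
Proof. by move=> sphi s; have := sphi (rcons s i); rewrite foldr_rcons. Qed.

Lemma smooth_continuous phi : smooth phi -> continuous phi.
Proof. by move=> /(_ [::])[]. Qed.

Lemma smooth_derivable phi : smooth phi -> forall i x, derivable phi x (e_ i).
Proof. by move=> /(_ [::])[]. Qed.

Lemma ctest_partial i phi : ctest phi -> ctest (partial i phi).
Proof.
move=> [sphi [M phiM]]; split; first exact: smooth_partial.
exists M => x Mx; rewrite /partial (@near_eq_derive _ _ _ phi (cst 0)); first by rewrite derive_cst.
have : open [set y : 'rV[R]_n | M < `|y|].
  rewrite (_ : [set _ | _] = (fun x : 'rV[R]_n => `|x|) @^-1` [set r | M < r])//.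
  apply: open_comp; last exact: open_gt.
  by move=> y _; exact: norm_continuous.
by move=> /(_ x)-/(_ Mx); apply: filterS => y; exact: phiM.
Qed.

Lemma ctest_bcs phi : ctest phi -> bcs nrm phi.
Proof.
by move=> [sphi suphi]; split => //; apply: lbm_continuous; exact: smooth_continuous.
Qed.

Lemma ctest_derivable phi : ctest phi -> forall i x, derivable phi x (e_ i).
Proof. by move=> [sphi _]; exact: smooth_derivable. Qed.

Lemma ctest_bounded1 phi : ctest phi ->
  exists2 L, 0 < L & forall i x, `|partial i phi x| <= L.
Proof.
move=> cphi.
have /choice[L LP] : forall i, exists L, 0 < L /\ forall x, `|partial i phi x| <= L.
  by move=> i; have [C C0 HC] := bcs_bounded (ctest_bcs (ctest_partial i cphi)); exists C.
exists (1 + \sum_i L i); first by rewrite ltr_pwDl// sumr_ge0// => i _; exact/ltW/(LP i).1.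
move=> i x; rewrite (le_trans ((LP i).2 x))// (bigD1 i)//= addrCA lerDl addr_ge0//.
by rewrite sumr_ge0// => j _; exact/ltW/(LP j).1.
Qed.

Lemma ctest_lipschitz phi : ctest phi ->
  exists2 L, 0 < L & forall x z, `|phi (x + z) - phi x| <= L * `|z|.
Proof.
move=> cphi; have [L L0 LP] := ctest_bounded1 cphi.
exists (n.+1%:R * L); first by rewrite mulr_gt0.
move=> x z; have [w [wz ->]] := coord_mvt x z (ctest_derivable cphi).
rewrite (le_trans (ler_norm_sum _ _ _))//.
rewrite (@le_trans _ _ (\sum_(i < n) `|z| * L))//.
  by apply: ler_sum => i _; rewrite normrM ler_pM// ler_coord_norm.
rewrite sumr_const card_ord -[leLHS]mulr_natl [leRHS]mulrAC -mulrA ler_wpM2r ?ler_nat//.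
by rewrite mulr_ge0// ltW.
Qed.

Lemma ctest_taylor phi : ctest phi ->
  exists2 C, 0 < C & forall x z,
    `|phi (x + z) - phi x - \sum_i z ord0 i * partial i phi x| <= C * `|z| ^+ 2.
Proof.
move=> cphi.
have /choice[L LP] : forall i, exists L, 0 < L /\
    forall x z, `|partial i phi (x + z) - partial i phi x| <= L * `|z|.
  by move=> i; have [L L0 HL] := ctest_lipschitz (ctest_partial i cphi); exists L.
exists (1 + \sum_i L i); first by rewrite ltr_pwDl// sumr_ge0// => i _; exact/ltW/(LP i).1.
move=> x z; have [w [wz ->]] := coord_mvt x z (ctest_derivable cphi).
rewrite -sumrB (le_trans (ler_norm_sum _ _ _))// mulrDl mul1r.
apply: ler_wpDl; first exact: sqr_ge0.
rewrite mulr_suml ler_sum// => i _; rewrite -mulrBr normrM.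
rewrite [leRHS](_ : _ = `|z| * (L i * `|z|)); last by ring.
rewrite ler_pM ?ler_coord_norm// (le_trans ((LP i).2 _ _))//.
by rewrite ler_pM2l//; exact: (LP i).1.
Qed.

Lemma ctest_taylor1 phi : ctest phi ->
  exists2 C, 0 < C & forall i x (s : R),
    `|phi (x + s *: e_ i) - phi x - s * partial i phi x| <= C * s ^+ 2.
Proof.
move=> cphi; have [C C0 CP] := ctest_taylor cphi; exists C => // i x s.
have := CP x (s *: e_ i); rewrite (bigD1 i)//= big1 => [|j ji]; last first.
  by rewrite !mxE eqxx/= (negbTE ji) mulr0 mul0r.
rewrite !mxE !eqxx/= mulr1 addr0 => /le_trans; apply; rewrite ler_pM2l//.
rewrite -[leRHS]ger0_norm ?sqr_ge0// normrX lerXn2r ?nnegrE//.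
apply: rV_norm_le => // j; rewrite !mxE eqxx/=.
by case: (j == i); rewrite ?mulr1 ?mulr0 ?normr0.
Qed.

(** By translation invariance a difference quotient has integral 0, and it differs from the
    derivative by O(s) on a fixed box. *)
Lemma int_partial i phi : ctest phi -> Int (partial i phi) = 0.
Proof.
move=> cphi; have [C C0 CP] := ctest_taylor1 cphi.
have bphi := ctest_bcs cphi; have bp := ctest_bcs (ctest_partial i cphi).
have [M phiM] := cphi.2; have [M' pM] := (ctest_partial i cphi).2.
(* For s <= 1 the function, its shift and the derivative all vanish outside this box. *)
pose K := Num.max (`|M| + 1) M'.
pose B : 'rV[R]_n -> R := \1_[set x | nrm x <= K].
have sR := sized_rV (R := R) n.
have mB : measurable [set x : 'rV[R]_n | nrm x <= K] by exact: measurable_sublevel sR K.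
have bB : bcs nrm B.
  exact: (bcs_indic (M := K)).
have key s : 0 < s <= 1 -> `|Int (partial i phi)| <= C * Int B * s.
  move=> /andP[s0 s1].
  have Es : Int (fun x => phi (x + s *: e_ i) - phi x - s * partial i phi x) =
      - (s * Int (partial i phi)).
    rewrite (intB sR); [|by apply: bcsB => //; exact: bcs_shift|].
      rewrite (intB sR)//; last exact: bcs_shift.
      by rewrite int_shift// subrr sub0r (intZ sR).
    exact: bcsZ.
  have bd : bcs nrm (fun x => phi (x + s *: e_ i) - phi x - s * partial i phi x).
    apply: bcsB; first by apply: bcsB => //; exact: bcs_shift.
    exact: bcsZ.
  have : s * `|Int (partial i phi)| <= C * s ^+ 2 * Int B.
    rewrite -[X in X * _ <= _](gtr0_norm s0) -normrM -normrN -Es.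
    rewrite (le_trans (int_norm sR bd))// -(intZ sR)//.
    apply: (le_int sR); first exact: bcs_norm.
      exact: bcsZ.
    move=> x; rewrite /B indicE; case: (boolP (x \in _)) => [_|].
      by rewrite mulr1; exact: CP.
    rewrite notin_setE/= => /negP; rewrite -ltNge gt_max => /andP[Mx M'x].
    rewrite mulr0 pM// mulr0 subr0 [phi x]phiM; last first.
      by rewrite (le_lt_trans _ Mx)// (le_trans (ler_norm _))// lerDl.
    rewrite subr0 phiM ?normr0//; rewrite (le_lt_trans (ler_norm M))//.
    have : nrm x <= nrm (x + s *: e_ i) + `|s *: e_ i|.
      by have := ler_normB (x + s *: e_ i) (s *: e_ i); rewrite addrK.
    have : `|s *: e_ i| <= 1.
      apply: rV_norm_le => // j; rewrite !mxE eqxx/=.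
      by case: (j == i); rewrite ?mulr1 ?mulr0 ?normr0// ger0_norm// ltW.
    by lra.
  by rewrite expr2 -[X in _ <= X](_ : s * (C * Int B * s) = _); [rewrite ler_pM2l|ring].
have B0 : 0 <= Int B by apply: int_ge0 => x; rewrite /B indicE.
apply/eqP; rewrite -normr_le0; apply/ler_addgt0Pr => e e0; rewrite add0r.
pose s := Num.min 1 (e / (C * Int B + 1)).
have D0 : 0 < C * Int B + 1 by rewrite ltr_wpDl// mulr_ge0// ltW.
have s01 : 0 < s <= 1 by rewrite lt_min ltr01 divr_gt0//= ge_min lexx.
apply: le_trans (key s s01) _.
rewrite (@le_trans _ _ ((C * Int B + 1) * s))//.
  by rewrite ler_wpM2r ?lerDl//; case/andP : s01 => /ltW.
by rewrite mulrC -ler_pdivlMr// ge_min lexx orbT.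
Qed.

End partial_derivatives.

(** * Algebras of smooth functions and convolution *)

Section smooth_algebra.
Context {R : realType} {n : nat}.
Notation fn := ('rV[R]_n -> R).
Notation e_ i := (delta_mx (ord0 : 'I_1) i : 'rV[R]_n).
Implicit Types (f g phi psi : fn) (x v : 'rV[R]_n).

(* If the base functions have their partial derivatives in the algebra that they
   generate together with the coordinates, that algebra consists of smooth
   functions. *)
Inductive generated (S : set fn) : fn -> Prop :=
| gen_base f : S f -> generated S f
| gen_cst c : generated S (fun=> c)
| gen_coord i : generated S (fun x => x ord0 i)
| gen_add f g : generated S f -> generated S g -> generated S (fun x => f x + g x)
| gen_mul f g : generated S f -> generated S g -> generated S (fun x => f x * g x).

Lemma generated_smooth (S : set fn) :
  (forall f, S f -> continuous f /\ forall i, exists2 g, generated S g &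
    forall x, is_derive x (e_ i) f (g x)) ->
  forall f, generated S f -> smooth f.
Proof.
move=> HS f gf.
have H h : generated S h -> continuous h /\ forall i, exists2 g, generated S g &
    forall x, is_derive x (e_ i) h (g x).
  elim => {f gf h} [h|c|j|f g _ [cf df] _ [cg dg]|f g gf [cf df] gg [cg dg]].
  - exact: HS.
  - split=> [|i]; first exact: cst_continuous.
    by exists (fun=> 0); [exact: gen_cst|move=> x; exact: is_derive_cst].
  - split=> [|i]; first exact: coord_continuous.
    exists (fun=> (i == j)%:R); first exact: gen_cst.
    move=> x; apply: (@is_derive_quad _ _ _ _ _ _ 0) => s.
    by rewrite !mxE eqxx/= mul0r [j == i]eq_sym [X in `|X|](_ : _ = 0) ?normr0//; ring.
  - split=> [x|i]; first by apply: (@continuousD _ _ _ f g x); [exact: cf|exact: cg].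
    have [f' gf' Hf'] := df i; have [g' gg' Hg'] := dg i.
    exists (fun x => f' x + g' x); first exact: gen_add.
    by move=> x; apply: is_deriveD.
  - split=> [x|i]; first by apply: (@continuousM _ _ f g x); [exact: cf|exact: cg].
    have [f' gf' Hf'] := df i; have [g' gg' Hg'] := dg i.
    exists (fun x => f x * g' x + g x * f' x).
      by apply: gen_add; apply: gen_mul.
    by move=> x; apply: is_deriveM.
have G s : generated S (foldr (@partial R n) f s).
  elim: s => //= i s IH; have [_ /(_ i)[g gg Hg]] := H _ IH.
  rewrite (_ : partial i _ = g)//; apply/funext => x.
  by have [_ <-] := Hg x.
move=> s; have [cs ds] := H _ (G s); split => // i x.
by have [g _ Hg] := ds i; have [] := Hg x.
Qed.

Lemma smooth_generated phi : generated (@smooth R n) phi -> smooth phi.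
Proof.
apply: generated_smooth => f sf; split; first exact: smooth_continuous.
move=> i; exists (partial i f); first by apply: gen_base; exact: smooth_partial.
by move=> x; apply: derivableP; exact: smooth_derivable.
Qed.

Lemma smoothM phi psi : smooth phi -> smooth psi -> smooth (fun x => phi x * psi x).
Proof. by move=> sp sq; apply: smooth_generated; apply: gen_mul; exact: gen_base. Qed.

Lemma smooth_cst (c : R) : smooth ((fun=> c) : fn).
Proof. by apply: smooth_generated; exact: gen_cst. Qed.

Lemma smooth_coord i : smooth ((fun x => x ord0 i) : fn).
Proof. by apply: smooth_generated; exact: gen_coord. Qed.

Lemma partialM i phi psi x : smooth phi -> smooth psi ->
  partial i (fun y => phi y * psi y) x = phi x * partial i psi x + psi x * partial i phi x.
Proof.
by move=> sp sq; rewrite /partial deriveM//; exact: smooth_derivable.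
Qed.

Lemma partial_coord i j x : partial i (fun y => y ord0 j) x = (i == j)%:R.
Proof.
suff [_] : is_derive x (e_ i) (fun y => y ord0 j) (i == j)%:R by [].
apply: (@is_derive_quad _ _ _ _ _ _ 0) => s.
by rewrite !mxE eqxx/= mul0r [j == i]eq_sym [X in `|X|](_ : _ = 0) ?normr0//; ring.
Qed.

Lemma ctestM phi psi : smooth phi -> ctest psi -> ctest (fun x => phi x * psi x).
Proof.
move=> sp [sq [M HM]]; split; first exact: smoothM.
by exists M => x /HM ->; rewrite mulr0.
Qed.

Lemma sqnormD_line i x s :
  sqnorm (s *: e_ i + x) = sqnorm x + (2 * x ord0 i * s + s ^+ 2).
Proof.
rewrite /sqnorm (bigD1 i)//= [in RHS](bigD1 i)//= !mxE !eqxx/= mulr1.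
under eq_bigr => j ji do rewrite !mxE eqxx (negbTE ji) mulr0 add0r.
by ring.
Qed.

Lemma sqnorm_continuous : continuous (@sqnorm R n).
Proof.
apply: smooth_continuous.
apply: smooth_generated; rewrite /sqnorm.
elim: (index_enum _) => [|i s IH].
  by under eq_fun do rewrite big_nil; exact: gen_cst.
under eq_fun do rewrite big_cons.
by apply: gen_add => //; apply: gen_mul; exact: gen_coord.
Qed.

Lemma is_derive_comp_sqnorm (a : R -> R) l i x : is_derive (sqnorm x) 1 a l ->
  is_derive x (e_ i) (fun y => a (sqnorm y)) (2 * x ord0 i * l).
Proof.
move=> da.
pose p (s : R) := sqnorm x + (2 * x ord0 i * s + s ^+ 2).
have dp : is_derive (0 : R) 1 p (2 * x ord0 i).
  by apply: is_derive_eq; rewrite /GRing.scale/=; ring.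
have p0 : p 0 = sqnorm x by rewrite /p mulr0 expr0n/= !addr0.
rewrite -p0 in da; have dc := @is_derive1_comp _ a p 0 _ _ da dp.
have E : (fun h : R => h^-1 *: (((fun y => a (sqnorm y)) \o shift x) (h *: e_ i)
    - a (sqnorm x))) =
    (fun h : R => h^-1 *: (((a \o p) \o shift 0) (h *: 1) - (a \o p) 0)).
  apply/funext => h /=; rewrite sqnormD_line p0; congr (_ *: (a _ - _)).
  by rewrite /p addr0 /GRing.scale/= mulr1.
by rewrite mulrC; case: dc => dc1 <-; split; rewrite /derivable ?/derive E.
Qed.

(** A recursion with two successors covers both uses: the exponential, as a constant family, and
    [profile]. Each partial derivative of a member is 2 x_i times a combination of members, which
    keeps the generated algebra closed. *)
Lemma smooth_comp_sqnorm (a : nat -> R -> R) (c d : nat -> R) :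
  (forall k (s : R), is_derive s 1 (a k) (c k * a k.+1 s + d k * a k.+2 s)) ->
  forall k, smooth ((fun x => a k (sqnorm x)) : fn).
Proof.
move=> Ha k; pose S : set fn := [set f | exists k, f = fun x => a k (sqnorm x)].
apply: (@generated_smooth S); last by apply: gen_base; exists k.
move=> _ [{}k ->]; split=> [x|i].
  have ca : {for sqnorm x, continuous (a k)}.
    by apply/differentiable_continuous/derivable1_diffP; have [] := Ha k (sqnorm x).
  exact: (continuous_comp (@sqnorm_continuous x) ca).
exists (fun x => (2 * x ord0 i) * (c k * a k.+1 (sqnorm x) + d k * a k.+2 (sqnorm x))).
  apply: gen_mul; first by apply: gen_mul; [exact: gen_cst|exact: gen_coord].
  by apply: gen_add; (apply: gen_mul; first exact: gen_cst); apply: gen_base;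
    [exists k.+1|exists k.+2].
by move=> x; exact: is_derive_comp_sqnorm.
Qed.

(** The constant -1/2 gives the Gaussian weight, -1/4 its square root, 1/4 the inverse of that root,
    and [- (step d / 8)] the factor that stands for the potential. *)
Definition gexp (c : R) (x : 'rV[R]_n) := expR (c * sqnorm x).

Lemma is_derive_expRM (c s : R) : is_derive s 1 (fun s => expR (c * s)) (c * expR (c * s)).
Proof.
have d1 : is_derive s 1 (fun s : R => c * s) c.
  by apply: is_derive_eq; rewrite /GRing.scale/=; ring.
have := @is_derive1_comp _ expR (fun s : R => c * s) s _ _ (is_derive_expR (c * s)) d1.
by rewrite mulrC.
Qed.

Lemma smooth_gexp c : smooth (gexp c).
Proof.
apply: (@smooth_comp_sqnorm (fun=> fun s => expR (c * s)) (fun=> c) (fun=> 0) _ 0%N).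
by move=> _ s; rewrite mul0r addr0; exact: is_derive_expRM.
Qed.

Lemma partial_gexp i c x : partial i (gexp c) x = 2 * c * x ord0 i * gexp c x.
Proof.
have [_ H] := is_derive_comp_sqnorm i (is_derive_expRM c (sqnorm x)).
by rewrite /partial H /gexp; ring.
Qed.

Definition conv (k F : fn) (x : 'rV[R]_n) := Int (fun y => k (x - y) * F y).

Let sR := sized_rV (R := R) n.

Lemma bcs_shiftN k x : bcs nrm k -> bcs nrm (fun y : 'rV[R]_n => k (x - y)).
Proof.
move=> [lk [K kK]]; split; last first.
  exists (K + nrm x) => y h; apply: kK.
  by have := ler_normB x (x - y); rewrite subKr => h'; rewrite /nrm in h *; lra.
have h := lbm_sub lk; split; first exact: (measurableT_comp h.1 (pair1_measurable x)).
move=> M; have [C HC] := h.2 (Num.max M (nrm x)); exists C => y yM.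
by apply: (HC (x, y)); rewrite /maxN/= ge_max !le_max lexx yM orbT.
Qed.

Lemma bcs_conv_integrand k F x : bcs nrm k -> lbm nrm F ->
  bcs nrm (fun y : 'rV[R]_n => k (x - y) * F y).
Proof. by move=> bk lF; apply: bcsMr => //; exact: bcs_shiftN. Qed.

Lemma bcs_conv k F : bcs nrm k -> bcs nrm F -> bcs nrm (conv k F).
Proof. by move=> bk bF; exact: (bcs_int sR sR (bcs_sub2 bk bF)). Qed.

(** The Taylor remainder of the kernel is uniform in the point, so it can be integrated against
    [F]. *)
Lemma is_derive_conv k F i x : ctest k -> bcs nrm F ->
  is_derive x (e_ i) (conv k F) (conv (partial i k) F x).
Proof.
move=> ck bF; have [C C0 CP] := ctest_taylor1 ck; have bk := ctest_bcs ck.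
have bp := ctest_bcs (ctest_partial i ck).
apply: (@is_derive_quad _ _ _ _ _ _ (C * Int (fun y => `|F y|))) => s.
have lF := bcs_lbm bF.
have b1 := bcs_conv_integrand (x + s *: e_ i) bk lF.
have b2 := bcs_conv_integrand x bk lF.
have b3 := bcs_conv_integrand x bp lF.
have b4 : bcs nrm (fun y : 'rV[R]_n => s * (partial i k (x - y) * F y)).
  exact: bcsZ.
have b5 := bcsB (bcsB b1 b2) b4.
rewrite /conv -(intZ sR)// -(intB sR)// -(intB sR)//; last exact: bcsB.
rewrite (le_trans (int_norm sR b5))//.
rewrite [leRHS](_ : _ = C * s ^+ 2 * Int (fun y => `|F y|)); last by ring.
rewrite -(intZ sR); last exact: bcs_norm.
apply: (le_int sR); first exact: bcs_norm.
  by apply: bcsZ; exact: bcs_norm.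
move=> y; have := CP i (x - y) s.
rewrite [X in `|X| <= C * s ^+ 2 * _](_ : _ = (k (x - y + s *: e_ i) - k (x - y) -
    s * partial i k (x - y)) * F y); last first.
  by rewrite [x + _ - y]addrAC; ring.
by move=> h; rewrite normrM ler_wpM2r.
Qed.

Lemma partial_conv k F i : ctest k -> bcs nrm F ->
  partial i (conv k F) = conv (partial i k) F.
Proof.
by move=> ck bF; apply/funext => x; have [_ <-] := is_derive_conv i x ck bF.
Qed.

Lemma continuous_conv k F : ctest k -> bcs nrm F -> continuous (conv k F).
Proof.
move=> ck bF x; have [L L0 LP] := ctest_lipschitz ck; have bk := ctest_bcs ck.
have lF := bcs_lbm bF; pose D := L * Int (fun y => `|F y|) + 1.
have IF0 : 0 <= Int (fun y => `|F y|) by apply: int_ge0.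
have D0 : 0 < D by rewrite ltr_wpDl// mulr_ge0// ltW.
have key z : `|conv k F z - conv k F x| <= D * `|z - x|.
  have b1 := bcs_conv_integrand z bk lF; have b2 := bcs_conv_integrand x bk lF.
  rewrite /conv -(intB sR)// (le_trans (int_norm sR (bcsB b1 b2)))//.
  rewrite (@le_trans _ _ (L * `|z - x| * Int (fun y => `|F y|)))//.
    rewrite -(intZ sR); last exact: bcs_norm.
    apply: (le_int sR); first by apply: bcs_norm; exact: bcsB.
      by apply: bcsZ; exact: bcs_norm.
    move=> y; rewrite -mulrBl normrM ler_wpM2r//.
    by have := LP (x - y) (z - x); rewrite [x - y + _]addrC addrA subrK.
  by rewrite mulrAC /D mulrDl mul1r lerDl.
apply/(@cvgrPdist_le _ _ _ (nbhs x) (nbhs_filter x)) => /= e e0.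
apply/nbhs_ballP; exists (e / D); first exact: divr_gt0.
move=> z; rewrite -ball_normE /= => xz.
by rewrite distrC (le_trans (key z))// mulrC -ler_pdivlMr// distrC ltW.
Qed.

(** All derivatives fall on the kernel, so [F] may be a rough function. *)
Lemma ctest_conv k F : ctest k -> bcs nrm F -> ctest (conv k F).
Proof.
move=> ck bF; split; last exact: (bcs_conv (ctest_bcs ck) bF).2.
suff H s : foldr (@partial R n) (conv k F) s = conv (foldr (@partial R n) k s) F /\
    ctest (foldr (@partial R n) k s).
  move=> s; have [-> cs] := H s; split; first exact: continuous_conv.
  by move=> i x; have [] := is_derive_conv i x cs bF.
elim: s => [//|i s [IH cs]] /=; rewrite IH; split; first exact: partial_conv.
exact: ctest_partial.
Qed.

End smooth_algebra.

(** * The smoothing kernels *)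

Section profile.
Context {R : realType}.
Implicit Types (s : R).

(* The family is stable under differentiation; k = 0 and k = 2 are the kernels in
   use, since the gradient of [ker 0] at z is a multiple of [ker 2 z] times z, and
   the constant 2 in the exponential makes [ker 2] log-concave. *)
Definition profile (k : nat) s : R :=
  if s < 1 then (1 - s)^-1 ^+ k * expR (- 2 * (1 - s)^-1) else 0.

Lemma profile_ge0 k s : 0 <= profile k s.
Proof.
rewrite /profile; case: ifPn => // s1; rewrite mulr_ge0 ?expR_ge0// exprn_ge0//.
by rewrite invr_ge0 subr_ge0 ltW.
Qed.

(** At s = 1 the function is flat: for h < 0 and y = -1/h, its value at 1 + h divided by h^2 is
    y^(k+2) exp(-2 y), which is bounded because y^(k+2) <= (k+2)! exp y. *)
Lemma is_derive_profile k s : is_derive s 1 (profile k) (k%:R * profile k.+1 s + (- 2) * profile k.+2 s).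
Proof.
have [s1|s1|->] := ltgtP s 1.
- pose y (s : R) := (1 - s)^-1.
  have y0 : 1 - s != 0 by rewrite subr_eq0 eq_sym lt_eqF.
  have dy : is_derive s 1 y (y s ^+ 2).
    have d1 : is_derive s 1 (fun s : R => 1 - s) (-1).
      by apply: is_derive_eq; ring.
    have h := @is_deriveV _ (fun s : R => 1 - s) s _ _ y0 d1; apply: (is_derive_eq h).
    by rewrite /y /GRing.scale/= exprVn mulrN1 opprK.
  have dE : is_derive s 1 (fun s => expR (- 2 * y s)) (expR (- 2 * y s) * (- 2 * y s ^+ 2)).
    have d2 : is_derive s 1 (fun s => - 2 * y s) (- 2 * y s ^+ 2).
      by apply: is_derive_eq; rewrite /GRing.scale/=; ring.
    exact: (@is_derive1_comp _ expR (fun s => - 2 * y s) s _ _ (is_derive_expR _) d2).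
  have df : is_derive s 1 (fun s => y s ^+ k * expR (- 2 * y s))
      (k%:R * profile k.+1 s + (- 2) * profile k.+2 s).
    have h := is_deriveM (is_deriveX k dy) dE; rewrite exprfctE in h.
    apply: (is_derive_eq h); rewrite /profile s1 -/(y s) /GRing.scale/=.
    case: k {h} => [|k] /=; rewrite ?expr0 ?mul0r ?mulr0 ?add0r ?addr0; first by rewrite !exprS expr0; ring.
    by rewrite !exprS; ring.
  apply: near_eq_is_derive df; near=> z; rewrite /profile /y.
  by rewrite (_ : z < 1)//; near: z; exact: lt_nbhsl.
- have d0 : is_derive s 1 (cst 0 : R -> R) (k%:R * profile k.+1 s + (- 2) * profile k.+2 s).
    rewrite /profile (ltNge s) (ltW s1)/= !mulr0 addr0; exact: is_derive_cst.
  apply: near_eq_is_derive d0; near=> z; rewrite /profile /cst.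
  by rewrite ltNge (_ : 1 <= z)//; apply: ltW; near: z; exact: lt_nbhsr.
- have -> : k%:R * profile k.+1 1 + (- 2) * profile k.+2 1 = 0 by rewrite /profile ltxx !mulr0 addr0.
  apply: (@is_derive_quad _ _ _ _ _ _ (k.+2)`!%:R) => h.
  rewrite mulr0 subr0 {2}/profile ltxx subr0 /GRing.scale/= mulr1 ger0_norm ?profile_ge0//.
  rewrite /profile gtrDl opprD addNKr; case: ifPn => h0; last by rewrite mulr_ge0 ?sqr_ge0.
  set y := (- h)^-1; have y0 : 0 < y by rewrite invr_gt0 oppr_gt0.
  have -> : h ^+ 2 = y ^- 2 by rewrite /y exprVn invrK sqrrN.
  have f0 : 0 < (k.+2)`!%:R :> R by rewrite ltr0n fact_gt0.
  rewrite ler_pdivlMr ?exprn_gt0// mulrAC -exprD addn2 mulNr expRN ler_pdivrMr ?expR_gt0//.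
  have := expR_ge1Dxn k.+1 (ltW y0); set E := expR y => HE.
  have HE' : y ^+ k.+2 <= (k.+2)`!%:R * E.
    by rewrite mulrC -ler_pdivrMr//; apply: le_trans HE; rewrite lerDr.
  apply: (le_trans HE'); rewrite ler_pM2l// /E ler_expR; lra.
Unshelve. all: by end_near. Qed.

End profile.

Section kernel.
Context {R : realType} {n : nat}.
Variable d : R.
Hypothesis d0 : 0 < d.
Implicit Types (x y z : 'rV[R]_n).

Definition ker (k : nat) z : R := profile k (d ^- 2 * sqnorm z).

Let r : R := d ^- 2.
Let r0 : 0 < r. Proof. by rewrite invr_gt0 exprn_gt0. Qed.

Lemma ker_ge0 k z : 0 <= ker k z. Proof. exact: profile_ge0. Qed.

Lemma sqnorm_ge0 z : 0 <= sqnorm z.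
Proof. by apply: sumr_ge0 => i _; exact: sqr_ge0. Qed.

Lemma sqnormN z : sqnorm (- z) = sqnorm z.
Proof. by apply: eq_bigr => i _; rewrite mxE sqrrN. Qed.

Lemma kerN k z : ker k (- z) = ker k z.
Proof. by rewrite /ker sqnormN. Qed.

Lemma coord_le_sqnorm z i : z ord0 i ^+ 2 <= sqnorm z.
Proof. by rewrite /sqnorm (bigD1 i)//= lerDl sumr_ge0// => j _; exact: sqr_ge0. Qed.

Lemma is_derive_profile_scale k (s : R) : is_derive s 1 (fun s => profile k (r * s))
  (r * k%:R * profile k.+1 (r * s) + (- 2 * r) * profile k.+2 (r * s)).
Proof.
have d1 : is_derive s 1 (fun s : R => r * s) r.
  by apply: is_derive_eq; rewrite /GRing.scale/=; ring.
have := @is_derive1_comp _ (profile k) (fun s : R => r * s) s _ _ (is_derive_profile k (r * s)) d1.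
by rewrite mulrDl => h; apply: (is_derive_eq h); ring.
Qed.

Lemma ker_support k z : ker k z != 0 -> sqnorm z < d ^+ 2.
Proof.
rewrite /ker /profile; case: ifPn => [|]; last by rewrite eqxx.
by rewrite mulrC ltr_pdivrMr ?exprn_gt0// mul1r.
Qed.

Lemma ctest_ker k : ctest (ker k).
Proof.
split.
  exact: (smooth_comp_sqnorm (a := fun k s => profile k (r * s)) (c := fun k => r * k%:R)
    (d := fun=> - 2 * r) is_derive_profile_scale).
exists d => z dz; apply/eqP/negPn/negP => /ker_support zd.
move: dz; rewrite ltNge => /negP; apply; apply: rV_norm_le; first exact: ltW.
move=> i; rewrite -[leRHS](gtr0_norm d0) -ler_sqr ?nnegrE//.
by rewrite !real_normK ?num_real// (le_trans (coord_le_sqnorm z i))// ltW.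
Qed.

Lemma bcs_ker k : bcs nrm (ker k). Proof. exact/ctest_bcs/ctest_ker. Qed.

Lemma partial_ker0 i z : partial i (ker 0) z = - (4 * r) * (z ord0 i * ker 2 z).
Proof.
have [_ H] := is_derive_comp_sqnorm i (is_derive_profile_scale 0 (sqnorm z)).
by rewrite /partial H /ker -/r; ring.
Qed.

Lemma ker02 z : ker 0 z <= ker 2 z.
Proof.
rewrite /ker /profile; case: ifPn => // s1; rewrite expr0 ler_wpM2r ?expR_ge0//.
rewrite exprn_ege1// invf_ge1 ?subr_gt0// gerBl mulr_ge0 ?sqnorm_ge0//.
by rewrite invr_ge0 exprn_ge0// ltW.
Qed.

(** The left side is [ker 1 z]. With y = 1 / (1 - sqnorm z / d^2) and up to a common factor, this is
    2 y <= 1 + y^2. *)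
Lemma ker1_le z : (1 - r * sqnorm z) * ker 2 z <= (ker 0 z + ker 2 z) / 2.
Proof.
rewrite /ker /profile -/r; case: ifPn => s1; last by rewrite mulr0 addr0 mul0r.
have y0 : 1 - r * sqnorm z != 0 by rewrite subr_eq0 eq_sym lt_eqF.
set E := expR _; have E0 : 0 <= E by exact: expR_ge0.
set y := (1 - _)^-1.
have -> : (1 - r * sqnorm z) * (y ^+ 2 * E) = y * E.
  by rewrite /y expr2 -mulrA mulVKf.
have -> : (y ^+ 0 * E + y ^+ 2 * E) / 2 = y * E + (y - 1) ^+ 2 * E / 2 by field.
by rewrite lerDl divr_ge0// mulr_ge0// sqr_ge0.
Qed.

Let sR := sized_rV (R := R) n.

Definition NP : R := Int (ker 0).
Definition Np : R := Int (ker 2).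

(** Up to a constant factor the integrand is a partial derivative of [ker 0]. *)
Lemma int_ker_moment1 i : Int (fun z : 'rV[R]_n => z ord0 i * ker 2 z) = 0.
Proof.
have := int_partial i (ctest_ker 0).
rewrite (_ : partial i (ker 0) = fun z => - (4 * r) * (z ord0 i * ker 2 z)); last first.
  by apply/funext => z; exact: partial_ker0.
rewrite (intZ sR); last by apply: bcsMl; [exact: lbm_coord|exact: bcs_ker].
by move=> /eqP; rewrite mulf_eq0 oppr_eq0 mulf_eq0 (gt_eqF r0) orbF pnatr_eq0/= => /eqP.
Qed.

(** Integrating the partial derivative of z_j [ker 0] trades a second moment of [ker 2] for the mass
    of [ker 0]. The constant is exact, as both sides of the estimate of [form] require. *)
Lemma int_ker_moment2 i j :
  Int (fun z : 'rV[R]_n => z ord0 j * (z ord0 i * ker 2 z)) = (i == j)%:R * (d ^+ 2 / 4) * NP.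
Proof.
have cj : ctest (fun z : 'rV[R]_n => z ord0 j * ker 0 z).
  by apply: ctestM; [exact: smooth_coord|exact: ctest_ker].
have b1 : bcs nrm (fun z : 'rV[R]_n => z ord0 j * (z ord0 i * ker 2 z)).
  by do 2 (apply: bcsMl; first exact: lbm_coord); exact: bcs_ker.
have := int_partial i cj.
rewrite (_ : partial i _ = fun z => (i == j)%:R * ker 0 z
     - (4 * r) * (z ord0 j * (z ord0 i * ker 2 z))); last first.
  apply/funext => z; rewrite partialM; [|exact: smooth_coord|exact: (ctest_ker 0).1].
  by rewrite partial_ker0 partial_coord; ring.
rewrite (intB sR); [|by apply: bcsZ; exact: bcs_ker
  |by apply: bcsZ].
rewrite !(intZ sR)//; last exact: bcs_ker.
rewrite -/NP => /eqP; rewrite subr_eq0 => /eqP H.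
have rr : d ^+ 2 = r^-1 by rewrite /r invrK.
have r0' : r != 0 by rewrite gt_eqF.
rewrite mulrAC H rr; field.
exact: r0'.
Qed.

Lemma box_gt0 M : 0 < M -> (0 < lebesgue_rV n [set x : 'rV[R]_n | (nrm x <= M)%R])%E.
Proof.
move=> M0; elim: n => [|m IH].
  rewrite /= diracE mem_set ?lte01//= /nrm.
  by apply: rV_norm_le => [|[]//]; exact: ltW.
rewrite /= /lebesgue_step /pushforward.
rewrite (_ : _ @^-1` _ = `[-M, M]%classic `*` [set x | nrm x <= M]); last first.
  apply/seteqP; split => p /=; rewrite /nrm norm_cons_rV ge_max in_itv/= ler_norml.
    by move=> /andP[].
  by move=> [-> ->].
have mB : measurable [set x : 'rV[R]_m | nrm x <= M].
  exact: (measurable_sublevel (sized_rV m)).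
rewrite product_measure1E//; apply: mule_gt0; last exact: IH.
rewrite /= lebesgue_measure_itv/= lte_fin.
by rewrite ifT ?gtrN// -EFinB lte_fin; lra.
Qed.

Lemma NP_gt0 : 0 < NP.
Proof.
(* On this box sqnorm / d^2 is at most 1/2, so the exponent in [profile] is at least -4. *)
pose M := Num.min 1 (r^-1 / (2 * n.+1%:R)).
have M0 : 0 < M.
  by rewrite lt_min ltr01 divr_gt0 ?invr_gt0 ?mulr_gt0.
have mB : measurable [set x : 'rV[R]_n | nrm x <= M] by exact: measurable_sublevel sR M.
pose B : 'rV[R]_n -> R := \1_[set x | nrm x <= M].
have bB : bcs nrm B.
  exact: (bcs_indic (M := M)).
apply: (@lt_le_trans _ _ (expR (- 4) * Int B)).
  rewrite mulr_gt0 ?expR_gt0// /Rintegral integral_indic//= setIT.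
  by rewrite fine_gt0// box_gt0//=; exact: sR.2.
rewrite -(intZ sR)//; apply: (le_int sR); [|exact: bcs_ker|].
  exact: bcsZ.
move=> x; rewrite /B indicE; case: (boolP (x \in _)) => [|_]; last by rewrite mulr0 ker_ge0.
move=> /set_mem/= xM; rewrite mulr1 /ker /profile -/r expr0 mul1r.
have s2 : r * sqnorm x <= 2^-1.
  have : sqnorm x <= n.+1%:R * M.
    rewrite (@le_trans _ _ (\sum_(i < n) M))//.
      apply: ler_sum => i _; have xi := le_trans (ler_coord_norm x i) xM.
      rewrite -real_normK ?num_real// (le_trans _ xi)// expr2 ler_piMl//.
      by rewrite (le_trans xi)// ge_min lexx.
    by rewrite sumr_const card_ord -[leLHS]mulr_natl ler_wpM2r ?ler_nat// ltW.
  move=> h; rewrite (@le_trans _ _ (r * (n.+1%:R * M)))// ?ler_pM2l//.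
  rewrite (@le_trans _ _ (r * (n.+1%:R * (r^-1 / (2 * n.+1%:R)))))//.
    by rewrite ler_pM2l// ler_pM2l// ge_min lexx orbT.
  have r0' : r != 0 by rewrite gt_eqF.
  rewrite le_eqVlt; apply/orP; left; apply/eqP; field.
  by rewrite r0' andbT nat1r pnatr_eq0.
rewrite ifT; last lra.
rewrite ler_expR mulNr lerN2 (_ : 4 = 2 * 2 :> R); last by ring.
by rewrite ler_pM2l// -[leRHS]invrK lef_pV2 ?posrE; lra.
Qed.

Lemma le_NP_Np : NP <= Np.
Proof. by apply: (le_int sR); [exact: bcs_ker|exact: bcs_ker|exact: ker02]. Qed.

(** The diagonal second moments evaluate the integral of [ker 1] as Np - (n/4) NP, and [ker1_le]
    bounds it by the mean of the two masses. The ratio of the masses is thus bounded uniformly in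
    [d]. *)
Lemma Np_le_NP : Np <= (1 + n%:R / 2) * NP.
Proof.
have b2 : bcs nrm (fun z : 'rV[R]_n => (1 - r * sqnorm z) * ker 2 z).
  apply: bcsMl; last exact: bcs_ker.
  apply: lbmB; [exact: lbm_cst|apply: lbmM; first exact: lbm_cst].
  by apply: lbm_continuous; exact: sqnorm_continuous.
have bij (i : 'I_n) : bcs nrm (fun z : 'rV[R]_n => z ord0 i * (z ord0 i * ker 2 z)).
  by do 2 (apply: bcsMl; first exact: lbm_coord); exact: bcs_ker.
have E : Int (fun z : 'rV[R]_n => (1 - r * sqnorm z) * ker 2 z) = Np - n%:R / 4 * NP.
  rewrite (_ : (fun z => _) = fun z => ker 2 z - r * \sum_i z ord0 i * (z ord0 i * ker 2 z)).
    rewrite (intB sR); [|exact: bcs_ker|]; last first.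
      by apply: bcsZ; exact: bcs_sum.
    rewrite (intZ sR); last exact: bcs_sum.
    rewrite (int_sum sR)// -/Np; congr (_ - _).
    under eq_bigr do rewrite int_ker_moment2 eqxx mul1r.
    rewrite sumr_const card_ord -[_ *+ n]mulr_natl.
    have rr : d ^+ 2 = r^-1 by rewrite /r invrK.
    rewrite rr; field; rewrite gt_eqF//.
  apply/funext => z; rewrite mulrBl mul1r -mulrA; congr (_ - _ * _).
  by rewrite /sqnorm mulr_suml; apply: eq_bigr => i _; rewrite expr2 mulrA.
have : Int (fun z : 'rV[R]_n => (1 - r * sqnorm z) * ker 2 z) <= (NP + Np) / 2.
  have bh : bcs nrm (fun z : 'rV[R]_n => (ker 0 z + ker 2 z) / 2).
    by apply: bcsMr; [apply: bcsD; exact: bcs_ker|exact: lbm_cst].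
  rewrite /NP /Np -(intD sR); [|exact: bcs_ker|exact: bcs_ker].
  rewrite -(intZr sR); last by apply: bcsD; exact: bcs_ker.
  by apply: (le_int sR) => // z; exact: ker1_le.
rewrite E; lra.
Qed.

Lemma sqnorm_convex (t : R) x y : 0 <= t <= 1 ->
  sqnorm ((1 - t) *: x + t *: y) <= (1 - t) * sqnorm x + t * sqnorm y.
Proof.
move=> /andP[t0 t1]; rewrite /sqnorm !mulr_sumr -big_split/=; apply: ler_sum => i _.
rewrite !mxE -subr_ge0.
rewrite [leRHS](_ : _ = (1 - t) * t * (x ord0 i - y ord0 i) ^+ 2); last by ring.
by rewrite mulr_ge0 ?sqr_ge0// mulr_ge0// subr_ge0.
Qed.

(** In terms of a = 1 - sqnorm z / d^2, which is concave in z, the logarithm of [ker 2] is 2 psi(a)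
    with psi(a) = - ln a - 1/a, and psi is increasing and concave between 0 and 1. *)
Lemma ker_logconcave (t : R) x y : 0 < t < 1 ->
  ker 2 x `^ (1 - t) * ker 2 y `^ t <= ker 2 ((1 - t) *: x + t *: y).
Proof.
move=> /andP[t0 t1]; have t1' : 0 < 1 - t by rewrite subr_gt0.
rewrite /ker -/r; set sx := sqnorm x; set sy := sqnorm y; set sw := sqnorm _.
have sconv : sw <= (1 - t) * sx + t * sy by apply: sqnorm_convex; rewrite (ltW t0) (ltW t1).
have [x1|x1] := ltP (r * sx) 1; last first.
  by rewrite {1}/profile ltNge x1/= powR0 ?gt_eqF// mul0r profile_ge0.
have [y1|y1] := ltP (r * sy) 1; last first.
  by rewrite {2}/profile ltNge y1/= powR0 ?gt_eqF// mulr0 profile_ge0.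
pose u := 1 - r * sx; pose v := 1 - r * sy; pose w := 1 - r * sw.
have u0 : 0 < u by rewrite subr_gt0.
have v0 : 0 < v by rewrite subr_gt0.
have uvw : (1 - t) * u + t * v <= w.
  have := ler_wpM2l (ltW r0) sconv; rewrite /u /v /w; lra.
have w0 : 0 < w by apply: lt_le_trans uvw; rewrite addr_gt0// mulr_gt0.
have w1 : w <= 1 by rewrite gerBl mulr_ge0 ?sqnorm_ge0 ?(ltW r0).
pose psi (a : R) := - ln a - a^-1.
have thE a : 0 < a -> a^-1 ^+ 2 * expR (- 2 * a^-1) = expR (2 * psi a).
  move=> a0; rewrite /psi mulrBr expRD -mulNr; congr (_ * _).
  by rewrite -[a^-1]lnK ?posrE ?invr_gt0// -expRM_natl lnV ?posrE.
have wlt : r * sw < 1 by rewrite -subr_gt0.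
rewrite /profile x1 y1 wlt -/u -/v -/w !thE//.
rewrite /powR !gt_eqF ?expR_gt0// !expRK -expRD ler_expR.
(* The graph of psi lies below its tangent at w. The slope there is nonnegative because w <= 1, so
   (1 - t) u + t v may afterwards be replaced by the larger w. *)
have H a : 0 < a -> psi a - psi w <= (a - w) * ((1 - w) / w ^+ 2).
  move=> a0; have wa0 : 0 < w / a by rewrite divr_gt0.
  have := expR_ge1Dx (ln (w / a)); rewrite lnK ?posrE// ln_div ?posrE// => h.
  have : 0 <= (a - w) ^+ 2 * (1 - w) / (a * w ^+ 2).
    by apply: divr_ge0; apply: mulr_ge0; rewrite ?sqr_ge0 ?subr_ge0//; exact: ltW.
  have -> : (a - w) ^+ 2 * (1 - w) / (a * w ^+ 2) =
      (a - w) * ((1 - w) / w ^+ 2) - (w / a - 1 - a^-1 + w^-1).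
    by field; rewrite !gt_eqF.
  rewrite /psi; lra.
have Hu := ler_wpM2l (ltW t1') (H u u0); have Hv := ler_wpM2l (ltW t0) (H v v0).
have q0 : 0 <= (1 - w) / w ^+ 2 by rewrite divr_ge0 ?sqr_ge0 ?subr_ge0.
have := ler_wpM2r q0 uvw; move: Hu Hv.
set q := (1 - w) / w ^+ 2 => Hu Hv Hw; lra.
Qed.

End kernel.

(** * Quadratic forms *)

Lemma discriminant_le (R : realFieldType) (A B C : R) :
  (forall s, 0 <= A - 2 * s * B + s ^+ 2 * C) -> B ^+ 2 <= A * C.
Proof.
move=> H; have [C0|C0|C0] := ltgtP C 0.
- have A0 := H 0; rewrite mulr0 mul0r subr0 expr0n/= mul0r addr0 in A0.
  (* A negative leading coefficient is impossible: this s is so large that the polynomial is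
     negative at s or at - s. *)
  exfalso; pose s := (A + `|B| + 1) / - C + 1.
  have h1 := H s; have h2 := H (- s).
  have C0' : 0 < - C by rewrite oppr_gt0.
  have s1 : 1 <= s by rewrite lerDr; apply: divr_ge0; [rewrite !addr_ge0|exact: ltW].
  have sC : s * - C = A + `|B| + 1 - C by rewrite /s; field; rewrite lt_eqF.
  have : s ^+ 2 * - C >= A + 1.
    rewrite expr2 -mulrA sC; have B0 := normr_ge0 B.
    rewrite (@le_trans _ _ (1 * (A + `|B| + 1 - C)))//; first lra.
    by rewrite ler_wpM2r//; lra.
  by move: h1 h2; rewrite sqrrN; lra.
- have := H (B / C) => h.
  have : 0 <= (A - 2 * (B / C) * B + (B / C) ^+ 2 * C) * C by rewrite mulr_ge0// ltW.
  have -> : (A - 2 * (B / C) * B + (B / C) ^+ 2 * C) * C = A * C - B ^+ 2.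
    by field; rewrite gt_eqF.
  by rewrite subr_ge0.
- rewrite C0 mulr0; have [->|B0] := eqVneq B 0; first by rewrite expr0n.
  have := H ((A + 1) / (2 * B)); rewrite C0 mulr0 addr0.
  have -> : A - 2 * ((A + 1) / (2 * B)) * B = - 1 by field.
  by rewrite ler0N1.
Qed.

Section forms.
Context {R : realType} {n : nat}.
Notation rV := 'rV[R]_n.
Implicit Types (k F G f : rV -> R) (x y z : rV).
Let sR := sized_rV (R := R) n.
Let s2 := sized_prod sR sR.

Definition bcs2 (K : rV * rV -> R) := bcs (maxN nrm nrm) K.
Definition lbm2 (K : rV * rV -> R) := lbm (maxN nrm nrm) K.
Definition int2 (K : rV * rV -> R) : R :=
  Rintegral (lebesgue_rV n \x lebesgue_rV n)%E setT K.

Lemma bcs2_l k F (G : rV * rV -> R) : bcs nrm k -> bcs nrm F -> lbm2 G ->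
  bcs2 (fun p => k (p.1 - p.2) * (F p.1 * G p)).
Proof.
by move=> bk bF lG; under eq_fun do rewrite mulrA; apply: bcsMr => //; exact: bcs_sub1.
Qed.

Lemma bcs2_r k F (G : rV * rV -> R) : bcs nrm k -> bcs nrm F -> lbm2 G ->
  bcs2 (fun p => k (p.1 - p.2) * (F p.2 * G p)).
Proof.
by move=> bk bF lG; under eq_fun do rewrite mulrA; apply: bcsMr => //; exact: bcs_sub2.
Qed.

Lemma int2_iter K : bcs2 K -> int2 K = Int (fun x => Int (fun y => K (x, y))).
Proof. by move=> bK; rewrite /int2 (int_prod sR sR). Qed.

Lemma int_even k x : bcs nrm k -> (forall z, k (- z) = k z) ->
  Int (fun y => k (x - y)) = Int k.
Proof.
move=> bk ek; rewrite -(int_shift (- x) bk).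
by congr Rintegral; apply/funext => y; rewrite -ek opprB.
Qed.

Lemma int_odd k x : bcs nrm k -> (forall z, k (- z) = - k z) ->
  Int (fun y => k (x - y)) = - Int k.
Proof.
move=> bk ek; rewrite -(int_shift (- x) bk) -(intN sR); last exact: bcs_shift.
by congr Rintegral; apply/funext => y; rewrite -ek opprB.
Qed.

Lemma int2_fst k F : bcs nrm k -> bcs nrm F -> (forall z, k (- z) = k z) ->
  int2 (fun p => k (p.1 - p.2) * F p.1) = Int k * Int F.
Proof.
move=> bk bF ek; rewrite int2_iter; last exact: bcs_sub1.
rewrite -(intZ sR)//; congr Rintegral; apply/funext => x /=.
rewrite (intZr sR); last exact: bcs_shiftN.
by rewrite int_even.
Qed.

Lemma int2_snd k F : bcs nrm k -> bcs nrm F -> (forall z, k (- z) = k z) ->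
  int2 (fun p => k (p.1 - p.2) * F p.2) = Int k * Int F.
Proof.
move=> bk bF ek; rewrite int2_iter; last exact: bcs_sub2.
rewrite (int_fubini sR sR (bcs_sub2 bk bF)) -(intZ sR)//.
congr Rintegral; apply/funext => y /=.
rewrite (intZr sR); last exact: bcs_shift.
by rewrite (int_shift (- y) bk).
Qed.

Lemma int2_conv k F G : bcs nrm k -> bcs nrm F -> bcs nrm G ->
  int2 (fun p => k (p.1 - p.2) * (F p.1 * G p.2)) = Int (fun x => F x * conv k G x).
Proof.
move=> bk bF bG; have lG := bcs_lbm bG; rewrite int2_iter; last first.
  by apply: bcs2_l => //; apply: lbm_snd.
congr Rintegral; apply/funext => x /=; rewrite /conv -(intZ sR).
  by congr Rintegral; apply/funext => y; ring.
exact: bcs_conv_integrand.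
Qed.

Lemma conv_sym k F G : bcs nrm k -> bcs nrm F -> bcs nrm G -> (forall z, k (- z) = k z) ->
  Int (fun x => F x * conv k G x) = Int (fun x => G x * conv k F x).
Proof.
move=> bk bF bG ek; have lF := bcs_lbm bF; have lG := bcs_lbm bG.
have b1 : bcs2 (fun p => k (p.1 - p.2) * (F p.1 * G p.2)).
  by apply: bcs2_l => //; apply: lbm_snd.
have b2 : bcs2 (fun p => k (p.1 - p.2) * (G p.1 * F p.2)).
  by apply: bcs2_l => //; apply: lbm_snd.
rewrite -!int2_conv// !int2_iter// (int_fubini sR sR b1).
congr Rintegral; apply/funext => x; congr Rintegral; apply/funext => y /=.
by rewrite -ek opprB; ring.
Qed.

Lemma bcs2_diff k F : bcs nrm k -> bcs nrm F ->
  bcs2 (fun p => k (p.1 - p.2) * (F p.1 - F p.2) ^+ 2).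
Proof.
move=> bk bF; have lF := bcs_lbm bF.
have l1 : lbm2 (fun p => F p.1) by apply: lbm_fst.
have l2 : lbm2 (fun p => F p.2) by apply: lbm_snd.
rewrite (_ : (fun p => _) = fun p => k (p.1 - p.2) * (F p.1 * (F p.1 - 2 * F p.2)) +
  k (p.1 - p.2) * (F p.2 * F p.2)); last by apply/funext => p; ring.
apply: bcsD; last exact: bcs2_r.
by apply: bcs2_l => //; apply: lbmB => //; apply: lbmM => //; exact: lbm_cst.
Qed.

Definition energy k F := int2 (fun p => k (p.1 - p.2) * (F p.1 - F p.2) ^+ 2).

(** Expanding the square: the two squared terms both integrate to the mass of [k] times that of F^2.
    Hence a form close to its maximal value means a small energy. *)
Lemma energyE k F : bcs nrm k -> bcs nrm F -> (forall z, k (- z) = k z) ->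
  energy k F = 2 * (Int k * Int (fun x => F x ^+ 2) - Int (fun x => F x * conv k F x)).
Proof.
move=> bk bF ek; have lF := bcs_lbm bF; have bF2 := bcsX 1 bF.
have b1 := bcs_sub1 bk bF2; have b2 := bcs_sub2 bk bF2.
have b3 : bcs2 (fun p => k (p.1 - p.2) * (F p.1 * F p.2)).
  by apply: bcs2_l => //; apply: lbm_snd.
have b4 : bcs2 (fun p => 2 * (k (p.1 - p.2) * (F p.1 * F p.2))).
  exact: bcsZ.
rewrite /energy (_ : (fun p => _) = fun p => k (p.1 - p.2) * F p.1 ^+ 2 +
   k (p.1 - p.2) * F p.2 ^+ 2 - 2 * (k (p.1 - p.2) * (F p.1 * F p.2))); last first.
  by apply/funext => p; ring.
rewrite /int2 (intB s2)//; last exact: bcsD.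
rewrite (intD s2)// (intZ s2)//.
move: (int2_fst bk bF2 ek) (int2_snd bk bF2 ek) (int2_conv bk bF bF); rewrite /int2 => -> -> ->.
by ring.
Qed.

Lemma energy_ge0 k F : (forall z, 0 <= k z) -> 0 <= energy k F.
Proof. by move=> k0; apply: int_ge0 => p; rewrite mulr_ge0// sqr_ge0. Qed.

Lemma int_cauchy_schwarz_weight k F G : bcs nrm k -> lbm nrm F -> lbm nrm G ->
  (forall z, 0 <= k z) ->
  Int (fun x => k x * (F x * G x)) ^+ 2 <=
    Int (fun x => k x * F x ^+ 2) * Int (fun x => k x * G x ^+ 2).
Proof.
move=> bk lF lG k0; apply: discriminant_le => s.
have b1 : bcs nrm (fun x => k x * F x ^+ 2) by apply: bcsMr => //; exact: lbmX.
have b2 : bcs nrm (fun x => k x * G x ^+ 2) by apply: bcsMr => //; exact: lbmX.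
have b3 : bcs nrm (fun x => k x * (F x * G x)) by apply: bcsMr => //; exact: lbmM.
have b4 : bcs nrm (fun x => 2 * s * (k x * (F x * G x))).
  exact: bcsZ.
have b5 : bcs nrm (fun x => s ^+ 2 * (k x * G x ^+ 2)).
  exact: bcsZ.
rewrite -(intZ sR)// -(intZ sR)// -(intB sR)// -(intD sR)//; last exact: bcsB.
apply: int_ge0 => x.
rewrite (_ : _ + _ = k x * (F x - s * G x) ^+ 2); last by ring.
by rewrite mulr_ge0// sqr_ge0.
Qed.

Lemma int_cauchy_schwarz F G : bcs nrm F -> bcs nrm G ->
  Int (fun x => F x * G x) ^+ 2 <= Int (fun x => F x ^+ 2) * Int (fun x => G x ^+ 2).
Proof.
move=> bF bG; apply: discriminant_le => s.
have b1 := bcsX 1 bF; have b2 := bcsX 1 bG.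
have b3 : bcs nrm (fun x => F x * G x) by apply: bcsMr => //; exact: bcs_lbm.
have b4 : bcs nrm (fun x => 2 * s * (F x * G x)) by exact: bcsZ.
have b5 : bcs nrm (fun x => s ^+ 2 * (G x ^+ 2)) by exact: bcsZ.
rewrite -(intZ sR)// -(intZ sR)// -(intB sR)// -(intD sR)//; last exact: bcsB.
apply: int_ge0 => x.
by rewrite (_ : _ + _ = (F x - s * G x) ^+ 2) ?sqr_ge0//; ring.
Qed.

(* Jensen for the weight k(x - y) dy *)
Lemma int_sqr_diff_conv k F : bcs nrm k -> bcs nrm F -> (forall z, 0 <= k z) ->
  (forall z, k (- z) = k z) ->
  Int (fun x => (Int k * F x - conv k F x) ^+ 2) <= Int k * energy k F.
Proof.
move=> bk bF k0 ek; have lF := bcs_lbm bF; have bd := bcs2_diff bk bF.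
rewrite /energy int2_iter// -(intZ sR); last exact: (bcs_int sR sR bd).
apply: (le_int sR).
- apply: bcsX; apply: bcsB; last exact: bcs_conv.
  exact: bcsZ.
- by apply: bcsZ; exact: (bcs_int sR sR bd).
move=> x /=; have bkx := bcs_shiftN x bk.
have lFx : lbm nrm (fun y => F x - F y) by apply: lbmB => //; exact: lbm_cst.
have := int_cauchy_schwarz_weight bkx (lbm_cst nrm 1) lFx (fun y => k0 (x - y)).
rewrite (_ : (fun y => k (x - y) * (1 * (F x - F y))) = fun y => k (x - y) * (F x - F y));
  last by apply/funext => y; rewrite mul1r.
rewrite (_ : (fun y => k (x - y) * 1 ^+ 2) = fun y => k (x - y));
  last by apply/funext => y; rewrite expr1n mulr1.
rewrite int_even//; congr (_ ^+ 2 <= _); rewrite /conv.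
have e1 : Int k * F x = Int (fun y => k (x - y) * F x).
  by rewrite (intZr sR)// int_even.
rewrite e1 -(intB sR); last 2 first.
- by apply: bcsMr => //; exact: lbm_cst.
- exact: bcs_conv_integrand.
by congr Rintegral; apply/funext => y; rewrite mulrBr.
Qed.

End forms.

(** * Estimates for the mollification of a rough function *)

Section kernel_estimates.
Context {R : realType} {n : nat}.
Variable d : R.
Hypothesis d0 : 0 < d.
Notation rV := 'rV[R]_n.
Implicit Types (F G f u : rV -> R) (x y z : rV).
Let sR := sized_rV (R := R) n.
Let s2 := sized_prod sR sR.
Notation p := (@ker R n d 2).
Notation P := (@ker R n d 0).
Notation NP := (@NP R n d).
Notation Np := (@Np R n d).
Notation c := (d ^+ 2 / 4).

Let bp : bcs nrm p. Proof. exact: bcs_ker. Qed.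
Let bP : bcs nrm P. Proof. exact: bcs_ker. Qed.
Let NP0 : 0 < NP. Proof. exact: NP_gt0. Qed.
Let Np0 : 0 < Np. Proof. exact: lt_le_trans NP0 (le_NP_Np d0). Qed.
Let c0 : 0 < c. Proof. by rewrite divr_gt0 ?exprn_gt0. Qed.

Definition coord_ker (i : 'I_n) z := z ord0 i * p z.

Let bq i : bcs nrm (coord_ker i).
Proof. by apply: bcsMl => //; exact: lbm_coord. Qed.

Let bqq i j : bcs nrm (fun z => z ord0 j * coord_ker i z).
Proof. by apply: bcsMl => //; exact: lbm_coord. Qed.

(* Bessel's inequality in L^2(p) for the orthogonal functions 1, z_1, ..., z_n. *)
Lemma conv_bessel F x : bcs nrm F ->
  conv p F x ^+ 2 / Np + (\sum_i conv (coord_ker i) F x ^+ 2) / (c * NP) <=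
  conv p (fun y => F y ^+ 2) x.
Proof.
move=> bF; have lF := bcs_lbm bF; have lF2 := lbmX 2 lF.
(* Coefficients of the projection of F(y) onto 1 and the (x - y)_i: for the weight p(x - y) these
   functions have squared norms Np and c NP. *)
pose a := conv p F x / Np; pose b i := conv (coord_ker i) F x / (c * NP).
have B1 := bcs_conv_integrand x bp lF2.
have B2 : bcs nrm (fun y => 2 * a * (p (x - y) * F y)).
  by apply: bcsZ; exact: bcs_conv_integrand.
have B3 : bcs nrm (fun y => a ^+ 2 * p (x - y)).
  by apply: bcsZ; exact: bcs_shiftN.
have B4' i : bcs nrm (fun y => b i * (coord_ker i (x - y) * F y)).
  by apply: bcsZ; exact: bcs_conv_integrand.
have B4 : bcs nrm (fun y => 2 * \sum_i b i * (coord_ker i (x - y) * F y)).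
  by apply: bcsZ; exact: bcs_sum.
have B5' i : bcs nrm (fun y => b i * coord_ker i (x - y)).
  by apply: bcsZ; exact: bcs_shiftN.
have B5 : bcs nrm (fun y => 2 * a * \sum_i b i * coord_ker i (x - y)).
  by apply: bcsZ; exact: bcs_sum.
have B6'' i j : bcs nrm (fun y => b i * b j * ((x - y) ord0 j * coord_ker i (x - y))).
  by apply: bcsZ; exact: (bcs_shiftN x (bqq i j)).
have B6' i : bcs nrm (fun y => \sum_j b i * b j * ((x - y) ord0 j * coord_ker i (x - y))).
  by apply: bcs_sum => j; exact: B6''.
have B6 : bcs nrm (fun y => \sum_i \sum_j b i * b j * ((x - y) ord0 j * coord_ker i (x - y))).
  exact: bcs_sum.
(* The weighted square of the residual: first moments vanish by oddness, mixed second moments by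
   [int_ker_moment2]. *)
have E : Int (fun y => p (x - y) * (F y - a - \sum_i b i * (x - y) ord0 i) ^+ 2) =
    conv p (fun y => F y ^+ 2) x - 2 * a * conv p F x + a ^+ 2 * Np
    - 2 * (\sum_i b i * conv (coord_ker i) F x) + \sum_i b i ^+ 2 * (c * NP).
  rewrite (_ : (fun y => _) = fun y => p (x - y) * F y ^+ 2 - 2 * a * (p (x - y) * F y)
     + a ^+ 2 * p (x - y) - 2 * (\sum_i b i * (coord_ker i (x - y) * F y))
     + 2 * a * (\sum_i b i * coord_ker i (x - y))
     + \sum_i \sum_j b i * b j * ((x - y) ord0 j * coord_ker i (x - y))); last first.
    apply/funext => y; set S := \sum_i b i * _.
    have -> : \sum_i b i * (coord_ker i (x - y) * F y) = p (x - y) * F y * S.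
      by rewrite /S mulr_sumr; apply: eq_bigr => i _; rewrite /coord_ker; ring.
    have -> : \sum_i b i * coord_ker i (x - y) = p (x - y) * S.
      by rewrite /S mulr_sumr; apply: eq_bigr => i _; rewrite /coord_ker; ring.
    have -> : \sum_i \sum_j b i * b j * ((x - y) ord0 j * coord_ker i (x - y)) =
        p (x - y) * (S * S).
      rewrite {1}/S mulr_suml mulr_sumr; apply: eq_bigr => i _.
      rewrite /S !mulr_sumr; apply: eq_bigr => j _; rewrite /coord_ker; ring.
    by ring.
  rewrite (intD sR)//; last by do ?[apply: bcsB|apply: bcsD].
  rewrite (intD sR)//; last by do ?[apply: bcsB|apply: bcsD].
  rewrite (intB sR)//; last by do ?[apply: bcsB|apply: bcsD].
  rewrite (intD sR)//; last by do ?[apply: bcsB|apply: bcsD].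
  rewrite (intB sR)//.
  rewrite (intZ sR); last exact: bcs_conv_integrand.
  rewrite (intZ sR); last exact: bcs_shiftN.
  rewrite (intZ sR); last exact: bcs_sum.
  rewrite (intZ sR); last exact: bcs_sum.
  rewrite !(int_sum sR)//.
  rewrite int_even//; last exact: kerN.
  have -> : \sum_i Int (fun y => b i * coord_ker i (x - y)) = 0.
    apply: big1 => i _; rewrite (intZ sR); last exact: bcs_shiftN.
    rewrite int_odd//; last by move=> z; rewrite /coord_ker kerN mxE mulNr.
    by rewrite int_ker_moment1// oppr0 mulr0.
  rewrite mulr0 addr0; congr (_ - 2 * _ + _).
    by apply: eq_bigr => i _; rewrite (intZ sR)//; exact: bcs_conv_integrand.
  apply: eq_bigr => i _; rewrite (int_sum sR)// (bigD1 i)//= big1 ?addr0; last first.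
    move=> j ji; rewrite (intZ sR); last exact: (bcs_shiftN x (bqq i j)).
    rewrite (@int_even _ _ (fun z => z ord0 j * coord_ker i z))//; last first.
      by move=> z; rewrite /coord_ker kerN !mxE; ring.
    by rewrite int_ker_moment2// eq_sym (negbTE ji) !mul0r mulr0.
  rewrite (intZ sR); last exact: (bcs_shiftN x (bqq i i)).
  rewrite (@int_even _ _ (fun z => z ord0 i * coord_ker i z))//; last first.
    by move=> z; rewrite /coord_ker kerN !mxE; ring.
  by rewrite int_ker_moment2// eqxx mul1r.
have : 0 <= Int (fun y => p (x - y) * (F y - a - \sum_i b i * (x - y) ord0 i) ^+ 2).
  by apply: int_ge0 => y; rewrite mulr_ge0 ?ker_ge0 ?sqr_ge0.
rewrite E /a.
have -> : \sum_i b i * conv (coord_ker i) F x = (\sum_i conv (coord_ker i) F x ^+ 2) / (c * NP).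
  by rewrite mulr_suml; apply: eq_bigr => i _; rewrite /b; ring.
have -> : \sum_i b i ^+ 2 * (c * NP) = (\sum_i conv (coord_ker i) F x ^+ 2) / (c * NP).
  rewrite mulr_suml; apply: eq_bigr => i _; rewrite /b; field.
  by rewrite !gt_eqF.
set A := conv p F x; set T := _ / (c * NP).
have -> : 2 * (A / Np) * A = 2 * (A ^+ 2 / Np) by ring.
have -> : (A / Np) ^+ 2 * Np = A ^+ 2 / Np by field; rewrite gt_eqF.
lra.
Qed.

(** [ker 0] is the mollifier so that the gradient of the result consists of the first moments
    [conv (coord_ker i) F], which [conv_bessel] bounds. *)
Definition smoothing F x := NP^-1 * conv P F x.

Lemma ctest_smoothing F : bcs nrm F -> ctest (smoothing F).
Proof.
by move=> bF; apply: ctestM; [exact: smooth_cst|apply: ctest_conv => //; exact: ctest_ker].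
Qed.

Lemma partial_smoothing F i x : bcs nrm F ->
  partial i (smoothing F) x = - (c * NP)^-1 * conv (coord_ker i) F x.
Proof.
move=> bF; have lF := bcs_lbm bF; have cP := ctest_ker (n := n) d0 0.
rewrite /smoothing partialM; [|exact: smooth_cst|exact: (ctest_conv cP bF).1].
rewrite (_ : partial i (fun=> NP^-1) x = 0); last exact: derive_cst.
rewrite mulr0 addr0 partial_conv// {1}/conv.
rewrite (_ : (fun y => _) = fun y => - (4 * d ^- 2) * (coord_ker i (x - y) * F y)); last first.
  by apply/funext => y; rewrite partial_ker0// /coord_ker; ring.
rewrite (intZ sR); last exact: bcs_conv_integrand.
by rewrite -/(conv _ _ _); field; rewrite !gt_eqF.
Qed.

(** The integrated Bessel inequality bounds the first moments by Np |F|^2 - |p conv F|^2 / Np, and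
    |p conv F|^2 >= 2 Np <F, p conv F> - Np^2 |F|^2 since the square of p conv F - Np F is
    nonnegative. Division by 2 Np turns the factor on the left into [step d]. *)
Lemma smoothing_energy F : bcs nrm F ->
  c * NP * Int (fun x => sqnorm (grad (smoothing F) x)) <=
    2 * (Np * Int (fun x => F x ^+ 2) - Int (fun x => F x * conv p F x)).
Proof.
move=> bF; have lF := bcs_lbm bF; have bF2 := bcsX 1 bF.
have bpF := bcs_conv bp bF.
have bg i : bcs nrm (fun x => conv (coord_ker i) F x ^+ 2) by apply: bcsX; exact: bcs_conv.
have E : Int (fun x => sqnorm (grad (smoothing F) x)) =
    (c * NP) ^- 2 * Int (fun x => \sum_i conv (coord_ker i) F x ^+ 2).
  rewrite -(intZ sR); last exact: bcs_sum.
  congr Rintegral; apply/funext => x; rewrite /sqnorm mulr_sumr.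
  apply: eq_bigr => i _; rewrite mxE partial_smoothing// exprMn sqrrN.
  by rewrite exprVn.
have H : Int (fun x => conv p F x ^+ 2) / Np +
    Int (fun x => \sum_i conv (coord_ker i) F x ^+ 2) / (c * NP) <= Np * Int (fun x => F x ^+ 2).
  have -> : Np * Int (fun x => F x ^+ 2) = Int (conv p (fun y => F y ^+ 2)).
    rewrite -(int2_snd bp bF2); last exact: kerN.
    by rewrite int2_iter//; exact: (bcs_sub2 bp bF2).
  rewrite -!(intZr sR)//; [|exact: bcs_sum|exact: bcsX].
  rewrite -(intD sR); [|by apply: bcsMr; [exact: bcsX|exact: lbm_cst]
    |by apply: bcsMr; [exact: bcs_sum|exact: lbm_cst]].
  apply: (le_int sR).
  - by apply: bcsD; apply: bcsMr; [exact: bcsX|exact: lbm_cst|exact: bcs_sum|exact: lbm_cst].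
  - exact: bcs_conv.
  - by move=> x; exact: conv_bessel.
have J : 2 * Np * Int (fun x => F x * conv p F x) - Np ^+ 2 * Int (fun x => F x ^+ 2) <=
    Int (fun x => conv p F x ^+ 2).
  have bFp : bcs nrm (fun x => F x * conv p F x) by apply: bcsMl.
  have b1 : bcs nrm (fun x => 2 * Np * (F x * conv p F x)) by exact: bcsZ.
  have b2 : bcs nrm (fun x => Np ^+ 2 * (F x ^+ 2)) by exact: bcsZ.
  rewrite -(intZ sR)// -(intZ sR)// -(intB sR)//.
  apply: (le_int sR); [exact: bcsB|exact: bcsX|move=> x].
  rewrite -subr_ge0 (_ : _ - _ = (conv p F x - Np * F x) ^+ 2) ?sqr_ge0//; ring.
rewrite E.
set A := Int (fun x => \sum_i _) in H *; set B := Int (fun x => F x ^+ 2) in H J *.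
set D := Int (fun x => F x * _) in J *; set X := Int (fun x => conv p F x ^+ 2) in H J.
have -> : c * NP * ((c * NP) ^- 2 * A) = A / (c * NP).
  by field; rewrite !gt_eqF.
have : 2 * D - Np * B <= X / Np.
  rewrite ler_pdivlMr//; apply: le_trans J; rewrite le_eqVlt; apply/orP; left.
  by apply/eqP; ring.
lra.
Qed.

(** Jensen bounds the distance by the energy of [ker 0], which is at most that of [ker 2] by
    [ker02]. The factor 1 + n/2 is the bound on the ratio of the masses. *)
Lemma smoothing_close F : bcs nrm F ->
  Int (fun x => (F x - smoothing F x) ^+ 2) <=
  2 * (1 + n%:R / 2) * (Int (fun x => F x ^+ 2) - Int (fun x => F x * conv p F x) / Np).
Proof.
move=> bF; have lF := bcs_lbm bF; have bF2 := bcsX 1 bF.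
have h1 := int_sqr_diff_conv bP bF (@ker_ge0 _ _ _ _) (@kerN _ _ _ _).
have h2 : energy P F <= energy p F.
  apply: (le_int s2); [exact: bcs2_diff|exact: bcs2_diff|move=> q /=].
  by rewrite ler_wpM2r ?sqr_ge0// ker02.
rewrite [X in _ <= X]energyE// in h2; last exact: kerN.
have bd : bcs nrm (fun x => (NP * F x - conv P F x) ^+ 2).
  by apply: bcsX; apply: bcsB; [exact: bcsZ|exact: bcs_conv].
have -> : Int (fun x => (F x - smoothing F x) ^+ 2) =
    NP ^- 2 * Int (fun x => (NP * F x - conv P F x) ^+ 2).
  rewrite -(intZ sR)//; congr Rintegral; apply/funext => x; rewrite /smoothing.
  by field; rewrite gt_eqF.
rewrite -/NP in h1; rewrite -/Np in h2.
set Z := Int (fun x => (_ - _) ^+ 2) in h1 *.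
set B := Int (fun x => F x ^+ 2) in h2 *; set D := Int (fun x => F x * _) in h2 *.
have BD : 0 <= Np * B - D.
  have := le_trans (energy_ge0 F (@ker_ge0 _ _ _ _)) h2.
  by rewrite pmulr_rge0.
rewrite mulrC ler_pdivrMr ?exprn_gt0//; apply: (le_trans h1).
rewrite [leRHS](_ : _ = NP * (2 * ((1 + n%:R / 2) * NP * ((Np * B - D) / Np)))); last first.
  by field; rewrite gt_eqF.
rewrite ler_pM2l//; apply: (le_trans h2); rewrite ler_pM2l//.
rewrite -[leLHS](@divfK _ Np) ?gt_eqF// mulrC ler_wpM2r//.
  by rewrite divr_ge0// ltW.
exact: Np_le_NP.
Qed.

(** Young's inequality |a + b|^2 <= (1 + d) |a|^2 + (1 + 1/d) |b|^2 with b = x - y shorter than d;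
    the error 2 d bounds d + d^2. *)
Lemma sqnorm_ker_close k x y : d <= 1 -> ker d k (x - y) != 0 ->
  sqnorm x <= (1 + d) * sqnorm y + 2 * d.
Proof.
move=> d1 Pxy; have xy := ltW (ker_support d0 Pxy).
have h : sqnorm x <= (1 + d) * sqnorm y + (1 + d^-1) * sqnorm (x - y).
  rewrite /sqnorm !mulr_sumr -big_split/=; apply: ler_sum => i _; rewrite !mxE.
  rewrite -subr_ge0 (_ : _ - _ = d * (y ord0 i - d^-1 * (x ord0 i - y ord0 i)) ^+ 2).
    by rewrite mulr_ge0 ?sqr_ge0// ltW.
  by field; rewrite gt_eqF.
apply: (le_trans h); rewrite lerD2l.
apply: (@le_trans _ _ ((1 + d^-1) * d ^+ 2)).
  by rewrite ler_wpM2l// addr_ge0// invr_ge0 ltW.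
have -> : (1 + d^-1) * d ^+ 2 = d ^+ 2 + d by field; rewrite gt_eqF.
have : d * d <= d * 1 by rewrite ler_wpM2l// ltW.
by rewrite -expr2 mulr1; lra.
Qed.

(** Cauchy-Schwarz for the averaging weight puts the square inside the average, and on the support
    of the kernel [sqnorm x] may be exchanged for [sqnorm y]. *)
Lemma smoothing_potential F : bcs nrm F -> d <= 1 ->
  Int (fun x => sqnorm x * smoothing F x ^+ 2) <=
  (1 + d) * Int (fun x => sqnorm x * F x ^+ 2) + 2 * d * Int (fun x => F x ^+ 2).
Proof.
move=> bF d1; have lF := bcs_lbm bF; have bF2 := bcsX 1 bF.
have lsq : lbm nrm (@sqnorm R n) by apply: lbm_continuous; exact: sqnorm_continuous.
have bsF : bcs nrm (fun x => sqnorm x * F x ^+ 2) by apply: bcsMl.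
have bcF := bcs_conv bP bF2.
have bG : bcs nrm (fun x => (1 + d) * (sqnorm x * F x ^+ 2) + 2 * d * F x ^+ 2).
  by apply: bcsD; exact: bcsZ.
rewrite -(intZ sR)// -(intZ sR)// -(intD sR); [|exact: bcsZ..].
rewrite -[leRHS](mulKf (lt0r_neq0 NP0)) -[X in _ * (X * _)]/(Int P).
rewrite -(int2_snd bP bG); last exact: kerN.
rewrite -[leLHS](mulKf (lt0r_neq0 NP0)) ler_pM2l ?invr_gt0//.
have lsq1 : lbm2 (fun q : rV * rV => sqnorm q.1) by apply: lbm_fst.
apply: (@le_trans _ _ (int2 (fun q : rV * rV => P (q.1 - q.2) * (F q.2 ^+ 2 * sqnorm q.1)))).
  rewrite int2_iter; last exact: (bcs2_r bP bF2 lsq1).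
  have bs : bcs nrm (fun x => sqnorm x * smoothing F x ^+ 2).
    by apply: bcsMl => //; apply: bcsX; exact/ctest_bcs/ctest_smoothing.
  rewrite -(intZ sR)//; apply: (le_int sR).
  - exact: bcsZ.
  - exact: (bcs_int sR sR (bcs2_r bP bF2 lsq1)).
  move=> x /=.
  have := int_cauchy_schwarz_weight (bcs_shiftN x bP) (lbm_cst nrm 1) lF (fun y => ker_ge0 d 0 (x - y)).
  rewrite (_ : (fun y => P (x - y) * (1 * F y)) = fun y => P (x - y) * F y);
    last by apply/funext => y; rewrite mul1r.
  rewrite (_ : (fun y => P (x - y) * 1 ^+ 2) = fun y => P (x - y));
    last by apply/funext => y; rewrite expr1n mulr1.
  rewrite int_even//; last exact: kerN.
  rewrite -/(conv _ _ _) -/NP => h.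
  have -> : Int (fun y => P (x - y) * (F y ^+ 2 * sqnorm x)) =
      sqnorm x * Int (fun y => P (x - y) * F y ^+ 2).
    rewrite -(intZ sR); last exact: (bcs_conv_integrand x bP (lbmX 2 lF)).
    by congr Rintegral; apply/funext => y; ring.
  rewrite mulrCA ler_wpM2l ?sqnorm_ge0//.
  rewrite /smoothing -(ler_pM2l NP0); apply: le_trans h; rewrite le_eqVlt; apply/orP; left.
  by apply/eqP; field; rewrite gt_eqF.
apply: (le_int s2); [exact: (bcs2_r bP bF2 lsq1)|exact: (bcs_sub2 bP bG)|move=> [x y] /=].
have [->|Pxy] := eqVneq (P (x - y)) 0; first by rewrite !mul0r.
rewrite ler_wpM2l ?ker_ge0//.
rewrite [leRHS](_ : _ = F y ^+ 2 * ((1 + d) * sqnorm y + 2 * d)); last by ring.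
rewrite ler_wpM2l ?sqr_ge0//.
exact: (sqnorm_ker_close d1 Pxy).
Qed.

End kernel_estimates.

(** * Step size, forms, and the energy of a smooth function *)

Section two_sided_estimates.
Context {R : realType} {n : nat}.
Notation rV := 'rV[R]_n.
Implicit Types (F G f u : rV -> R) (x y z : rV).
Let sR := sized_rV (R := R) n.
Let s2 := sized_prod sR sR.
Notation p d := (@ker R n d 2).

Definition box (M : R) : rV -> R := \1_[set x | nrm x <= M].

Lemma bcs_box M : bcs nrm (box M).
Proof. by apply: (bcs_indic (M := M)) => //; exact: (measurable_sublevel sR). Qed.

Lemma nrm_sqr_le z : nrm z ^+ 2 <= sqnorm z.
Proof.
rewrite -[leRHS]sqr_sqrtr ?sqnorm_ge0// lerXn2r ?nnegrE ?sqrtr_ge0 ?normr_ge0//.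
apply: rV_norm_le => [|i]; first exact: sqrtr_ge0.
by rewrite -sqrtr_sqr ler_wsqrtr// coord_le_sqnorm.
Qed.

Lemma lbm_sqnorm : lbm nrm (@sqnorm R n).
Proof. by apply: lbm_continuous; exact: sqnorm_continuous. Qed.

Lemma lbm_gexp a : lbm nrm (@gexp R n a).
Proof. by apply: lbm_continuous; exact: smooth_continuous (smooth_gexp a). Qed.

(* Half the variance of each coordinate under the density p / Np. *)
Definition step (d : R) : R := d ^+ 2 / 4 * @NP R n d / (2 * @Np R n d).

Lemma step_gt0 d : 0 < d -> 0 < step d.
Proof.
move=> d0; have NP0 := @NP_gt0 R n d d0; have Np0 := lt_le_trans NP0 (le_NP_Np d0).
by rewrite !divr_gt0 ?mulr_gt0// divr_gt0 ?exprn_gt0.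
Qed.

Lemma step_le d : 0 < d -> d <= 1 -> step d <= d ^+ 2 /\ step d <= d.
Proof.
move=> d0 d1; have NP0 := @NP_gt0 R n d d0; have Np0 := lt_le_trans NP0 (le_NP_Np d0).
have dd : d ^+ 2 <= d by rewrite expr2 ler_piMl// ltW.
have h : step d <= d ^+ 2.
  rewrite /step ler_pdivrMr ?mulr_gt0// -mulrA ler_pM2l ?exprn_gt0//.
  have := le_NP_Np (n := n) d0; lra.
by split => //; exact: le_trans dd.
Qed.

(** The Schroedinger form without its constant - n/2, hence nonnegative; the constant reappears in
    [schrodinger_transform]. *)
Definition dirichlet u : R :=
  Int (fun x => sqnorm (grad u x)) + Int (fun x => sqnorm x * u x ^+ 2) / 4.

(* To leading order as d -> 0, [form d f / Np] is |f|^2 minus [step d] times the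
   Dirichlet form: the convolution accounts for the gradient and the weight for the
   potential sqnorm / 4. *)
Definition weighted (d : R) f : rV -> R := fun x => gexp (- (step d / 8)) x * f x.

Definition form (d : R) f : R :=
  Int (fun x => weighted d f x * conv (p d) (weighted d f) x).

Lemma bcs_weighted d f : bcs nrm f -> bcs nrm (weighted d f).
Proof. by move=> bf; apply: bcsMl => //; exact: lbm_gexp. Qed.

Lemma bcs_grad u : ctest u -> bcs nrm (fun x => sqnorm (grad u x)).
Proof.
move=> cu; rewrite /sqnorm; apply: bcs_sum => i.
apply: bcsX; rewrite (_ : (fun x => _) = partial i u).
  exact/ctest_bcs/ctest_partial.
by apply/funext => x; rewrite mxE.
Qed.

(** First order Taylor expansion at x: by the second moments of [ker 2], the square of the linear
    term integrates to (d^2/4) NP |grad u|^2. The remainder is O(|x - y|^2), at most O(d |x - y|),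
    and Young's inequality with parameter [d] splits it off. *)
Lemma energy_ctest u : ctest u -> exists2 C, 0 <= C & forall d, 0 < d -> d <= 1 ->
  energy (p d) u <= d ^+ 2 / 4 * @NP R n d * (Int (fun x => sqnorm (grad u x)) + C * d).
Proof.
move=> cu; have bu := ctest_bcs cu; have [C0 C00 C0P] := ctest_taylor cu.
(* For d <= 1 and x outside this box, every y that the kernel sees is outside the support of [u] as
   well. *)
have [M uM] := cu.2; pose B := box (M + 1); have bB : bcs nrm B by exact: bcs_box.
pose G2 := Int (fun x => sqnorm (grad u x)).
have bpart i : bcs nrm (partial i u) by exact/ctest_bcs/ctest_partial.
have G20 : 0 <= G2 by apply: int_ge0 => x; exact: sqnorm_ge0.
have B0 x : 0 <= B x by rewrite /B/box indicE.
have IB0 : 0 <= Int B by apply: int_ge0.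
exists (G2 + 2 * C0 ^+ 2 * (n%:R * Int B)).
  apply: addr_ge0 => //; apply: mulr_ge0; last exact: mulr_ge0.
  by apply: mulr_ge0 => //; exact: sqr_ge0.
move=> d d0 d1.
have bp : bcs nrm (p d) by exact: bcs_ker.
have bqq i j : bcs nrm (fun z : rV => z ord0 j * coord_ker d i z).
  by do 2 (apply: bcsMl; first exact: lbm_coord).
have eqq i j z : (- z) ord0 j * coord_ker d i (- z) = z ord0 j * coord_ker d i z.
  by rewrite /coord_ker kerN !mxE; ring.
have bFF i j : bcs nrm (fun x => partial i u x * partial j u x).
  by apply: bcsMl => //; exact: bcs_lbm.
set q := d ^+ 2 / 4 * _.
have q0 : 0 < q by rewrite mulr_gt0 ?NP_gt0// divr_gt0 ?exprn_gt0.
(* [K1] is the square of the linear Taylor term times the kernel; [K2], up to a constant and d^2,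
   dominates the square of the remainder times the kernel. *)
pose K1 (s : rV * rV) := \sum_i \sum_j (s.1 - s.2) ord0 j * coord_ker d i (s.1 - s.2) *
  (partial i u s.1 * partial j u s.1).
pose K2 (s : rV * rV) := \sum_i (s.1 - s.2) ord0 i * coord_ker d i (s.1 - s.2) * B s.1.
have bK1' i j : bcs2 (fun s : rV * rV => (s.1 - s.2) ord0 j * coord_ker d i (s.1 - s.2) *
  (partial i u s.1 * partial j u s.1)) by exact: (bcs_sub1 (bqq i j) (bFF i j)).
have bK1'' i : bcs2 (fun s : rV * rV => \sum_j (s.1 - s.2) ord0 j * coord_ker d i (s.1 - s.2) *
  (partial i u s.1 * partial j u s.1)) by apply: bcs_sum => j; exact: bK1'.
have bK2' i : bcs2 (fun s : rV * rV => (s.1 - s.2) ord0 i * coord_ker d i (s.1 - s.2) * B s.1).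
  exact: (bcs_sub1 (bqq i i) bB).
have bK1 : bcs2 K1 by exact: bcs_sum.
have bK2 : bcs2 K2 by exact: bcs_sum.
have EK1 : int2 K1 = q * G2.
  rewrite /int2 (int_sum s2)//.
  transitivity (\sum_(i < n) q * Int (fun x => partial i u x ^+ 2)).
    apply: eq_bigr => i _; rewrite (int_sum s2); last by move=> j; exact: bK1'.
    have H j : Rintegral (lebesgue_rV n \x lebesgue_rV n)%E setT (fun s : rV * rV =>
        (s.1 - s.2) ord0 j * coord_ker d i (s.1 - s.2) * (partial i u s.1 * partial j u s.1)) =
      (i == j)%:R * q * Int (fun x => partial i u x * partial j u x).
      rewrite -[LHS]/(int2 _) (int2_fst (bqq i j) (bFF i j))//.
      by rewrite int_ker_moment2// /q; ring.
    under eq_bigr do rewrite H.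
    rewrite (bigD1 i)//= eqxx mul1r big1 ?addr0 => [|j ji].
      by congr (_ * _); congr Rintegral; apply/funext => x; rewrite expr2.
    by rewrite eq_sym (negbTE ji) !mul0r.
  rewrite -mulr_sumr; congr (_ * _); rewrite -(int_sum sR).
    by congr Rintegral; apply/funext => x; apply: eq_bigr => i _; rewrite mxE.
  by move=> i; apply: bcsX.
have EK2 : int2 K2 = q * (n%:R * Int B).
  rewrite /int2 (int_sum s2)//.
  have H i : Rintegral (lebesgue_rV n \x lebesgue_rV n)%E setT (fun s : rV * rV =>
      (s.1 - s.2) ord0 i * coord_ker d i (s.1 - s.2) * B s.1) = q * Int B.
    rewrite -[LHS]/(int2 _) (int2_fst (bqq i i) bB)//.
    by rewrite int_ker_moment2// eqxx mul1r.
  under eq_bigr do rewrite H.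
  by rewrite sumr_const card_ord -[LHS]mulr_natl; ring.
have bb : bcs2 (fun s => (1 + d) * K1 s + (1 + d^-1) * C0 ^+ 2 * d ^+ 2 * K2 s).
  by apply: bcsD; exact: bcsZ.
apply: (@le_trans _ _ (int2 (fun s => (1 + d) * K1 s + (1 + d^-1) * C0 ^+ 2 * d ^+ 2 * K2 s))).
  apply: (le_int s2); [exact: bcs2_diff|exact: bb|move=> [x y] /=].
  pose z := x - y; pose S := \sum_i z ord0 i * partial i u x.
  have -> : K1 (x, y) = p d z * S ^+ 2.
    rewrite /K1/= expr2 {1}/S mulr_suml mulr_sumr; apply: eq_bigr => i _.
    rewrite /S !mulr_sumr; apply: eq_bigr => j _; rewrite /coord_ker -/z; ring.
  have -> : K2 (x, y) = p d z * sqnorm z * B x.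
    rewrite /K2/= /sqnorm mulr_sumr mulr_suml; apply: eq_bigr => i _.
    by rewrite /coord_ker -/z; ring.
  rewrite -/z.
  have [->|pz] := eqVneq (p d z) 0; first by rewrite !mul0r !mulr0 addr0.
  have zd := ker_support d0 pz.
  have zd' : nrm z <= d.
    rewrite -[leRHS](gtr0_norm d0) -[leLHS]normr_id -ler_sqr ?nnegrE// !real_normK ?num_real//.
    exact: le_trans (nrm_sqr_le z) (ltW zd).
  rewrite [leRHS](_ : _ = p d z * ((1 + d) * S ^+ 2 +
    (1 + d^-1) * C0 ^+ 2 * d ^+ 2 * (sqnorm z * B x))); last by ring.
  rewrite ler_wpM2l ?ker_ge0//.
  have d1' : 0 <= 1 + d^-1 by rewrite addr_ge0// invr_ge0 ltW.
  have [xM|Mx] := leP (nrm x) (M + 1); last first.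
    have My : M < nrm y.
      have : nrm x <= nrm y + nrm z by have := ler_normD y z; rewrite addrC subrK.
      lra.
    rewrite !uM//; last lra.
    rewrite subrr expr0n/= addr_ge0//.
      by rewrite mulr_ge0 ?sqr_ge0// addr_ge0// ltW.
    by do ![exact: B0|exact: sqnorm_ge0|exact: sqr_ge0|apply: mulr_ge0 => //].
  rewrite /B/box indicE mem_set//= mulr1.
  have := C0P x (- z); rewrite {1}/z subKr.
  rewrite (_ : \sum_i _ = - S); last first.
    by rewrite /S -sumrN; apply: eq_bigr => i _; rewrite mxE mulNr.
  rewrite opprK normrN => hr; set r := u y - u x + S in hr.
  have r2 : r ^+ 2 <= C0 ^+ 2 * d ^+ 2 * sqnorm z.
    rewrite -real_normK ?num_real//.
    apply: (@le_trans _ _ ((C0 * `|z| ^+ 2) ^+ 2)).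
      by rewrite lerXn2r ?nnegrE// mulr_ge0 ?sqr_ge0// ltW.
    rewrite exprMn -mulrA ler_pM2l ?exprn_gt0// [X in X <= _]expr2.
    have nz := nrm_sqr_le z.
    by apply: ler_pM; rewrite ?sqr_ge0//; exact: le_trans nz (ltW zd).
  apply: (@le_trans _ _ ((1 + d) * S ^+ 2 + (1 + d^-1) * r ^+ 2)); last first.
    by rewrite lerD2l; have := ler_wpM2l d1' r2; rewrite !mulrA.
  rewrite -subr_ge0 (_ : _ - _ = d * (S + d^-1 * r) ^+ 2).
    by rewrite mulr_ge0 ?sqr_ge0// ltW.
  by rewrite /r; field; rewrite gt_eqF.
rewrite /int2 (intD s2); [|exact: bcsZ..].
rewrite !(intZ s2)//.
move: EK1 EK2; rewrite /int2 => -> ->.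
rewrite [leLHS](_ : _ = q * ((1 + d) * G2 + (d ^+ 2 + d) * (C0 ^+ 2 * (n%:R * Int B)))); last first.
  by field; rewrite gt_eqF.
rewrite ler_pM2l// -/G2.
have dd : d ^+ 2 + d <= 2 * d.
  have : d * d <= d * 1 by rewrite ler_wpM2l// ltW.
  by rewrite -expr2 mulr1; lra.
have X0 : 0 <= C0 ^+ 2 * (n%:R * Int B) by rewrite mulr_ge0 ?sqr_ge0// mulr_ge0.
have := ler_wpM2r X0 dd; lra.
Qed.

End two_sided_estimates.

(** * The form compared with the Dirichlet form *)

Section form_estimates.
Context {R : realType} {n : nat}.
Notation rV := 'rV[R]_n.
Implicit Types (F G f u : rV -> R) (x y z : rV).
Let sR := sized_rV (R := R) n.
Let s2 := sized_prod sR sR.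
Notation p d := (@ker R n d 2).
Notation NP d := (@NP R n d).
Notation Np d := (@Np R n d).
Notation st d := (@step R n d).

Lemma Np_gt0 d : 0 < d -> 0 < Np d.
Proof. by move=> d0; exact: lt_le_trans (@NP_gt0 R n d d0) (le_NP_Np d0). Qed.

(** Write a b = (a^2 + b^2)/2 - (a - b)^2/2 for the two values of [u]. The last part leads to the
    energy of [energy_ctest]. The product of the weights, at most 1 there and bounded below to first
    order in the first part, produces the potential. *)
Lemma form_lower u : ctest u -> exists2 C, 0 <= C & forall d, 0 < d -> d <= 1 ->
  Np d * (Int (fun x => u x ^+ 2) - st d * (dirichlet u + C * d)) <= form d u.
Proof.
move=> cu; have bu := ctest_bcs cu; have lu := bcs_lbm bu.
have [C1 C10 C1P] := energy_ctest cu.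
have bu2 : bcs nrm (fun x => u x ^+ 2) by exact: bcsX.
have bsu : bcs nrm (fun x => sqnorm x * u x ^+ 2) by apply: bcsMl => //; exact: lbm_sqnorm.
set U := Int (fun x => u x ^+ 2); pose W := Int (fun x => sqnorm x * u x ^+ 2).
have U0 : 0 <= U by apply: int_ge0 => x; exact: sqr_ge0.
have W0 : 0 <= W by apply: int_ge0 => x; rewrite mulr_ge0 ?sqr_ge0 ?sqnorm_ge0.
exists (W / 8 + U / 4 + C1); first by rewrite !addr_ge0 ?divr_ge0.
move=> d d0 d1; have Np0 := Np_gt0 d0; have h0 := @step_gt0 R n d d0.
have bp : bcs nrm (p d) by exact: bcs_ker.
have Ecl := C1P d d0 d1; set h := st d in h0 *.
have hE : d ^+ 2 / 4 * NP d = 2 * h * Np d.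
  by rewrite /h /step; field; rewrite gt_eqF.
rewrite hE in Ecl.
have bw := bcs_weighted d bu.
have b1 : bcs2 (fun s : rV * rV => p d (s.1 - s.2) * u s.1 ^+ 2) by exact: (bcs_sub1 bp bu2).
have b2 : bcs2 (fun s : rV * rV => p d (s.1 - s.2) * u s.2 ^+ 2) by exact: (bcs_sub2 bp bu2).
have b3 : bcs2 (fun s : rV * rV => p d (s.1 - s.2) * (sqnorm s.1 * u s.1 ^+ 2)).
  exact: (bcs_sub1 bp bsu).
have b4 : bcs2 (fun s : rV * rV => p d (s.1 - s.2) * (sqnorm s.2 * u s.2 ^+ 2)).
  exact: (bcs_sub2 bp bsu).
have b5 : bcs2 (fun s : rV * rV => p d (s.1 - s.2) * (u s.1 - u s.2) ^+ 2) by exact: (bcs2_diff bp bu).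
have e1 := int2_fst bp bu2 (@kerN _ _ _ _); have e2 := int2_snd bp bu2 (@kerN _ _ _ _).
have e3 := int2_fst bp bsu (@kerN _ _ _ _); have e4 := int2_snd bp bsu (@kerN _ _ _ _).
rewrite -[Int (ker d 2)]/(Np d) -/U -/W in e1 e2 e3 e4.
(* The terms with [d] in these constants pay for exchanging sqnorm x u(y)^2 for sqnorm y u(y)^2. *)
pose a := 2^-1 - h * d / 8; pose b := h * (2 + d) / 16.
have b12 : bcs2 (fun s : rV * rV => a * (p d (s.1 - s.2) * u s.1 ^+ 2 +
    p d (s.1 - s.2) * u s.2 ^+ 2)).
  by apply: bcsZ; exact: bcsD.
have b34 : bcs2 (fun s : rV * rV => b * (p d (s.1 - s.2) * (sqnorm s.1 * u s.1 ^+ 2) +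
   p d (s.1 - s.2) * (sqnorm s.2 * u s.2 ^+ 2))).
  by apply: bcsZ; exact: bcsD.
have b55 : bcs2 (fun s : rV * rV => 2^-1 * (p d (s.1 - s.2) * (u s.1 - u s.2) ^+ 2)).
  exact: bcsZ.
have H : int2 (fun s : rV * rV => a * (p d (s.1 - s.2) * u s.1 ^+ 2 +
    p d (s.1 - s.2) * u s.2 ^+ 2) -
    b * (p d (s.1 - s.2) * (sqnorm s.1 * u s.1 ^+ 2) +
   p d (s.1 - s.2) * (sqnorm s.2 * u s.2 ^+ 2)) -
   2^-1 * (p d (s.1 - s.2) * (u s.1 - u s.2) ^+ 2)) <= form d u.
  rewrite /form -int2_conv//; apply: (le_int s2).
  - by apply: bcsB => //; exact: bcsB.
  - by apply: bcs2_l => //; apply: lbm_snd; exact: bcs_lbm.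
  move=> [x y] /=; have [->|pz] := eqVneq (p d (x - y)) 0.
    by rewrite !mul0r !addr0 !mulr0 !subr0.
  have hx := sqnorm_ker_close d0 d1 pz.
  have pz' : p d (y - x) != 0 by rewrite -kerN opprB.
  have hy := sqnorm_ker_close d0 d1 pz'.
  rewrite [leLHS](_ : _ = p d (x - y) * (a * (u x ^+ 2 + u y ^+ 2) -
    b * (sqnorm x * u x ^+ 2 + sqnorm y * u y ^+ 2) - 2^-1 * (u x - u y) ^+ 2)); last by ring.
  rewrite ler_wpM2l ?ker_ge0// /weighted /gexp -/h.
  set X := expR _; set Y := expR _.
  have -> : X * u x * (Y * u y) = X * Y * ((u x ^+ 2 + u y ^+ 2) / 2 - (u x - u y) ^+ 2 / 2).
    by field.
  have XY1 : X * Y <= 1.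
    rewrite /X /Y -expRD -expR0 ler_expR -mulrDr mulNr oppr_le0.
    by rewrite mulr_ge0 ?addr_ge0 ?sqnorm_ge0// divr_ge0// ltW.
  have XY2 : 1 - h / 8 * (sqnorm x + sqnorm y) <= X * Y.
    by rewrite /X /Y -expRD -mulrDr; apply: le_trans (expR_ge1Dx _); rewrite mulNr.
  have S0 : 0 <= u x ^+ 2 + u y ^+ 2 by rewrite addr_ge0 ?sqr_ge0.
  have D0 : 0 <= (u x - u y) ^+ 2 by exact: sqr_ge0.
  have k1 := ler_wpM2r S0 XY2; have k2 := ler_wpM2r D0 XY1.
  have ux : 0 <= h * u x ^+ 2 by rewrite mulr_ge0 ?sqr_ge0// ltW.
  have uy : 0 <= h * u y ^+ 2 by rewrite mulr_ge0 ?sqr_ge0// ltW.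
  have k3 := ler_wpM2r uy hx; have k4 := ler_wpM2r ux hy.
  rewrite /a /b; set A := u x ^+ 2 in k1 k2 k3 k4 *; set B := u y ^+ 2 in k1 k2 k3 k4 *.
  set D := (u x - u y) ^+ 2 in k2 *; set XY := X * Y in k1 k2 *.
  lra.
apply: le_trans H; rewrite /int2 (intB s2)//; last exact: bcsB.
rewrite (intB s2)// !(intZ s2)//; [|exact: bcsD|exact: bcsD].
rewrite !(intD s2)//.
move: e1 e2 e3 e4; rewrite /int2 => -> -> -> ->.
rewrite -[X in 2^-1 * X]/(energy (p d) u) /dirichlet -/W /a /b.
set Gr := Int (fun x => sqnorm _) in Ecl *.
have Nh : 0 < h * Np d by rewrite mulr_gt0.
by move: Ecl; lra.
Qed.

Lemma form_le_sqr d f : 0 < d -> bcs nrm f ->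
  form d f <= Np d * Int (fun x => weighted d f x ^+ 2).
Proof.
move=> d0 bf; have bF := bcs_weighted d bf.
have := energy_ge0 (weighted d f) (@ker_ge0 R n d 2).
rewrite energyE//; [|exact: bcs_ker|exact: kerN].
by rewrite pmulr_rge0// subr_ge0.
Qed.

(** Near-converse of [form_lower] without regularity of [f]: the constant depends only on a bound
    for the support and one for the rate, so it can be fixed before [d] and [f]. The second
    conclusion prevents the mollification from losing mass, without which the first would say
    nothing about a quotient. *)
Lemma form_upper (Vm L : R) : 0 <= Vm -> 0 <= L ->
  exists2 C, 0 <= C & forall d f (Lam : R), 0 < d -> d <= 1 -> bcs nrm f ->
  (forall x, f x != 0 -> sqnorm x <= Vm) -> 0 <= Lam <= L ->
  Np d * (1 - st d * Lam) * Int (fun x => f x ^+ 2) <= form d f ->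
  dirichlet (smoothing d (weighted d f)) <= (Lam + C * d) * Int (fun x => f x ^+ 2) /\
  (1 - C * d) * Int (fun x => f x ^+ 2) <=
    (1 + d) * Int (fun x => smoothing d (weighted d f) x ^+ 2).
Proof.
move=> V0 L0; pose C1 := Vm ^+ 2 / 16 + Vm / 4 + 2^-1; pose C2 := L + 2 * (2 + n%:R) * L.
have C10 : 0 <= C1 by rewrite !addr_ge0 ?divr_ge0 ?sqr_ge0.
have C20 : 0 <= C2 by rewrite addr_ge0// mulr_ge0// mulr_ge0// addr_ge0.
exists (C1 + C2); first exact: addr_ge0.
move=> d f Lam d0 d1 bf fV /andP[Lam0 LamL] Hf.
have Np0 := Np_gt0 d0; have h0 := @step_gt0 R n d d0.
have [hd2 hd] := @step_le R n d d0 d1; set h := st d in h0 hd hd2 Hf *.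
have bF := bcs_weighted d bf; have lf := bcs_lbm bf.
have bf2 : bcs nrm (fun x => f x ^+ 2) by exact: bcsX.
have bF2 : bcs nrm (fun x => weighted d f x ^+ 2) by exact: bcsX.
have bsf : bcs nrm (fun x => sqnorm x * f x ^+ 2) by apply: bcsMl => //; exact: lbm_sqnorm.
have bsF : bcs nrm (fun x => sqnorm x * weighted d f x ^+ 2).
  by apply: bcsMl => //; exact: lbm_sqnorm.
have cS := ctest_smoothing d0 bF.
have bS := ctest_bcs cS.
have FE x : weighted d f x ^+ 2 = expR (- (h / 4 * sqnorm x)) * f x ^+ 2.
  rewrite /weighted exprMn; congr (_ * _).
  by rewrite /gexp -/h expr2 -expRD; congr expR; field.
have Ff x : weighted d f x ^+ 2 <= f x ^+ 2.
  rewrite FE ler_piMl ?sqr_ge0// -expR0 ler_expR oppr_le0.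
  by rewrite mulr_ge0 ?sqnorm_ge0// divr_ge0// ltW.
set S := Int (fun x => f x ^+ 2) in Hf *.
have S0 : 0 <= S by apply: int_ge0 => x; exact: sqr_ge0.
pose T := Int (fun x => weighted d f x ^+ 2).
pose W := Int (fun x => sqnorm x * f x ^+ 2).
have TS : T <= S by apply: (le_int sR).
have W0 : 0 <= W by apply: int_ge0 => x; rewrite mulr_ge0 ?sqr_ge0 ?sqnorm_ge0.
have WS : W <= Vm * S.
  rewrite -(intZ sR)//; apply: (le_int sR) => //.
    exact: bcsZ.
  move=> x; have [->|/fV fx] := eqVneq (f x) 0; first by rewrite expr0n/= !mulr0.
  by rewrite ler_wpM2r ?sqr_ge0.
have WF : Int (fun x => sqnorm x * weighted d f x ^+ 2) <= W.
  by apply: (le_int sR) => // x; rewrite ler_wpM2l ?sqnorm_ge0.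
(* The weight lowers the mass of [f] by h/4 times its potential term, up to second order in h; this
   is how the potential is recovered. *)
have TW : T <= S - h / 4 * W + h ^+ 2 * Vm ^+ 2 / 16 * S.
  rewrite /T /S /W -!(intZ sR)// -(intB sR)//; last exact: bcsZ.
  have b1 : bcs nrm (fun x => h / 4 * (sqnorm x * f x ^+ 2)) by exact: bcsZ.
  have b2 : bcs nrm (fun x => h ^+ 2 * Vm ^+ 2 / 16 * f x ^+ 2).
    exact: bcsZ.
  rewrite -(intD sR)//; last exact: bcsB.
  apply: (le_int sR) => //; first by apply: bcsD => //; exact: bcsB.
  move=> x; have [f0|/fV fx] := eqVneq (f x) 0.
    by rewrite FE f0 expr0n/= !mulr0 subrr addr0.
  rewrite FE; set q := h / 4 * sqnorm x.
  have q0 : 0 <= q by rewrite mulr_ge0 ?sqnorm_ge0// divr_ge0// ltW.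
  have qV : q ^+ 2 <= h ^+ 2 * Vm ^+ 2 / 16.
    rewrite (_ : h ^+ 2 * Vm ^+ 2 / 16 = (h / 4 * Vm) ^+ 2); last by field.
    rewrite lerXn2r ?nnegrE//; first by rewrite mulr_ge0// divr_ge0// ltW.
    by rewrite ler_pM2l// divr_gt0.
  (* Because (1 + q) (1 - q + q^2) = 1 + q^3 >= 1 and 1 + q <= exp q. *)
  have eq : expR (- q) <= 1 - q + q ^+ 2.
    rewrite expRN -ler_pV2 ?invrK ?inE ?unitfE ?gt_eqF ?invr_gt0 ?expR_gt0//=; last 2 first.
    - by have := sqr_ge0 (q - 2^-1); lra.
    - by have := sqr_ge0 (q - 2^-1); lra.
    rewrite -[leLHS]mul1r ler_pdivrMr; last by have := sqr_ge0 (q - 2^-1); lra.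
    apply: (@le_trans _ _ ((1 + q) * (1 - q + q ^+ 2))).
      rewrite (_ : _ * _ = 1 + q ^+ 3); last by ring.
      by rewrite lerDl exprn_ge0.
    rewrite ler_wpM2r ?expR_ge1Dx//; have := sqr_ge0 (q - 2^-1); lra.
  have := ler_wpM2r (sqr_ge0 (f x)) eq; have := ler_wpM2r (sqr_ge0 (f x)) qV.
  rewrite /q; lra.
have hT : (1 - h * Lam) * S <= T.
  have := le_trans Hf (form_le_sqr d0 bf).
  by rewrite -mulrA ler_pM2l.
have en := smoothing_energy d0 bF; have cl := smoothing_close d0 bF.
have po := smoothing_potential d0 bF d1.
rewrite -/(form d f) -/T in en cl po.
rewrite -/h in en cl po.
have hE : d ^+ 2 / 4 * NP d = 2 * h * Np d.
  by rewrite /h /step; field; rewrite gt_eqF.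
rewrite hE in en.
set Gr := Int (fun x => sqnorm _) in en.
have G1 : h * Gr <= T - (1 - h * Lam) * S.
  rewrite -(ler_pM2l Np0); move: en Hf; lra.
(* Gradient and potential come out with the same factor h, which is divided out. *)
have G2 : Gr + W / 4 <= (Lam + h * Vm ^+ 2 / 16) * S.
  rewrite -(ler_pM2l h0); move: G1 TW; rewrite expr2; lra.
have hVS : h * (Vm ^+ 2 / 16 * S) <= d * (Vm ^+ 2 / 16 * S).
  by rewrite ler_wpM2r// mulr_ge0// divr_ge0// sqr_ge0.
have dWS : d * W <= d * (Vm * S) by rewrite ler_wpM2l// ltW.
have dTS : d * T <= d * S by rewrite ler_wpM2l// ltW.
have d1' : 0 <= 1 + d by rewrite addr_ge0// ltW.
have dWF := ler_wpM2l d1' WF.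
have C2dS : 0 <= C2 * d * S by rewrite !mulr_ge0// ltW.
have C1dS : 0 <= C1 * d * S by rewrite !mulr_ge0// ltW.
split.
  rewrite /dirichlet -/Gr mulrDl mulrDl.
  apply: (@le_trans _ _ (Lam * S + C1 * d * S)); last lra.
  by move: po; rewrite /C1; lra.
have bFS : bcs nrm (fun x => (weighted d f x - smoothing d (weighted d f) x) ^+ 2).
  by apply: bcsX; exact: bcsB.
have bS2 : bcs nrm (fun x => smoothing d (weighted d f) x ^+ 2) by exact: bcsX.
set Z := Int (fun x => (_ - _) ^+ 2) in cl.
have ZS : Z <= (2 + n%:R) * (d ^+ 2 * L * S).
  apply: (le_trans cl); rewrite (_ : 2 * (1 + n%:R / 2) = 2 + n%:R); last by field.
  rewrite ler_wpM2l ?addr_ge0//.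
  apply: (@le_trans _ _ (S - (1 - h * Lam) * S)).
    apply: lerB => //; rewrite ler_pdivlMr//; by apply: le_trans Hf; rewrite [leLHS]mulrC mulrA.
  rewrite (_ : _ - _ = h * Lam * S); last by ring.
  by rewrite ler_wpM2r// ler_pM// ltW.
have TZ : T <= (1 + d) * Int (fun x => smoothing d (weighted d f) x ^+ 2) + (1 + d^-1) * Z.
  rewrite -!(intZ sR)// -(intD sR); [|exact: bcsZ..].
  apply: (le_int sR) => //.
    by apply: bcsD; exact: bcsZ.
  move=> x; set A := weighted d f x; set B := smoothing d _ x.
  rewrite -subr_ge0 (_ : _ - _ = d * (B - d^-1 * (A - B)) ^+ 2).
    by rewrite mulr_ge0 ?sqr_ge0// ltW.
  by field; rewrite gt_eqF.
have dZ : (1 + d^-1) * Z <= 2 * d * ((2 + n%:R) * L * S).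
  apply: (@le_trans _ _ ((1 + d^-1) * ((2 + n%:R) * (d ^+ 2 * L * S)))).
    by rewrite ler_wpM2l// addr_ge0// invr_ge0 ltW.
  rewrite [leLHS](_ : _ = (d ^+ 2 + d) * ((2 + n%:R) * L * S)); last first.
    by field; rewrite gt_eqF.
  rewrite ler_wpM2r//; first by rewrite !mulr_ge0// addr_ge0.
  have : d * d <= d * 1 by rewrite ler_wpM2l// ltW.
  by rewrite -expr2 mulr1; lra.
have hLS : h * Lam * S <= d * L * S by rewrite ler_wpM2r// ler_pM// ltW.
move: hT TZ dZ hLS; rewrite mulrDl /C2.
set X := Int _; lra.
Qed.

End form_estimates.

(** * Log-concave iteration *)

(** Bernoulli's inequality: q^k >= 1 + k (q - 1). *)
Lemma expr_unbounded (R : realType) (q C m : R) : 1 < q -> 0 < C -> exists k, m < C * q ^+ k.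
Proof.
move=> q1 C0; have B k : 1 + k%:R * (q - 1) <= q ^+ k.
  elim: k => [|k IH]; first by rewrite mul0r addr0 expr0.
  rewrite exprS -natr1; apply: (@le_trans _ _ (q * (1 + k%:R * (q - 1)))); last first.
    by rewrite ler_pM2l//; exact: lt_trans q1.
  rewrite -subr_ge0 (_ : _ - _ = k%:R * (q - 1) ^+ 2); last by ring.
  by rewrite mulr_ge0// sqr_ge0.
have q0 : 0 < q - 1 by rewrite subr_gt0.
exists (Num.truncn (m / C / (q - 1))).+1; set k := _.+1.
have := truncnS_gt (m / C / (q - 1)); rewrite -/k !ltr_pdivrMr// mulrC => h.
by apply: (lt_le_trans h); rewrite ler_pM2l//; apply: le_trans (B k); rewrite lerDr.
Qed.

(** * Growth rates of the operator cut off to one set *)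

Section symmetric_operator.
Context {R : realType} {n : nat}.
Notation rV := 'rV[R]_n.
Implicit Types (F G f g u : rV -> R) (x y z : rV) (K : set rV).
Let sR := sized_rV (R := R) n.
Let s2 := sized_prod sR sR.
Variable d : R.
Hypothesis d0 : 0 < d.
Notation p := (@ker R n d 2).
Let bp : bcs nrm p. Proof. exact: bcs_ker. Qed.

Lemma convD F G x : bcs nrm F -> bcs nrm G ->
  conv p (fun y => F y + G y) x = conv p F x + conv p G x.
Proof.
move=> bF bG; have lF := bcs_lbm bF; have lG := bcs_lbm bG.
rewrite /conv -(intD sR); [|exact: bcs_conv_integrand..].
by congr Rintegral; apply/funext => y; rewrite mulrDr.
Qed.

Lemma convZ a F x : bcs nrm F -> conv p (fun y => a * F y) x = a * conv p F x.
Proof.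
move=> bF; have lF := bcs_lbm bF.
rewrite /conv -(intZ sR); last exact: bcs_conv_integrand.
by congr Rintegral; apply/funext => y; ring.
Qed.

Lemma conv_quadratic a F G : bcs nrm F -> bcs nrm G ->
  Int (fun x => (F x + a * G x) * conv p (fun y => F y + a * G y) x) =
  Int (fun x => F x * conv p F x) + 2 * a * Int (fun x => F x * conv p G x) +
  a ^+ 2 * Int (fun x => G x * conv p G x).
Proof.
move=> bF bG.
have baG : bcs nrm (fun x => a * G x) by exact: bcsZ.
have bc F' G' : bcs nrm F' -> bcs nrm G' -> bcs nrm (fun x => F' x * conv p G' x).
  by move=> b1 b2; apply: bcsMr => //; apply: bcs_lbm; exact: bcs_conv.
have bca F' G' s : bcs nrm F' -> bcs nrm G' -> bcs nrm (fun x => s * (F' x * conv p G' x)).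
  by move=> b1 b2; apply: bcsZ; exact: bc.
rewrite (_ : (fun x => _) = fun x => F x * conv p F x + a * (F x * conv p G x) +
  a * (G x * conv p F x) + a ^+ 2 * (G x * conv p G x)); last first.
  by apply/funext => x; rewrite convD// convZ//; ring.
rewrite (intD sR); [|by do ?[apply: bcsD]; do ?[exact: bca|exact: bc]|exact: bca].
rewrite (intD sR); [|by do ?[apply: bcsD]; do ?[exact: bca|exact: bc]|exact: bca].
rewrite (intD sR); [|exact: bc|exact: bca].
rewrite !(intZ sR); [|exact: bc..].
have e := conv_sym bp bG bF (@kerN _ _ _ _).
set B := Int (fun x => G x * conv p F x) in e *.
set A := Int (fun x => F x * conv p F x).
set C := Int (fun x => F x * conv p G x) in e *.
rewrite e.
set D := Int (fun x => G x * conv p G x).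
move: A B C D {e} => A _ C D.
ring.
Qed.

Lemma formD a f g : bcs nrm f -> bcs nrm g ->
  form d (fun x => f x + a * g x) = form d f +
  2 * a * Int (fun x => weighted d f x * conv p (weighted d g) x) + a ^+ 2 * form d g.
Proof.
move=> bf bg; have bF := bcs_weighted d bf; have bG := bcs_weighted d bg.
rewrite /form (_ : weighted d (fun x => f x + a * g x) =
  fun x => weighted d f x + a * weighted d g x); last first.
  by apply/funext => x; rewrite /weighted; ring.
exact: conv_quadratic.
Qed.

Lemma form_norm f : bcs nrm f -> `|form d f| <= form d (fun x => `|f x|).
Proof.
move=> bf; have bF := bcs_weighted d bf.
have bF' := bcs_weighted d (bcs_norm bf).
have b1 : bcs2 (fun s : rV * rV => p (s.1 - s.2) * (weighted d f s.1 * weighted d f s.2)).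
  by apply: bcs2_l => //; apply: lbm_snd; exact: bcs_lbm.
rewrite /form -!int2_conv//; apply: (le_trans (int_norm s2 b1)).
apply: (le_int s2); first exact: bcs_norm.
  by apply: bcs2_l => //; apply: lbm_snd; exact: bcs_lbm.
move=> [x y]/=; rewrite /weighted !normrM ger0_norm ?ker_ge0//.
by rewrite !(ger0_norm (expR_ge0 _)).
Qed.

Variables (K : set rV) (M : R).
Hypotheses (mK : measurable K) (KM : forall x, K x -> nrm x <= M).
Notation oneK := (\1_K : rV -> R).

Let b1K : bcs nrm oneK. Proof. exact: bcs_indic mK KM. Qed.
Let l1K : lbm nrm oneK. Proof. exact: bcs_lbm. Qed.

Definition restr f : rV -> R := fun x => oneK x * f x.

(** Cutting off on both sides keeps the operator symmetric, and its nonnegative kernel keeps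
    nonnegative functions nonnegative; growth rates need both. *)
Definition oper f : rV -> R := restr (weighted d (conv p (weighted d (restr f)))).

Lemma bcs_restr f : bcs nrm f -> bcs nrm (restr f).
Proof. by move=> bf; apply: bcsMl. Qed.

Lemma bcs_oper f : bcs nrm f -> bcs nrm (oper f).
Proof.
by move=> bf; apply/bcs_restr/bcs_weighted/bcs_conv => //; apply/bcs_weighted/bcs_restr.
Qed.

Lemma bcs_iter_oper k f : bcs nrm f -> bcs nrm (iter k oper f).
Proof. by move=> bf; elim: k => //= k; exact: bcs_oper. Qed.

Lemma operE f g : bcs nrm f -> bcs nrm g -> Int (fun x => f x * oper g x) =
  Int (fun x => weighted d (restr f) x * conv p (weighted d (restr g)) x).
Proof.
by move=> bf bg; congr Rintegral; apply/funext => x; rewrite /oper /restr /weighted; ring.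
Qed.

Lemma oper_sym f g : bcs nrm f -> bcs nrm g ->
  Int (fun x => f x * oper g x) = Int (fun x => g x * oper f x).
Proof.
move=> bf bg; rewrite (operE bf bg) (operE bg bf); apply: conv_sym => //; last exact: kerN.
- by apply/bcs_weighted/bcs_restr.
- by apply/bcs_weighted/bcs_restr.
Qed.

Lemma iter_oper_sym i j f g : bcs nrm f -> bcs nrm g ->
  Int (fun x => f x * iter (i + j) oper g x) =
  Int (fun x => iter i oper f x * iter j oper g x).
Proof.
move=> bf bg; elim: i j => [//|i IH] j.
rewrite addSnnS IH iterS oper_sym; last 2 first.
- exact: bcs_iter_oper.
- exact: bcs_iter_oper.
by congr Rintegral; apply/funext => x; rewrite mulrC.
Qed.

Lemma restr_id f : (forall x, ~ K x -> f x = 0) -> restr f = f.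
Proof.
move=> fK; apply/funext => x; rewrite /restr indicE.
case: (boolP (x \in K)) => [_|]; first by rewrite mul1r.
by rewrite notin_setE mul0r => /fK ->.
Qed.

Lemma ge0_oper f : (forall x, 0 <= f x) -> forall x, 0 <= oper f x.
Proof.
move=> f0 x; rewrite /oper /restr /weighted indicE mulr_ge0// mulr_ge0 ?expR_ge0//.
apply: int_ge0 => y; rewrite !mulr_ge0 ?ker_ge0 ?expR_ge0//.
Qed.

Lemma ge0_iter_oper k f : (forall x, 0 <= f x) -> forall x, 0 <= iter k oper f x.
Proof. by move=> f0; elim: k => //= k; exact: ge0_oper. Qed.

(* The moments of the symmetric operator are log-convex, so the growth from 0 to 1
   persists. *)
Lemma oper_growth u C a : bcs nrm u -> (forall x, ~ K x -> u x = 0) ->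
  0 < C -> (forall x, `|u x| <= C) -> 0 < a -> 0 < Int (fun x => u x ^+ 2) ->
  a * Int (fun x => u x ^+ 2) <= form d u ->
  forall k, Int (fun x => u x ^+ 2) * (a ^+ 2) ^+ k <=
    C ^+ 2 * Int (iter k.*2 oper oneK).
Proof.
move=> bu uK C0 uC a0 u20 au k.
pose U x := `|u x|; have bU : bcs nrm U by exact: bcs_norm.
have U0 x : 0 <= U x by exact: normr_ge0.
have UK : restr U = U by apply: restr_id => x /uK; rewrite /U => ->; rewrite normr0.
(* Moments at |u|, whose form is at least that of [u] because the kernel is nonnegative. *)
pose c j := Int (fun x => U x * iter j oper U x).
have c0E : c 0%N = Int (fun x => u x ^+ 2).
  by congr Rintegral; apply/funext => x; rewrite /= -expr2 real_normK ?num_real.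
have c1 : a * c 0%N <= c 1%N.
  rewrite c0E; apply: (le_trans au); apply: (le_trans (ler_norm _)).
  apply: (le_trans (form_norm bu)); rewrite -/U.
  have -> : c 1%N = form d U by rewrite /c /= (operE bU bU) UK.
  exact: lexx.
(* Cauchy-Schwarz bounds a moment by even ones only. The operator is not known to be positive
   semidefinite, so the growth is followed in steps of two. *)
have cs i j : c (i + j)%N ^+ 2 <= c (i + i)%N * c (j + j)%N.
  rewrite /c !iter_oper_sym//; have bi := bcs_iter_oper i bU; have bj := bcs_iter_oper j bU.
  exact: int_cauchy_schwarz.
have cE j : c j = Int (fun x => U x * iter j oper U x) by [].
clearbody c.
have key j : 0 < c j.*2 /\ a ^+ 2 * c j.*2 <= c j.+1.*2.
  elim: j => [|j [IH1 IH2]].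
    split; first by rewrite c0E.
    have := cs 0%N 1%N; rewrite add0n addn0 => h.
    have c00 : 0 < c 0%N by rewrite c0E.
    rewrite -(ler_pM2l c00); apply: le_trans h.
    rewrite mulrCA -expr2 -exprMn lerXn2r ?nnegrE//; first by rewrite mulr_ge0// ltW.
    by apply: le_trans c1; rewrite mulr_ge0// ltW.
  have c' : 0 < c j.+1.*2 by apply: lt_le_trans IH2; rewrite mulr_gt0// exprn_gt0.
  split => //; have := cs j j.+2.
  rewrite (_ : (j + j.+2 = j.+1.*2)%N); last by rewrite -addnn !addnS addSn.
  rewrite !addnn => h; rewrite -(ler_pM2l IH1); apply: le_trans h.
  by rewrite mulrCA mulrA expr2 ler_wpM2r// ltW.
have grow : c 0%N * (a ^+ 2) ^+ k <= c k.*2.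
  elim: k => [|k IH]; first by rewrite mulr1.
  apply: le_trans (key k).2; rewrite exprS mulrCA ler_wpM2l//; exact/exprn_ge0/ltW.
rewrite -c0E; apply: (le_trans grow).
have bit j : bcs nrm (iter j oper oneK) by exact: bcs_iter_oper.
have bitU j : bcs nrm (iter j oper U) by exact: bcs_iter_oper.
(* |u| <= C 1_K replaces one of the two factors |u| at a time, and symmetry moves the iterate to the
   other side in between. The starting function then no longer depends on [u]. *)
have onel f : bcs nrm f -> (forall x, 0 <= f x) ->
    Int (fun x => U x * f x) <= C * Int (fun x => oneK x * f x).
  move=> bf f0; have lf := bcs_lbm bf; rewrite -(intZ sR); last exact: bcsMr.
  apply: (le_int sR); first exact: bcsMr.
    by apply: bcsZ; exact: bcsMr.
  move=> x; rewrite mulrA ler_wpM2r//.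
  rewrite indicE; case: (boolP (x \in K)) => [_|]; first by rewrite mulr1; exact: uC.
  by rewrite notin_setE => /uK; rewrite /U => ->; rewrite normr0 mulr0.
have b1j j f : bcs nrm f -> bcs nrm (fun x => oneK x * iter j oper f x).
  by move=> bf; apply: bcsMl => //; exact: bcs_iter_oper.
rewrite cE expr2 -mulrA; apply: (le_trans (onel _ (bitU _) (ge0_iter_oper _ U0))).
rewrite ler_pM2l//.
rewrite (_ : Int (fun x => oneK x * _) = Int (fun x => U x * iter k.*2 oper oneK x)).
  have one0 x : 0 <= oneK x by rewrite indicE.
  apply: (le_trans (onel _ (bit _) (ge0_iter_oper _ one0))).
  rewrite ler_pM2l//; apply: (le_int sR); [exact: b1j|exact: bit|move=> x].
  by rewrite ler_piMl ?ge0_iter_oper// indicE lern1 leq_b1.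
have := @iter_oper_sym k.*2 0 _ _ b1K bU; rewrite addn0 => ->.
by congr Rintegral; apply/funext => x; rewrite mulrC.
Qed.

(** A bound on the form of a symmetric operator A bounds its norm by polarization at A g + b g and A
    g - b g. The form is also bounded below, because |form f| <= form |f|. The integral of the
    iterate of order 2 k is the squared norm of A^k 1_K. *)
Lemma oper_bounded b : 0 < b ->
  (forall f, bcs nrm f -> form d (restr f) <= b * Int (fun x => f x ^+ 2)) ->
  forall k, Int (iter k.*2 oper oneK) <= (b ^+ 2) ^+ k * Int (fun x => oneK x ^+ 2).
Proof.
move=> b0 Hb.
have Hb' f : bcs nrm f -> - (b * Int (fun x => f x ^+ 2)) <= form d (restr f).
  move=> bf; rewrite lerNl; apply: (@le_trans _ _ `|form d (restr f)|).
    by rewrite -normrN ler_norm.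
  apply: (le_trans (form_norm (bcs_restr bf))).
  have := Hb _ (bcs_norm bf).
  rewrite (_ : restr (fun x => `|f x|) = fun x => `|restr f x|); last first.
    by apply/funext => x; rewrite /restr normrM indicE (ger0_norm (ler0n _ _)).
  congr (_ <= _ * _); congr Rintegral; apply/funext => x.
  by rewrite real_normK ?num_real.
have sq g : bcs nrm g -> Int (fun x => oper g x ^+ 2) <= b ^+ 2 * Int (fun x => g x ^+ 2).
  move=> bg; have bog := bcs_oper bg.
  have plus a : Int (fun x => (oper g x + a * g x) ^+ 2) = Int (fun x => oper g x ^+ 2)
      + 2 * a * Int (fun x => oper g x * g x) + a ^+ 2 * Int (fun x => g x ^+ 2).
    have B1 : bcs nrm (fun x => oper g x ^+ 2) by exact: bcsX.
    have B2 : bcs nrm (fun x => g x ^+ 2) by exact: bcsX.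
    have B3 : bcs nrm (fun x => oper g x * g x) by apply: bcsMl => //; exact: bcs_lbm.
    have B4 : bcs nrm (fun x => a ^+ 2 * g x ^+ 2) by exact: bcsZ.
    have B5 : bcs nrm (fun x => 2 * a * (oper g x * g x)).
      exact: bcsZ.
    rewrite -!(intZ sR)// -!(intD sR)//; last exact: bcsD.
    by congr Rintegral; apply/funext => x; ring.
  have formp a : form d (restr (fun x => oper g x + a * g x)) = form d (restr (oper g)) +
      2 * a * Int (fun x => oper g x ^+ 2) + a ^+ 2 * form d (restr g).
    rewrite (_ : restr (fun x => _) = fun x => restr (oper g) x + a * restr g x); last first.
      by apply/funext => x; rewrite /restr; ring.
    rewrite formD; [|exact: bcs_restr|exact: bcs_restr].
    by rewrite -operE//; congr (_ + _ * _ + _).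
  have bpl a : bcs nrm (fun x => oper g x + a * g x).
    by apply: bcsD => //; exact: bcsZ.
  (* Subtracting the two bounds gives 4 b |A g|^2 <= 2 b |A g|^2 + 2 b^3 |g|^2. *)
  have h1 := Hb _ (bpl b); have h2 := Hb' _ (bpl (- b)).
  move: h1 h2; rewrite !formp !plus sqrrN.
  set X := Int (fun x => oper g x ^+ 2); set Y := Int (fun x => g x ^+ 2).
  set Z := Int (fun x => _ * _) => h1 h2.
  set P := form d (restr (oper g)) in h1 h2; set Q := form d (restr g) in h1 h2.
  move: P Q X Y Z h1 h2 => P Q X Y Z h1 h2.
  rewrite -(ler_pM2l b0); move: h1 h2; rewrite expr2; lra.
move=> k.
have E : Int (iter k.*2 oper oneK) = Int (fun x => iter k oper oneK x ^+ 2).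
  have -> : iter k.*2 oper oneK = fun x => oneK x * iter k.*2 oper oneK x.
    apply/funext => x; rewrite indicE; case: (boolP (x \in K)) => [_|/negbTE xK].
      by rewrite mul1r.
    rewrite mul0r; case: k => [|k]; first by rewrite /= indicE xK.
    by rewrite doubleS iterS /oper [LHS]/restr indicE xK mul0r.
  rewrite -addnn (iter_oper_sym k k b1K b1K).
  by congr Rintegral; apply/funext => x; rewrite expr2.
rewrite E; elim: k {E} => [|k IH]; first by rewrite mul1r.
apply: (le_trans (sq _ (bcs_iter_oper k b1K))).
by rewrite [X in _ <= X * _]exprS -mulrA ler_pM2l// exprn_gt0.
Qed.

End symmetric_operator.

Lemma powR_expn (R : realType) (a s : R) (m : nat) : 0 <= a ->
  (a `^ s) ^+ m = (a ^+ m) `^ s.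
Proof. by move=> a0; rewrite -powR_mulrn ?powR_ge0// powRAC powR_mulrn. Qed.

(** * Comparison of the growth rates on three sets *)

Section log_concave_iteration.
Context {R : realType} {n : nat}.
Notation rV := 'rV[R]_n.
Implicit Types (F G f g u : rV -> R) (x y z : rV) (K : set rV).
Let sR := sized_rV (R := R) n.
Variable d : R.
Hypothesis d0 : 0 < d.
Notation p := (@ker R n d 2).
Variable t : R.
Hypothesis t01 : 0 < t < 1.

Lemma powR_le_mul (a0 a1 a b0 b1 b : R) : 0 <= a0 -> 0 <= a1 -> 0 <= b0 -> 0 <= b1 ->
  a0 `^ (1 - t) * a1 `^ t <= a -> b0 `^ (1 - t) * b1 `^ t <= b ->
  (a0 * b0) `^ (1 - t) * (a1 * b1) `^ t <= a * b.
Proof.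
by move=> ? ? ? ? h1 h2; rewrite !powRM// mulrACA ler_pM// mulr_ge0 ?powR_ge0.
Qed.

Lemma gexp_logconcave (a : R) x y : 0 <= a ->
  gexp (- a) x `^ (1 - t) * gexp (- a) y `^ t <= gexp (- a) ((1 - t) *: x + t *: y).
Proof.
move=> a0; have /andP[t0 t1] := t01.
rewrite /gexp /powR !gt_eqF ?expR_gt0// !expRK -expRD ler_expR.
have := ler_wpM2l a0 (@sqnorm_convex R n t x y _); rewrite (ltW t0) (ltW t1) => /(_ isT).
lra.
Qed.

Lemma indic_logconcave (K0 K1 Kt : set rV) x y :
  (forall x y, K0 x -> K1 y -> Kt ((1 - t) *: x + t *: y)) ->
  (\1_K0 x : R) `^ (1 - t) * (\1_K1 y : R) `^ t <= \1_Kt ((1 - t) *: x + t *: y).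
Proof.
move=> KK; have /andP[t0 t1] := t01.
rewrite !indicE; case: (boolP (x \in K0)) => [/set_mem x0|_]; last first.
  by rewrite powR0 ?mul0r ?ler0n// subr_eq0 gt_eqF.
case: (boolP (y \in K1)) => [/set_mem y1|_]; last first.
  by rewrite [X in _ * X]powR0 ?mulr0 ?ler0n// gt_eqF.
by rewrite mem_set ?powR1 ?mulr1//; exact: KK.
Qed.

Variables (K0 K1 Kt : set rV) (M : R).
Hypotheses (mK0 : measurable K0) (mK1 : measurable K1) (mKt : measurable Kt).
Hypotheses (K0M : forall x, K0 x -> nrm x <= M) (K1M : forall x, K1 x -> nrm x <= M)
  (KtM : forall x, Kt x -> nrm x <= M).
Hypothesis KK : forall x y, K0 x -> K1 y -> Kt ((1 - t) *: x + t *: y).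

(** Kernel, weights and indicators each satisfy the same kind of inequality, hence so do their
    products; Prekopa-Leindler carries it through the convolution integral. *)
Lemma oper_logconcave f0 f1 ft : bcs nrm f0 -> bcs nrm f1 -> bcs nrm ft ->
  (forall x, 0 <= f0 x) -> (forall x, 0 <= f1 x) -> (forall x, 0 <= ft x) ->
  (forall x y, f0 x `^ (1 - t) * f1 y `^ t <= ft ((1 - t) *: x + t *: y)) ->
  forall x y, oper d K0 f0 x `^ (1 - t) * oper d K1 f1 y `^ t <=
    oper d Kt ft ((1 - t) *: x + t *: y).
Proof.
move=> b0 b1 bt p0 p1 pt H x y.
have h0 := step_gt0 (n := n) d0; have bp : bcs nrm p by exact: bcs_ker.
have h8 : 0 <= @step R n d / 8 by rewrite divr_ge0// ltW.
have bi0 : bcs nrm (weighted d (restr K0 f0)) by exact/bcs_weighted/(bcs_restr mK0 K0M).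
have bi1 : bcs nrm (weighted d (restr K1 f1)) by exact/bcs_weighted/(bcs_restr mK1 K1M).
have bit : bcs nrm (weighted d (restr Kt ft)) by exact/bcs_weighted/(bcs_restr mKt KtM).
have wr0 K f z : (forall z, 0 <= f z) -> 0 <= weighted d (restr K f) z.
  by move=> f0'; rewrite /weighted/restr indicE !mulr_ge0// expR_ge0.
have cv0 K f z : (forall z, 0 <= f z) -> 0 <= conv p (weighted d (restr K f)) z.
  by move=> f0'; apply: int_ge0 => a; rewrite mulr_ge0 ?ker_ge0 ?wr0.
rewrite /oper /restr /(weighted d (conv _ _)).
apply: powR_le_mul; rewrite ?indicE ?ler0n//.
- by rewrite mulr_ge0 ?expR_ge0 ?cv0.
- by rewrite mulr_ge0 ?expR_ge0 ?cv0.
- by rewrite -!indicE; exact: indic_logconcave.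
apply: powR_le_mul; rewrite ?expR_ge0 ?cv0//; first exact: gexp_logconcave.
apply: prekopa_leindler => //.
- exact: (bcs_conv_integrand x bp (bcs_lbm bi0)).
- exact: (bcs_conv_integrand y bp (bcs_lbm bi1)).
- exact: (bcs_conv_integrand _ bp (bcs_lbm bit)).
- by move=> a; rewrite mulr_ge0 ?ker_ge0 ?wr0.
- by move=> a; rewrite mulr_ge0 ?ker_ge0 ?wr0.
- by move=> a; rewrite mulr_ge0 ?ker_ge0 ?wr0.
move=> a b; apply: powR_le_mul; rewrite ?ker_ge0 ?wr0//.
  have := ker_logconcave d0 (x - a) (y - b) t01; congr (_ <= ker _ _ _).
  by apply/rowP => i; rewrite !mxE; ring.
rewrite /weighted /restr.
apply: powR_le_mul; rewrite ?expR_ge0 ?mulr_ge0 ?indicE ?ler0n//.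
  exact: gexp_logconcave.
by apply: powR_le_mul; rewrite ?ler0n -?indicE//; exact: indic_logconcave.
Qed.

Lemma iter_oper_logconcave k x y :
  iter k (oper d K0) \1_K0 x `^ (1 - t) * iter k (oper d K1) \1_K1 y `^ t <=
  iter k (oper d Kt) \1_Kt ((1 - t) *: x + t *: y).
Proof.
have o0 (K : set rV) z : 0 <= (\1_K z : R) by rewrite indicE.
elim: k x y => [|k IH] x y; first exact: indic_logconcave.
rewrite !iterS; apply: oper_logconcave => //.
- by apply: (bcs_iter_oper d0 mK0 K0M); exact: bcs_indic mK0 K0M.
- by apply: (bcs_iter_oper d0 mK1 K1M); exact: bcs_indic mK1 K1M.
- by apply: (bcs_iter_oper d0 mKt KtM); exact: bcs_indic mKt KtM.
- exact: ge0_iter_oper.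
- exact: ge0_iter_oper.
- exact: ge0_iter_oper.
Qed.

(* Otherwise the iterates of the operator on Kt would grow at rate b at most,
   while Prekopa-Leindler forces the weighted geometric mean of the rates on K0
   and K1. *)
Lemma form_competitor u0 u1 (a0 a1 b : R) :
  bcs nrm u0 -> bcs nrm u1 ->
  (forall x, ~ K0 x -> u0 x = 0) -> (forall x, ~ K1 x -> u1 x = 0) ->
  0 < Int (fun x => u0 x ^+ 2) -> 0 < Int (fun x => u1 x ^+ 2) ->
  0 < a0 -> 0 < a1 ->
  a0 * Int (fun x => u0 x ^+ 2) <= form d u0 ->
  a1 * Int (fun x => u1 x ^+ 2) <= form d u1 ->
  0 < b -> b < a0 `^ (1 - t) * a1 `^ t ->
  exists f, [/\ bcs nrm f, forall x, ~ Kt x -> f x = 0 &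
    b * Int (fun x => f x ^+ 2) < form d f].
Proof.
move=> bu0 bu1 u0K u1K u00 u10 a00 a10 f0 f1 b0 ba.
have /andP[t0 t1] := t01.
apply/not_existsP => H.
have Hb f : bcs nrm f -> form d (restr Kt f) <= b * Int (fun x => f x ^+ 2).
  move=> bf; rewrite leNgt; apply/negP => hf; apply: (H (restr Kt f)); split.
  - exact: bcs_restr mKt KtM _ bf.
  - by move=> x Kx; rewrite /restr indicE memNset// mul0r.
  apply: le_lt_trans hf; rewrite ler_pM2l//; apply: (le_int sR).
  - by apply: bcsX; exact: bcs_restr mKt KtM _ bf.
  - exact: bcsX.
  move=> x; rewrite /restr exprMn ler_piMl ?sqr_ge0// indicE.
have up := oper_bounded d0 mKt KtM b0 Hb.
have [C0 C00 uC0] := bcs_bounded bu0; have [C1 C10 uC1] := bcs_bounded bu1.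
have g0 := oper_growth d0 mK0 K0M bu0 u0K C00 uC0 a00 u00 f0.
have g1 := oper_growth d0 mK1 K1M bu1 u1K C10 uC1 a10 u10 f1.
set I0 := Int (fun x => u0 x ^+ 2) in g0 u00; set I1 := Int (fun x => u1 x ^+ 2) in g1 u10.
set m := Int (fun x => _ ^+ 2) in up.
pose g := a0 `^ (1 - t) * a1 `^ t.
(* Positive constants independent of k, so they cannot offset (g / b)^(2 k) in the end. *)
pose e0 := I0 / C0 ^+ 2; pose e1 := I1 / C1 ^+ 2.
have e00 : 0 < e0 by rewrite divr_gt0// exprn_gt0.
have e10 : 0 < e1 by rewrite divr_gt0// exprn_gt0.
pose e := e0 `^ (1 - t) * e1 `^ t.
have ee0 : 0 < e by rewrite mulr_gt0 ?powR_gt0.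
have o0 (K : set rV) z : 0 <= (\1_K z : R) by rewrite indicE.
have key k : e * (g ^+ 2) ^+ k <= (b ^+ 2) ^+ k * m.
  apply: le_trans (up k).
  have PL := prekopa_leindler t01
    (bcs_iter_oper d0 mK0 K0M k.*2 (bcs_indic mK0 K0M))
    (bcs_iter_oper d0 mK1 K1M k.*2 (bcs_indic mK1 K1M))
    (bcs_iter_oper d0 mKt KtM k.*2 (bcs_indic mKt KtM))
    (@ge0_iter_oper _ _ d K0 k.*2 _ (o0 K0)) (@ge0_iter_oper _ _ d K1 k.*2 _ (o0 K1))
    (@ge0_iter_oper _ _ d Kt k.*2 _ (o0 Kt)) (iter_oper_logconcave k.*2).
  apply: le_trans PL.
  have aux (C I a s J : R) : 0 < C -> 0 < I -> 0 < a -> 0 < s ->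
      I * (a ^+ 2) ^+ k <= C ^+ 2 * J -> (I / C ^+ 2) `^ s * (a `^ s ^+ 2) ^+ k <= J `^ s.
    move=> C' I' a' s' h.
    have -> : (a `^ s ^+ 2) ^+ k = ((a ^+ 2) ^+ k) `^ s.
      by rewrite -!exprM powR_expn// ltW.
    have I2 : 0 <= I / C ^+ 2 by rewrite divr_ge0 ?sqr_ge0// ltW.
    have A2 : 0 <= (a ^+ 2) ^+ k by rewrite !exprn_ge0// ltW.
    rewrite -powRM//; apply: ge0_ler_powR; rewrite ?nnegrE ?(ltW s')//.
    - by rewrite mulr_ge0.
    - rewrite -(pmulr_rge0 J (_ : 0 < C ^+ 2)) ?exprn_gt0//; apply: le_trans h.
      by rewrite mulr_ge0// ltW.
    - by rewrite mulrAC ler_pdivrMr ?exprn_gt0// [leRHS]mulrC.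
  have t1' : 0 < 1 - t by rewrite subr_gt0.
  have h0 := aux _ _ _ _ _ C00 u00 a00 t1' (g0 k).
  have h1 := aux _ _ _ _ _ C10 u10 a10 t0 (g1 k).
  rewrite /e (_ : (g ^+ 2) ^+ k = (a0 `^ (1 - t) ^+ 2) ^+ k * (a1 `^ t ^+ 2) ^+ k);
    last by rewrite -exprMn -exprMn.
  rewrite mulrACA.
  have P (z v s : R) : 0 <= z `^ s * (v `^ s ^+ 2) ^+ k.
    by rewrite mulr_ge0 ?powR_ge0// !exprn_ge0// powR_ge0.
  exact: ler_pM (P _ _ _) (P _ _ _) h0 h1.
have q1 : 1 < (g / b) ^+ 2.
  have gb : 1 < g / b by rewrite ltr_pdivlMr// mul1r.
  by rewrite exprn_egt1.
have [k] := expr_unbounded m q1 ee0.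
rewrite ltNge => /negP; apply.
have := key k; rewrite expr_div_n expr_div_n mulrA.
rewrite ler_pdivrMr ?exprn_gt0//.
by rewrite [_ * m]mulrC.
Qed.

End log_concave_iteration.

(** * The Gaussian frequency through test functions *)

Section gaussian_integral.
Context {R : realType} (n : nat).
Notation rV := 'rV[R]_n.
Notation mu := (@lebesgue_rV R n).
Notation pdf := (@gaussian_pdf R n).
Import HBNNSimple.
Local Open Scope ereal_scope.

Let mpdf : measurable_fun [set: rV] (EFin \o pdf).
Proof. by apply/measurable_EFinP; exact: measurable_gaussian_pdf. Qed.

Let integral_gaussian_nnsfun (f : {nnsfun rV >-> R}) :
  \int[gaussian n]_x (f x)%:E = \int[mu]_x ((f x)%:E * (pdf x)%:E).
Proof.
under [LHS]eq_integral do rewrite fimfunE -fsumEFin//.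
rewrite [LHS]ge0_integral_fsum//; last 2 first.
  - by move=> r; exact/measurable_EFinP/measurableT_comp.
  - by move=> m x _; rewrite EFinM nnfun_muleindic_ge0.
under [RHS]eq_integral.
  move=> x xD; rewrite fimfunE -fsumEFin// ge0_mule_fsuml; last first.
    by move=> r; rewrite EFinM nnfun_muleindic_ge0.
  over.
rewrite [RHS]ge0_integral_fsum//; last 2 first.
  - move=> r; apply: emeasurable_funM => //.
    by apply/measurable_EFinP; apply/measurableT_comp.
  - move=> m x _; rewrite mule_ge0//; first by rewrite EFinM nnfun_muleindic_ge0.
    by rewrite lee_fin gaussian_pdf_ge0.
apply: eq_fsbigr => r _; have [r0|r0] := ltP r 0%R.
  have f0 x : \1_(f @^-1` [set r]) x = 0%R :> R.
    rewrite indicE memNset// => /= fr; have : (0 <= f x)%R by exact: fun_ge0.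
    by rewrite fr leNgt r0.
  under eq_integral do rewrite f0 mulr0.
  under [RHS]eq_integral do rewrite f0 mulr0 mul0e.
  by rewrite !integral0.
under eq_integral do rewrite EFinM.
under [RHS]eq_integral do rewrite EFinM -muleA.
have mfr : measurable (f @^-1` [set r]) by exact: measurable_sfunP.
rewrite ge0_integralZl//; [|exact/measurable_EFinP/measurable_indic].
rewrite ge0_integralZl//; last 2 first.
- by apply: emeasurable_funM => //; exact/measurable_EFinP/measurable_indic.
- by move=> x _; rewrite mule_ge0// lee_fin gaussian_pdf_ge0.
congr (_ * _); rewrite integral_indic// setIT.
rewrite [LHS]/(\int[mu]_(x in _) _) [LHS]integral_mkcond; apply: eq_integral => x _.
by rewrite patchE indicE; case: (x \in f @^-1` [set r]); rewrite ?mul1e ?mul0e.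
Qed.

(** True for indicators by definition of [gaussian], for simple functions by linearity, and in
    general by monotone convergence. *)
Lemma ge0_integral_gaussian (f : rV -> \bar R) :
  measurable_fun setT f -> (forall x, 0 <= f x) ->
  \int[gaussian n]_x f x = \int[mu]_x (f x * (pdf x)%:E).
Proof.
move=> mf f0; pose f_ := nnsfun_approx measurableT mf.
transitivity (lim (\int[gaussian n]_x (f_ k x)%:E @[k --> \oo])).
  rewrite -monotone_convergence//=.
  - apply: eq_integral => x _; apply/esym/cvg_lim => //=.
    exact: cvg_nnsfun_approx.
  - by move=> k; exact/measurable_EFinP/measurable_funTS.
  - by move=> k x _; rewrite lee_fin.
  - by move=> x _ a b ab; rewrite lee_fin; exact/lefP/nd_nnsfun_approx.
under eq_fun do rewrite integral_gaussian_nnsfun.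
have p0 x : 0 <= (pdf x)%:E by rewrite lee_fin gaussian_pdf_ge0.
rewrite -monotone_convergence//=.
- apply: eq_integral => x _; apply/cvg_lim => //=.
  apply: cvgeZr => //; exact: cvg_nnsfun_approx.
- move=> k; apply: emeasurable_funM => //; exact/measurable_EFinP/measurable_funTS.
- by move=> k x _; rewrite mule_ge0// lee_fin.
- move=> x _ a b ab; rewrite lee_wpmul2r// lee_fin; exact/lefP/nd_nnsfun_approx.
Qed.

End gaussian_integral.

(** * Test functions and the substitution *)

Section test_functions.
Context {R : realType} {n : nat}.
Notation rV := 'rV[R]_n.
Implicit Types (phi u v : rV -> R) (x y z : rV) (Omega : set rV).
Let sR := sized_rV (R := R) n.

Lemma partial_eq0 i phi x : ~ closure [set x | phi x != 0] x -> partial i phi x = 0.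
Proof.
move=> cx; rewrite /partial (@near_eq_derive _ _ _ phi (cst 0)).
  by rewrite derive_cst.
have oC : open (~` closure [set x | phi x != 0]).
  by apply: closed_openC; exact: closed_closure.
move: (oC x cx); apply: filterS => y cy; apply/eqP/negPn/negP => py.
by apply: cy; exact: subset_closure.
Qed.

Lemma test_functionP Omega phi : test_function Omega phi ->
  [/\ ctest phi, forall x, ~ Omega x -> phi x = 0 &
    forall i x, ~ Omega x -> partial i phi x = 0].
Proof.
move=> [sp cp sub]; split.
- split => //; have [M [_ HM]] := compact_bounded cp.
  exists (M + 1) => x Mx; apply/eqP/negPn/negP => px.
  have cx : closure [set x | phi x != 0] x by exact: subset_closure.
  have := HM (M + 1); rewrite ltrDl ltr01 => /(_ isT x cx) /=.
  by rewrite leNgt -/(nrm x) Mx.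
- move=> x Ox; apply/eqP/negPn/negP => px; apply: Ox; apply: sub; exact: subset_closure.
- by move=> i x Ox; apply: partial_eq0 => cx; apply: Ox; exact: sub.
Qed.

(** [gmass] and [genergy] leave out the normalizing constant [kappa], which cancels in the quotient,
    and run over the whole space, as test functions vanish outside their set. *)
Definition gmass phi : R := Int (fun x => phi x ^+ 2 * gexp (- 2^-1) x).
Definition genergy phi : R := Int (fun x => sqnorm (grad phi x) * gexp (- 2^-1) x).
Definition kappa : R := (2 * pi) `^ (- (n%:R / 2)).

Lemma kappa_gt0 : 0 < kappa.
Proof. by rewrite powR_gt0// mulr_gt0// pi_gt0. Qed.

Lemma gaussian_pdfE x : gaussian_pdf x = kappa * gexp (- 2^-1) x.
Proof. by rewrite /gaussian_pdf /gexp; congr (_ * expR _); field. Qed.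

Lemma EFin_int_gaussian Omega (f : rV -> R) : bcs nrm f -> (forall x, 0 <= f x) ->
  (forall x, ~ Omega x -> f x = 0) ->
  (\int[gaussian n]_(x in Omega) (f x)%:E = (kappa * Int (fun x => f x * gexp (- 2^-1) x))%:E)%E.
Proof.
move=> bf f0 fO; rewrite integral_mkcond.
rewrite (_ : _ \_ _ = EFin \o f); last first.
  apply/funext => x; rewrite patchE; case: ifPn => // /negP xO; rewrite /= fO//.
  by move=> Ox; apply: xO; exact/mem_set.
have mf : measurable_fun setT (EFin \o f) by apply/measurable_EFinP; exact: bf.1.1.
have Ef0 x : (0 <= (EFin \o f) x)%E by rewrite lee_fin.
rewrite (ge0_integral_gaussian mf Ef0).
have bfg : bcs nrm (fun x => f x * gexp (- 2^-1) x) by apply: bcsMr => //; exact: lbm_gexp.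
have bkf : bcs nrm (fun x => kappa * (f x * gexp (- 2^-1) x)).
  exact: bcsZ.
transitivity (Int (fun x => kappa * (f x * gexp (- 2^-1) x)))%:E; last by rewrite (intZ sR).
rewrite (EFin_int sR bkf).
by apply: eq_integral => x _; rewrite gaussian_pdfE /= -EFinM; congr EFin; ring.
Qed.

Lemma int_gaussian Omega (f : rV -> R) : bcs nrm f -> (forall x, 0 <= f x) ->
  (forall x, ~ Omega x -> f x = 0) ->
  \int[gaussian n]_(x in Omega) f x = kappa * Int (fun x => f x * gexp (- 2^-1) x).
Proof. by move=> bf f0 fO; rewrite /Rintegral EFin_int_gaussian. Qed.

Lemma L2_bcs Omega (f : rV -> R) : bcs nrm f -> (forall x, ~ Omega x -> f x = 0) ->
  L2 Omega f.
Proof.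
move=> bf fO; split; first exact: measurable_funTS bf.1.1.
rewrite EFin_int_gaussian ?ltry//; first exact: bcsX.
- by move=> x; exact: sqr_ge0.
- by move=> x /fO ->; rewrite expr0n.
Qed.

Lemma sqnorm0 : sqnorm (0 : rV) = 0.
Proof. by apply: big1 => i _; rewrite mxE expr0n. Qed.

(** The product of two test functions has partial derivatives of integral 0, which gives the weak
    gradient; membership in the closure holds because [phi] approximates itself. *)
Lemma test_function_W12_0 Omega phi : test_function Omega phi -> W12_0 Omega phi (grad phi).
Proof.
move=> tphi; have [cphi phiO dphiO] := test_functionP tphi.
have bphi := ctest_bcs cphi.
have gE i : (fun x => grad phi x ord0 i) = partial i phi by apply/funext => x; rewrite mxE.
split; last first.
  move=> e e0; exists phi => //; rewrite /W12_norm.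
  rewrite (_ : (fun x => (phi \- phi) x ^+ 2) = fun=> 0); last first.
    by apply/funext => x; rewrite /= subrr expr0n.
  rewrite (_ : (fun x => sqnorm _) = fun=> 0); last first.
    by apply/funext => x; rewrite /= subrr sqnorm0.
  by rewrite /Rintegral integral0 addr0 sqrtr0.
split.
- exact: L2_bcs.
- move=> i; rewrite gE; apply: L2_bcs; first exact/ctest_bcs/ctest_partial.
  by move=> x; exact: dphiO.
- move=> psi tpsi i; have [cpsi psiO dpsiO] := test_functionP tpsi.
  have bpsi := ctest_bcs cpsi.
  have bd := ctest_bcs (ctest_partial i cphi); have bd' := ctest_bcs (ctest_partial i cpsi).
  have b1 : bcs nrm (fun x => phi x * partial i psi x) by apply: bcsMl => //; exact: bcs_lbm.
  have b2 : bcs nrm (fun x => psi x * partial i phi x) by apply: bcsMl => //; exact: bcs_lbm.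
  have := int_partial i (ctestM cphi.1 cpsi).
  rewrite (_ : partial i _ = fun x => phi x * partial i psi x + psi x * partial i phi x).
    rewrite (intD sR)// => /eqP; rewrite addr_eq0 => /eqP.
    rewrite (Rintegral_mkcond _ Omega) (_ : _ \_ _ = fun x => phi x * partial i psi x).
      move=> ->; congr (- _); rewrite (Rintegral_mkcond _ Omega); congr Rintegral.
      apply/funext => x; rewrite patchE mxE mulrC; case: ifPn => // /negP xO.
      by rewrite dphiO ?mul0r// => Ox; apply: xO; exact/mem_set.
    apply/funext => x; rewrite patchE; case: ifPn => // /negP xO.
    by rewrite phiO ?mul0r// => Ox; apply: xO; exact/mem_set.
  by apply/funext => x; rewrite partialM//; [exact: cphi.1|exact: cpsi.1].
Qed.

Lemma test_function_int Omega phi : test_function Omega phi ->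
  \int[gaussian n]_(x in Omega) phi x ^+ 2 = kappa * gmass phi /\
  \int[gaussian n]_(x in Omega) sqnorm (grad phi x) = kappa * genergy phi.
Proof.
move=> /test_functionP[cphi phiO dphiO]; split; apply: int_gaussian.
- exact/bcsX/ctest_bcs.
- by move=> x; exact: sqr_ge0.
- by move=> x /phiO ->; rewrite expr0n.
- exact: bcs_grad.
- by move=> x; exact: sqnorm_ge0.
- by move=> x xO; apply: big1 => i _; rewrite mxE dphiO// expr0n.
Qed.

(** Positive mass excludes vanishing almost everywhere, so [phi] is admissible in the infimum. *)
Lemma frequency_le Omega phi : open Omega -> test_function Omega phi -> 0 < gmass phi ->
  (gaussian_frequency Omega <= (genergy phi / gmass phi)%:E)%E.
Proof.
move=> oO tphi m0; have [cphi phiO dphiO] := test_functionP tphi.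
have bphi := ctest_bcs cphi; have k0 := kappa_gt0.
have phi2O x : ~ Omega x -> phi x ^+ 2 = 0 by move=> /phiO ->; rewrite expr0n.
have phi20 x : 0 <= phi x ^+ 2 by exact: sqr_ge0.
have [e1 e2] := test_function_int tphi.
apply: ereal_inf_lbound; exists phi, (grad phi); split.
- exact: test_function_W12_0.
- move=> ae; have mO := open_measurable_rV oO.
  have : (\int[gaussian n]_(x in Omega) (phi x ^+ 2)%:E = 0)%E.
    transitivity (\int[gaussian n]_(x in Omega) (cst 0%E x))%E; last by rewrite integral0.
    apply: ae_eq_integral => //.
      by apply/measurable_EFinP/measurable_funTS; exact: (bcsX 1 bphi).1.1.
    by apply: filterS ae => x H Ox; rewrite H//= expr0n.
  rewrite (EFin_int_gaussian (bcsX 1 bphi) phi20 phi2O) => -[] /eqP.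
  by rewrite mulf_eq0 (gt_eqF k0) -/(gmass phi) (gt_eqF m0).
congr EFin; rewrite e1 e2.
by field; rewrite !gt_eqF.
Qed.

(** Pointwise, the two energy densities differ by half the divergence of the field with components H
    i = x_i phi^2 G, G the Gaussian weight. The field has bounded support, so its divergence
    integrates to 0. The divergence n of the field x is the source of n/2. *)
Lemma schrodinger_transform phi : ctest phi ->
  dirichlet (fun x => gexp (- 4^-1) x * phi x) = genergy phi + n%:R / 2 * gmass phi /\
  Int (fun x => (gexp (- 4^-1) x * phi x) ^+ 2) = gmass phi.
Proof.
move=> cphi; have bphi := ctest_bcs cphi; have lphi := bcs_lbm bphi.
have gg x : gexp (- 4^-1) x ^+ 2 = gexp (- 2^-1) x :> R.
  by rewrite /gexp expr2 -expRD; congr expR; field.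
split; last first.
  by congr Rintegral; apply/funext => x; rewrite exprMn gg mulrC.
pose G := @gexp R n (- 2^-1).
pose H i := fun x : rV => x ord0 i * (phi x * phi x * G x).
have sG : smooth G by exact: smooth_gexp.
have sphi := cphi.1.
have cH i : ctest (H i).
  apply: ctestM; first exact: smooth_coord.
  rewrite (_ : (fun x => _) = fun x => (phi x * G x) * phi x).
    exact: ctestM (smoothM sphi sG) cphi.
  by apply/funext => x; ring.
have dH i x : partial i (H i) x =
    phi x ^+ 2 * G x + 2 * (x ord0 i * phi x * partial i phi x * G x)
     - x ord0 i ^+ 2 * phi x ^+ 2 * G x.
  rewrite /H (partialM _ _ (smooth_coord i) (smoothM (smoothM sphi sphi) sG)).
  rewrite partial_coord eqxx mulr1 (partialM _ _ (smoothM sphi sphi) sG).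
  rewrite (partialM _ _ sphi sphi) partial_gexp -/G.
  by field.
have bH i := ctest_bcs (ctest_partial i (cH i)).
have bu : ctest (fun x => gexp (- 4^-1) x * phi x) := ctestM (smooth_gexp _) cphi.
have b1 := bcs_grad bu.
have b2 : bcs nrm (fun x => sqnorm x * (gexp (- 4^-1) x * phi x) ^+ 2).
  by apply: bcsMl; [exact: lbm_sqnorm|exact/bcsX/ctest_bcs].
have b3 : bcs nrm (fun x => sqnorm (grad phi x) * G x).
  by apply: bcsMr; [exact: bcs_grad|exact: lbm_gexp].
have b4 : bcs nrm (fun x => phi x ^+ 2 * G x).
  by apply: bcsMr; [exact: bcsX|exact: lbm_gexp].
have b5 : bcs nrm (fun x => n%:R / 2 * (phi x ^+ 2 * G x)).
  exact: bcsZ.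
have b6 : bcs nrm (fun x => \sum_i partial i (H i) x) by exact: bcs_sum.
have key : forall z, sqnorm (grad (fun y => gexp (- 4^-1) y * phi y) z) +
    sqnorm z * (gexp (- 4^-1) z * phi z) ^+ 2 / 4 =
    sqnorm (grad phi z) * G z + n%:R / 2 * (phi z ^+ 2 * G z) -
    (\sum_i partial i (H i) z) / 2.
  move=> z; rewrite /sqnorm !mulr_suml -big_split/=.
  have -> : n%:R / 2 * (phi z ^+ 2 * G z) = \sum_(i < n) phi z ^+ 2 * G z / 2.
    by rewrite sumr_const card_ord -[in RHS]mulr_natl; field.
  rewrite -big_split -sumrB/=; apply: eq_bigr => i _.
  rewrite !mxE (partialM i z (smooth_gexp (- 4^-1)) sphi).
  rewrite partial_gexp dH exprMn -[G z]gg.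
  by field.
rewrite /dirichlet -(intZr sR)// -(intD sR)//; last by apply: bcsMr => //; exact: lbm_cst.
transitivity (Int (fun y => sqnorm (grad phi y) * G y +
    n%:R / 2 * (phi y ^+ 2 * G y) - (\sum_i partial i (H i) y) / 2)).
  by congr Rintegral; apply/funext => y; exact: key.
rewrite (intB sR); [|exact: bcsD|by apply: bcsMr => //; exact: lbm_cst].
rewrite (intD sR)// (intZ sR)// (intZr sR)// (int_sum sR)//.
rewrite [X in _ - X / 2]big1 ?mul0r ?subr0// => i _; exact: int_partial.
Qed.

End test_functions.

(** * Approximation of Sobolev functions by test functions *)

Section approximation.
Context {R : realType} {n : nat}.
Notation rV := 'rV[R]_n.
Implicit Types (phi u v : rV -> R) (x y z : rV) (Omega : set rV).
Let mu := @gaussian R n.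

Lemma L2_integrable Omega v : L2 Omega v -> mu.-integrable Omega (EFin \o (fun x => v x ^+ 2)).
Proof.
move=> [mv iv]; apply/integrableP; split; first exact/measurable_EFinP/measurable_funX.
apply: le_lt_trans iv; rewrite le_eqVlt; apply/orP; left; apply/eqP.
by apply: eq_integral => x _; rewrite /= ger0_norm ?sqr_ge0.
Qed.

Lemma L2B Omega u v : measurable Omega -> L2 Omega u -> L2 Omega v -> L2 Omega (u \- v).
Proof.
move=> mO Lu Lv; have [mu_ _] := Lu; have [mv _] := Lv.
have muv : measurable_fun Omega (u \- v) by exact: measurable_funB.
split => //.
have i1 : mu.-integrable Omega (EFin \o (fun x => 2 * u x ^+ 2)).
  by have := integrableZl mO 2 (L2_integrable Lu).
have i2 : mu.-integrable Omega (EFin \o (fun x => 2 * v x ^+ 2)).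
  by have := integrableZl mO 2 (L2_integrable Lv).
have /integrableP[_] : mu.-integrable Omega (EFin \o (fun x => (u \- v) x ^+ 2)).
  apply: le_integrable (integrableD mO i1 i2) => //.
    exact/measurable_EFinP/measurable_funX.
  move=> x _; rewrite /= lee_fin (ger0_norm (sqr_ge0 _)) ger0_norm.
    by have := sqr_ge0 (u x + v x); lra.
  by have := sqr_ge0 (u x); have := sqr_ge0 (v x); lra.
move=> H; apply: le_lt_trans H; rewrite le_eqVlt; apply/orP; left; apply/eqP.
by apply: eq_integral => x _; rewrite /= ger0_norm ?sqr_ge0.
Qed.

(* Young's inequality, used in place of the triangle inequality of L^2. *)
Lemma L2_young Omega u v (h : R) : measurable Omega -> 0 < h -> L2 Omega u -> L2 Omega v ->
  \int[mu]_(x in Omega) u x ^+ 2 <= (1 + h) * (\int[mu]_(x in Omega) v x ^+ 2) +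
    (1 + h^-1) * (\int[mu]_(x in Omega) (u \- v) x ^+ 2).
Proof.
move=> mO h0 Lu Lv; have iu := L2_integrable Lu; have iv := L2_integrable Lv.
have iuv := L2_integrable (L2B mO Lu Lv).
have i1 : mu.-integrable Omega (EFin \o (fun x => (1 + h) * v x ^+ 2)).
  by have := integrableZl mO (1 + h) iv.
have i2 : mu.-integrable Omega (EFin \o (fun x => (1 + h^-1) * (u \- v) x ^+ 2)).
  by have := integrableZl mO (1 + h^-1) iuv.
rewrite -(RintegralZl _ mO iv) -(RintegralZl _ mO iuv) -(RintegralD mO i1 i2).
apply: le_Rintegral => //; first exact: integrableD i1 i2.
move=> x _ /=; rewrite -subr_ge0.
rewrite (_ : _ - _ = h^-1 * (h * v x - (u x - v x)) ^+ 2); last by field; rewrite gt_eqF.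
by rewrite mulr_ge0 ?sqr_ge0 ?invr_ge0 ?ltW.
Qed.

Lemma Rintegral_sqnorm Omega (g : rV -> rV) : measurable Omega ->
  (forall i, L2 Omega (fun x => g x ord0 i)) ->
  \int[mu]_(x in Omega) sqnorm (g x) = \sum_i \int[mu]_(x in Omega) g x ord0 i ^+ 2.
Proof.
move=> mO Lg.
have I i := L2_integrable (Lg i).
rewrite /Rintegral (eq_integral (fun x => (\sum_(i < n) (g x ord0 i ^+ 2)%:E)%E)); last first.
  by move=> x _; rewrite sumEFin.
rewrite integral_sum//= -sum_fine// => i _; exact: (integrable_fin_num mO (I i)).
Qed.

(** The strict inequality leaves a slack that absorbs the error of replacing an admissible function
    by a test function close to it in [W12_norm]. *)
Lemma gaussian_frequency_approx Omega (q : R) : open Omega -> (gaussian_frequency Omega < q%:E)%E ->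
  exists phi, [/\ test_function Omega phi, 0 < gmass phi & genergy phi <= q * gmass phi].
Proof.
move=> oO /ereal_inf_lt[_ [v [g [[[Lv Lg _] cl] nae ->]]]]; rewrite lte_fin.
have mO := open_measurable_rV oO.
rewrite (Rintegral_sqnorm mO Lg).
set N := \int[_]_(x in _) _; set E := \sum_i _ => Eq.
have E0 : 0 <= E by apply: sumr_ge0 => i _; apply: Rintegral_ge0 => x _; exact: sqr_ge0.
have N0 : 0 < N.
  rewrite lt_neqAle eq_sym; apply/andP; split; last by apply: Rintegral_ge0 => x _; exact: sqr_ge0.
  apply/eqP => N0; apply: nae.
  have iv := L2_integrable Lv.
  have mv2 : measurable_fun Omega (EFin \o (fun x => v x ^+ 2)) by case/integrableP : iv.
  have : ae_eq mu Omega (EFin \o (fun x => v x ^+ 2)) (cst 0%E).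
    apply/(ae_eq_integral_abs mu mO mv2).
    rewrite (eq_integral (EFin \o (fun x => v x ^+ 2))); last first.
      by move=> x _; rewrite /= ger0_norm ?sqr_ge0.
    by rewrite -[LHS]fineK ?integrable_fin_num// -/(Rintegral _ _ _) -/N N0.
  by apply: filterS => x H Ox; move: (H Ox) => /= [] /eqP; rewrite sqrf_eq0 => /eqP.
have q0 : 0 < q by apply: le_lt_trans Eq; exact: divr_ge0 E0 (ltW N0).
rewrite ltr_pdivrMr// -subr_gt0 in Eq; set s := q * N - E in Eq.
(* With Young parameter h and error D, what has to hold is (1 + h) ((1 + h) E + D) <= q (N - D). The
   slack s = q N - E is split in halves: h is chosen for 3 h E <= s/2 and D for (2 + q) D <= s/2,
   while D < N keeps the mass positive. *)
pose h := s / (6 * (E + 1) + s).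
have h0 : 0 < h by rewrite divr_gt0//; lra.
have h1 : h <= 1 by rewrite ler_pdivrMr; lra.
have hE : 3 * h * E <= s / 2.
  have hK : h * (6 * (E + 1) + s) = s by rewrite mulfVK// gt_eqF//; lra.
  have : h * (6 * E) <= h * (6 * (E + 1) + s) by rewrite ler_pM2l//; lra.
  by rewrite hK; lra.
pose D := (s / 2) * N / ((2 + q) * N + s / 2).
have dp : 0 < (2 + q) * N + s / 2 by rewrite addr_gt0 ?mulr_gt0// ?divr_gt0//; lra.
have D0 : 0 < D by rewrite divr_gt0 ?mulr_gt0 ?invr_gt0.
have DN : D < N by rewrite ltr_pdivrMr//; nra.
have Dq : (2 + q) * D <= s / 2.
  by rewrite /D mulrA ler_pdivrMr//; nra.
have hi : 0 < 1 + h^-1 by rewrite addr_gt0 ?invr_gt0.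
have De : 0 < D / (1 + h^-1) by rewrite divr_gt0.
have [|phi tphi] := cl (Num.sqrt (D / (1 + h^-1))); first by rewrite sqrtr_gt0.
rewrite /W12_norm ltr_sqrt//.
have [cphi phiO dphiO] := test_functionP tphi.
have bphi := ctest_bcs cphi.
have Lphi : L2 Omega phi by exact: L2_bcs.
have gE i : (fun x => grad phi x ord0 i) = partial i phi by apply/funext => x; rewrite mxE.
have Ldphi i : L2 Omega (fun x => grad phi x ord0 i).
  by rewrite gE; apply: L2_bcs; [exact/ctest_bcs/ctest_partial|move=> x; exact: dphiO].
have Ldiff i : L2 Omega (fun x => (g \- grad phi) x ord0 i).
  rewrite (_ : (fun x => _) = (fun x => g x ord0 i) \- (fun x => grad phi x ord0 i)).
    exact: L2B.
  by apply/funext => x; rewrite /= !mxE.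
rewrite (Rintegral_sqnorm mO Ldiff).
set X := \int[_]_(x in _) _; set Y := \sum_i _ => XY.
have X0 : 0 <= X by apply: Rintegral_ge0 => x _; exact: sqr_ge0.
have Y0 : 0 <= Y by apply: sumr_ge0 => i _; apply: Rintegral_ge0 => x _; exact: sqr_ge0.
have XD : (1 + h^-1) * X <= D.
  by rewrite mulrC -ler_pdivlMr//; lra.
have YD : (1 + h^-1) * Y <= D.
  by rewrite mulrC -ler_pdivlMr//; lra.
have [e1 e2] := test_function_int tphi.
have k0 := @kappa_gt0 R n.
have I1 : N <= (1 + h) * (kappa (n := n) * gmass phi) + D.
  by rewrite -e1; apply: le_trans (L2_young mO h0 Lv Lphi) _; rewrite lerD2l.
have I2 : kappa (n := n) * genergy phi <= (1 + h) * E + D.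
  rewrite -e2 (Rintegral_sqnorm mO Ldphi).
  apply: (@le_trans _ _ ((1 + h) * E + (1 + h^-1) * Y)); last by rewrite lerD2l.
  rewrite /E /Y !mulr_sumr -big_split/=; apply: ler_sum => i _.
  apply: le_trans (L2_young mO h0 (Ldphi i) (Lg i)) _; rewrite lerD2l ler_pM2l//.
  rewrite le_eqVlt; apply/orP; left; apply/eqP; congr Rintegral; apply/funext => x; rewrite /= !mxE; ring.
have k0' := ltW k0.
pose m := kappa (n := n) * gmass phi; pose w := kappa (n := n) * genergy phi.
rewrite -/m in I1; rewrite -/w in I2.
have m0 : 0 < m.
  rewrite -(pmulr_rgt0 m (_ : 0 < 1 + h)); last by rewrite addr_gt0.
  by lra.
have wm : w <= q * m.
  rewrite -(ler_pM2l (_ : 0 < 1 + h)); last by rewrite addr_gt0.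
  apply: (@le_trans _ _ (q * (N - D))); last by rewrite mulrCA ler_pM2l//; lra.
  apply: (@le_trans _ _ ((1 + h) * ((1 + h) * E + D))); first by rewrite ler_pM2l// addr_gt0.
  have hhE : h * (h * E) <= h * E by rewrite ler_piMl// mulr_ge0// ltW.
  have hD : h * D <= D by rewrite ler_piMl// ltW.
  have -> : (1 + h) * ((1 + h) * E + D) = E + 2 * (h * E) + h * (h * E) + D + h * D by ring.
  have -> : q * (N - D) = s + E - q * D by rewrite /s; ring.
  by move: hE Dq hhE hD; clear; nra.
exists phi; split => //; first by rewrite -(pmulr_rgt0 _ k0).
by rewrite -(ler_pM2l k0) mulrCA.
Qed.

End approximation.

(** * Minkowski combinations *)

Section minkowski_topology.
Context {R : realType} {n : nat}.
Notation rV := 'rV[R]_n.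
Implicit Types (x y z : rV) (A B K Omega : set rV).

Let scale_continuous (a : R) : continuous ( *:%R a : rV -> rV).
Proof. by move=> x; exact: (@cvgZl_tmp R rV _ (nbhs x) _ a id x (@cvg_id _ _)). Qed.

Lemma minkowski_combination_compact (a b : R) A B : compact A -> compact B ->
  compact (minkowski_combination a b A B).
Proof.
move=> cA cB.
have cZ c (C : set rV) : compact C -> compact (( *:%R c) @` C).
  by move=> cC; apply: continuous_compact cC; exact/continuous_subspaceT/scale_continuous.
rewrite (_ : minkowski_combination a b A B =
    (fun p : rV * rV => p.1 + p.2) @` ((( *:%R a) @` A) `*` (( *:%R b) @` B))).
  apply: continuous_compact; last by apply: compact_setX; exact: cZ.
  exact/continuous_subspaceT/(@pseudometric_normed_Zmodule.add_continuous R rV).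
apply/seteqP; split => [_ [x Ax [y By <-]]|_ [[_ _] [/= [x Ax <-] [y By <-]] <-]].
  by exists (a *: x, b *: y) => //; split; [exists x|exists y].
by exists x => //; exists y.
Qed.

(** Solving for the first summand: q -> a^-1 (q - b y) is continuous, and openness of [A] pulls
    back. *)
Lemma minkowski_combination_open (a b : R) A B : a != 0 -> open A ->
  open (minkowski_combination a b A B).
Proof.
move=> a0 oA; rewrite openE => _ [x Ax [y By <-]]; rewrite /interior.
have : (fun q : rV => a^-1 *: (q - b *: y)) @ (a *: x + b *: y) --> x.
  rewrite [X in _ --> X](_ : x = a^-1 *: (a *: x + b *: y - b *: y)); last first.
    by rewrite addrK scalerK.
  apply: (@cvgZl_tmp R rV _ (nbhs (a *: x + b *: y)) _ a^-1 (fun q => q - b *: y)).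
  by apply: cvgB; [exact: cvg_id|exact: cvg_cst].
move=> /(_ A (open_nbhs_nbhs (conj oA Ax))) H.
have {}H : nbhs (a *: x + b *: y) [set q | A (a^-1 *: (q - b *: y))] by exact: H.
apply: filterS H => q Aq.
exists (a^-1 *: (q - b *: y)) => //; exists y => //.
by rewrite scalerA mulfV// scale1r subrK.
Qed.

(** Compactness makes the radii of the balls inside [Omega] uniform over [K]. The margin is the room
    in which the competitor is mollified. *)
Lemma compact_margin K Omega : compact K -> open Omega -> K `<=` Omega ->
  exists2 r : R, 0 < r & forall x z, K x -> nrm z <= r -> Omega (x + z).
Proof.
move=> /compact_near_coveringP cK oO KO.
have H : \forall r \near (0 : R)^'+, K `<=` (fun x => forall z, nrm z <= r -> Omega (x + z)).
  apply: cK => x Kx.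
  have /nbhs_ballP[e /= e0 eO] : nbhs x Omega by exact: open_nbhs_nbhs (conj oO (KO _ Kx)).
  have e20 : 0 < e / 2 by rewrite divr_gt0.
  exists (ball x (e / 2), [set r : R | r < e / 2]) => /=.
    split; first exact: nbhsx_ballx.
    exact: nbhs_right_lt.
  move=> [y r] /= [yx re] z zr; apply: eO; rewrite -ball_normE /= opprD addrA.
  apply: le_lt_trans (ler_normB _ _) _; rewrite (splitr e) ltrD//.
    by move: yx; rewrite -ball_normE.
  exact: le_lt_trans zr re.
have [r [Hr r0]] := filter_ex (filterI H (nbhs_right_gt (0 : R))).
by exists r => // x z Kx; exact: Hr.
Qed.

Lemma compact_bounded_nrm K : compact K -> exists M, forall x, K x -> nrm x <= M.
Proof.
move=> /compact_bounded[M [_ HM]]; exists (M + 1) => x Kx.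
by apply: (HM (M + 1)) => //; rewrite ltrDl.
Qed.

Lemma compact_measurable_rV K : compact K -> measurable K.
Proof.
move=> /(compact_closed (@norm_hausdorff _ _)) /closed_openC /open_measurable_rV.
by move=> /measurableC; rewrite setCK.
Qed.

Lemma compact_closed_ball (d : R) : compact [set z : rV | nrm z <= d].
Proof.
apply: bounded_closed_compact.
  by exists d; split; [exact: num_real|move=> e de z /= zd; exact: le_trans zd (ltW de)].
rewrite (_ : [set z | _] = nrm @^-1` [set r : R | r <= d])//.
by apply: preimage_closed; [move=> x _; exact: norm_continuous|exact: closed_le].
Qed.

(** The support lies in the sum of [K] and a closed ball of radius [d], which is compact. The factor
    [gexp a] is there to undo the substitution. *)
Lemma smoothing_test_function K Omega (d a : R) (f : rV -> R) : 0 < d -> bcs nrm f ->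
  compact K -> (forall x, ~ K x -> f x = 0) ->
  (forall x z, K x -> nrm z <= d -> Omega (x + z)) ->
  test_function Omega (fun x => gexp a x * smoothing d f x).
Proof.
move=> d0 bf cK fK KO; set phi := fun x => _.
pose S := minkowski_combination 1 1 K [set z : rV | nrm z <= d].
have cS : compact S by apply: minkowski_combination_compact => //; exact: compact_closed_ball.
have phiS : closure [set x | phi x != 0] `<=` S.
  rewrite [X in _ `<=` X]((closure_id S).1 (compact_closed (@norm_hausdorff _ _) cS)).
  apply: closureS => x; rewrite /phi /= /smoothing /conv => px.
  have [y /eqP] : exists y, ker d 0 (x - y) * f y <> 0.
    apply/existsNP => H; move: px; rewrite (_ : (fun y => _) = fun=> 0).
      by rewrite /Rintegral integral0 !mulr0 eqxx.
    exact/funext.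
  rewrite mulf_eq0 negb_or => /andP[/ker_support kxy fy].
  exists y; first by apply: contrapT => /fK fy0; rewrite fy0 eqxx in fy.
  exists (x - y); last by rewrite !scale1r addrC subrK.
  (* The kernel lives on a Euclidean ball, which is contained in the ball of the sup norm. *)
  rewrite /= -(ler_pXn2r (n := 2))// ?nnegrE ?normr_ge0 ?(ltW d0)//.
  exact: ltW (le_lt_trans (nrm_sqr_le _) (kxy d0)).
split.
- have := ctestM (smooth_gexp a) (ctest_smoothing d0 bf); by case.
- by apply: subclosed_compact cS phiS; exact: closed_closure.
- by move=> x /phiS[k Kk [z zd <-]]; rewrite !scale1r; exact: KO.
Qed.

End minkowski_topology.

Lemma small_parameter (R : realFieldType) (s : seq R) :
  exists2 d : R, 0 < d & forall x, x \in s -> d * x < 1.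
Proof.
pose Z := \sum_(x <- s) `|x|; have Z0 : 0 <= Z by apply: sumr_ge0 => x _.
exists (1 + Z)^-1; first by rewrite invr_gt0 ltr_wpDr.
move=> x xs; rewrite mulrC ltr_pdivrMr ?ltr_wpDr// mul1r ltr_pwDl//.
by apply: le_trans (ler_norm x) _; rewrite /Z (big_rem x)//= lerDl sumr_ge0.
Qed.

(** * From two given sets to their Minkowski combination *)

Section minkowski_transfer.
Context {R : realType} {n : nat}.
Notation rV := 'rV[R]_n.
Implicit Types (u f F : rV -> R) (x y z : rV) (K : set rV).
Let sR := sized_rV (R := R) n.
Variable t : R.
Hypothesis t01 : 0 < t < 1.

(** The geometric mean G exceeds the harmonic one: [amgm] for the inverses bounds 1/G by 1 + s, and
    1/(1 + s) >= 1 - s. This linearizes the geometric mean of two rates close to 1. *)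
Lemma weighted_mean_lower (x y : R) : 0 <= x <= 2^-1 -> 0 <= y <= 2^-1 ->
  1 - ((1 - t) * (x + 2 * x ^+ 2) + t * (y + 2 * y ^+ 2)) <= (1 - x) `^ (1 - t) * (1 - y) `^ t.
Proof.
move=> /andP[x0 x2] /andP[y0 y2]; have /andP[t0 t1] := t01.
have inv (z : R) : 0 <= z -> z <= 2^-1 -> (1 - z)^-1 <= 1 + (z + 2 * z ^+ 2).
  move=> z0 z2; rewrite -[leLHS]mul1r ler_pdivrMr; last by lra.
  rewrite -subr_ge0 (_ : _ - 1 = z ^+ 2 * (1 - 2 * z)); last by ring.
  by rewrite mulr_ge0 ?sqr_ge0//; lra.
have x1 : 0 < 1 - x by lra.
have y1 : 0 < 1 - y by lra.
have a := amgm t01 (ltW (_ : 0 < (1 - x)^-1)) (ltW (_ : 0 < (1 - y)^-1)).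
rewrite !invr_gt0 in a; have {a} := a x1 y1.
have pinv (z s : R) : 0 < z -> z^-1 `^ s = (z `^ s)^-1.
  by move=> z0; rewrite -powR_inv1 ?ltW// -powRrM mulN1r powRN.
rewrite !pinv// -invfM.
set G := _ `^ _ * _ `^ _; set s := _ * (x + _) + _.
have G0 : 0 < G by rewrite mulr_gt0 ?powR_gt0.
have s0 : 0 <= s.
  have q (z : R) : 0 <= z -> 0 <= z + 2 * z ^+ 2.
    by move=> z0; rewrite addr_ge0// mulr_ge0// sqr_ge0.
  by rewrite /s addr_ge0// mulr_ge0 ?q//; lra.
have hx := inv x x0 x2; have hy := inv y y0 y2.
have h : (1 - t) * (1 - x)^-1 + t * (1 - y)^-1 <= 1 + s.
  have := ler_wpM2l (_ : 0 <= 1 - t) hx; have := ler_wpM2l (ltW t0) hy.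
  by rewrite /s; lra.
move=> /le_trans /(_ h); rewrite -[leLHS]mul1r ler_pdivrMr// => sG.
have [s1|s1] := leP 1 s; first by apply: le_trans (ltW G0); rewrite subr_le0.
rewrite -(ler_pM2l (_ : 0 < 1 + s)); last by rewrite ltr_wpDr.
by apply: le_trans sG; rewrite -subr_ge0 (_ : _ - _ = s ^+ 2) ?sqr_ge0//; ring.
Qed.

Lemma sqnorm_le_nrm x (M : R) : nrm x <= M -> sqnorm x <= n%:R * M ^+ 2.
Proof.
move=> xM; rewrite mulr_natl -[X in _ *+ X](card_ord n) -sumr_const; apply: ler_sum => i _.
have c := le_trans (ler_coord_norm x i) xM.
by rewrite -real_normK ?num_real// lerXn2r ?nnegrE//; exact: le_trans c.
Qed.

Lemma form_lower_ratio u (L : R) : ctest u -> 0 < Int (fun x => u x ^+ 2) ->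
  dirichlet u <= L * Int (fun x => u x ^+ 2) ->
  exists2 C, 0 <= C & forall d, 0 < d -> d <= 1 ->
    @Np R n d * (1 - @step R n d * (L + C * d)) * Int (fun x => u x ^+ 2) <= form d u.
Proof.
move=> cu; set U := Int _ => U0 DL; have [C C0 HC] := form_lower cu.
exists (C / U); first exact: divr_ge0 C0 (ltW U0).
move=> d d0 d1; apply: le_trans (HC d d0 d1); rewrite -/U -mulrA ler_pM2l ?Np_gt0//.
have h0 := @step_gt0 R n d d0.
have := ler_wpM2l (ltW h0) DL.
have -> : (1 - step (n := n) d * (L + C / U * d)) * U =
  U - (step (n := n) d * (L * U) + step (n := n) d * (C * d)) by field; rewrite gt_eqF.
by move: (dirichlet u) (step _) => D h; lra.
Qed.

(** The form is at most Np times the integral of f^2, so the strict inequality would fail if that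
    integral were 0. *)
Lemma form_gt0_int f (b d : R) : 0 < d -> bcs nrm f ->
  b * Int (fun x => f x ^+ 2) < form d f -> 0 < Int (fun x => f x ^+ 2).
Proof.
move=> d0 bf; have S0 : 0 <= Int (fun x => f x ^+ 2) by apply: int_ge0 => x; exact: sqr_ge0.
move=> H; rewrite lt_neqAle S0 andbT eq_sym; apply/eqP => SE; move: H; rewrite SE mulr0 ltNge => /negP; apply.
apply: le_trans (form_le_sqr d0 bf) _; rewrite -(mulr0 (Np (n := n) d)) ler_pM2l ?Np_gt0// -SE.
apply: (le_int sR); [exact/bcsX/bcs_weighted|exact: bcsX|] => x.
rewrite /weighted exprMn ler_piMl ?sqr_ge0// exprn_ile1 ?expR_ge0//.
rewrite /gexp -expR0 ler_expR mulNr oppr_le0 mulr_ge0 ?sqnorm_ge0// divr_ge0//.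
exact/ltW/step_gt0.
Qed.

(** For x = h (L + c d), the hypothesis h <= d absorbs the quadratic term: x + 2 x^2 <= h (L + (c +
    2 (L + c)^2) d). This is the origin of C, whose final + 1 makes the inequality strict. *)
Lemma competitor_value (Npd h d L0 L1 c0 c1 : R) : 0 < Npd -> 0 < h -> h <= d -> 0 < d -> d <= 1 ->
  0 <= L0 -> 0 <= L1 -> 0 <= c0 -> 0 <= c1 ->
  d * (L0 + c0) <= 2^-1 -> d * (L1 + c1) <= 2^-1 ->
  let C := (1 - t) * (c0 + 2 * (L0 + c0) ^+ 2) + t * (c1 + 2 * (L1 + c1) ^+ 2) + 1 in
  [/\ 0 < Npd * (1 - h * (L0 + c0 * d)), 0 < Npd * (1 - h * (L1 + c1 * d)) &
    Npd * (1 - h * ((1 - t) * L0 + t * L1 + C * d)) <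
    (Npd * (1 - h * (L0 + c0 * d))) `^ (1 - t) * (Npd * (1 - h * (L1 + c1 * d))) `^ t].
Proof.
move=> N0 h0 hd d0 d1 L00 L10 c00 c10 B0 B1 C; have /andP[t0 t1] := t01.
pose x (L c : R) := h * (L + c * d).
have xP L c : 0 <= L -> 0 <= c -> d * (L + c) <= 2^-1 ->
    0 <= x L c <= 2^-1 /\ x L c + 2 * x L c ^+ 2 <= h * (L + (c + 2 * (L + c) ^+ 2) * d).
  move=> L_ c_ Bd; have cd : c * d <= c by rewrite ler_piMr.
  have cd0 : 0 <= c * d by rewrite mulr_ge0// ltW.
  have xB : x L c <= h * (L + c) by rewrite /x ler_pM2l//; lra.
  have x0 : 0 <= x L c by apply: (mulr_ge0 (ltW h0)); lra.
  have hB : h * (L + c) <= d * (L + c) by apply: ler_wpM2r hd; lra.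
  split; first by rewrite x0; lra.
  have : x L c ^+ 2 <= h * (d * (L + c) ^+ 2).
    apply: (@le_trans _ _ (h ^+ 2 * (L + c) ^+ 2)).
      by rewrite -exprMn lerXn2r ?nnegrE//; lra.
    by rewrite mulrA ler_wpM2r ?sqr_ge0// expr2 ler_pM2l.
  have -> : h * (L + (c + 2 * (L + c) ^+ 2) * d) = x L c + 2 * (h * (d * (L + c) ^+ 2)).
    by rewrite /x; ring.
  by move=> ?; lra.
have [X0 E0] := xP L0 c0 L00 c00 B0; have [X1 E1] := xP L1 c1 L10 c10 B1.
have := weighted_mean_lower X0 X1; rewrite -/(x L0 c0) -/(x L1 c1).
move: (x L0 c0) (x L1 c1) X0 X1 E0 E1 => X Y /andP[X0 X2] /andP[Y0 Y2] E0 E1 H.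
have X1 : 0 < 1 - X by lra.
have Y1 : 0 < 1 - Y by lra.
split; [exact: mulr_gt0|exact: mulr_gt0|].
rewrite !powRM ?ltW// mulrACA -powRD ?subrK ?powRr1 ?ltW//; last by rewrite oner_eq0.
rewrite ltr_pM2l//; apply: lt_le_trans H.
have t1' : 0 <= 1 - t by lra.
have := ler_wpM2l t1' E0; have := ler_wpM2l (ltW t0) E1.
have : 0 < h * d by exact: mulr_gt0.
rewrite /C; lra.
Qed.

(** S is the mass of the competitor, Y and D are the mass and the Dirichlet form of its
    mollification. The smallness condition is what (1 + d) (L + (C + c4) d) <= (L + e) (1 - c4 d)
    becomes when d^2 is bounded by d. *)
Lemma ratio_estimate (d c4 C L e D S Y : R) : 0 < d -> d <= 1 -> 0 <= C -> 0 <= c4 -> 0 <= L ->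
  0 < e -> d * c4 < 1 -> d * (L + 2 * (C + c4) + c4 * (L + e)) <= e -> 0 < S ->
  D <= (L + C * d + c4 * d) * S -> (1 - c4 * d) * S <= (1 + d) * Y ->
  0 < Y /\ D <= (L + e) * Y.
Proof.
move=> d0 d1 C0 c40 L_0 e0 dc4 dE S0 up1 up2.
have dd : 0 < 1 + d by exact: addr_gt0.
split.
  rewrite -(pmulr_rgt0 Y dd); apply: lt_le_trans up2; by rewrite mulr_gt0// subr_gt0 mulrC.
rewrite -(ler_pM2l dd).
apply: (@le_trans _ _ ((L + e) * ((1 - c4 * d) * S))); last first.
  by rewrite [leRHS]mulrCA ler_pM2l// ltr_wpDl.
apply: (@le_trans _ _ ((1 + d) * ((L + C * d + c4 * d) * S))); first by rewrite ler_pM2l.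
rewrite !mulrA ler_pM2r//.
have : d * d * (C + c4) <= d * (C + c4).
  by rewrite -mulrA ler_piMl//; apply: mulr_ge0 (ltW d0) (addr_ge0 C0 c40).
have -> : (1 + d) * (L + C * d + c4 * d) = L + d * L + d * (C + c4) + d * d * (C + c4) by ring.
by move: dE; clear; lra.
Qed.

Lemma dirichlet_minkowski K0 K1 u0 u1 (L0 L1 e r : R) : compact K0 -> compact K1 ->
  ctest u0 -> ctest u1 -> (forall x, ~ K0 x -> u0 x = 0) -> (forall x, ~ K1 x -> u1 x = 0) ->
  0 < Int (fun x => u0 x ^+ 2) -> 0 < Int (fun x => u1 x ^+ 2) -> 0 <= L0 -> 0 <= L1 ->
  dirichlet u0 <= L0 * Int (fun x => u0 x ^+ 2) ->
  dirichlet u1 <= L1 * Int (fun x => u1 x ^+ 2) -> 0 < e -> 0 < r ->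
  exists (d : R) F, [/\ 0 < d <= r, bcs nrm F,
    forall x, ~ minkowski_combination (1 - t) t K0 K1 x -> F x = 0,
    0 < Int (fun x => smoothing d F x ^+ 2) &
    dirichlet (smoothing d F) <=
      ((1 - t) * L0 + t * L1 + e) * Int (fun x => smoothing d F x ^+ 2)].
Proof.
move=> cK0 cK1 cu0 cu1 u0K u1K U0 U1 L00 L10 D0 D1 e0 r0; have /andP[t0 t1] := t01.
set Kt := minkowski_combination _ _ _ _.
have cKt : compact Kt by exact: minkowski_combination_compact.
have [M HM] : exists M, [/\ forall x, K0 x -> nrm x <= M, forall x, K1 x -> nrm x <= M &
    forall x, Kt x -> nrm x <= M].
  have [M0 H0] := compact_bounded_nrm cK0; have [M1 H1] := compact_bounded_nrm cK1.
  have [Mt Ht] := compact_bounded_nrm cKt.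
  exists (Num.max M0 (Num.max M1 Mt)); split => x.
  - by move=> /H0 h; rewrite le_max h.
  - by move=> /H1 h; rewrite !le_max h orbT.
  - by move=> /Ht h; rewrite !le_max h !orbT.
have [K0M K1M KtM] := HM.
have KK x y : K0 x -> K1 y -> Kt ((1 - t) *: x + t *: y).
  by move=> Kx Ky; exists x => //; exists y.
have mK0 := compact_measurable_rV cK0; have mK1 := compact_measurable_rV cK1.
have mKt := compact_measurable_rV cKt.
have [c0 c00 f0] := form_lower_ratio cu0 U0 D0.
have [c1 c10 f1] := form_lower_ratio cu1 U1 D1.
pose C : R := (1 - t) * (c0 + 2 * (L0 + c0) ^+ 2) + t * (c1 + 2 * (L1 + c1) ^+ 2) + 1.
pose L : R := (1 - t) * L0 + t * L1.
have t1' : 0 <= 1 - t by lra.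
have L_0 : 0 <= L by rewrite addr_ge0// mulr_ge0// ltW.
have C0 : 0 <= C.
  have q (a b : R) : 0 <= a -> 0 <= a + 2 * b ^+ 2.
    by move=> a0; rewrite addr_ge0// mulr_ge0// sqr_ge0.
  by rewrite /C !addr_ge0// mulr_ge0 ?q// ltW.
have LC0 : 0 <= L + C by exact: addr_ge0.
have V0 : 0 <= n%:R * M ^+ 2 by rewrite mulr_ge0 ?sqr_ge0.
(* The rate used later is L + C d, at most L + C, so [c4] is available before [d]. *)
have [c4 c40 up] := @form_upper R n _ _ V0 LC0.
pose E : R := L + 2 * (C + c4) + c4 * (L + e).
have E0 : 0 <= E by rewrite /E; have := mulr_ge0 c40 (addr_ge0 L_0 (ltW e0)); lra.
(* No entry depends on [d]: the factors 2 give the bounds by 1/2 in [competitor_value], L + C keeps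
   the rate of the competitor positive, c4 and E / e serve [ratio_estimate], and the last entry
   gives d <= r. *)
have [d d0 dP] := small_parameter
  [:: 1; 2 * (L0 + c0); 2 * (L1 + c1); L + C; c4; E / e; r^-1].
have d1 : d <= 1 by have := dP 1; rewrite !inE eqxx mulr1 => /(_ isT)/ltW.
have B0 : d * (L0 + c0) <= 2^-1.
  by have := dP (2 * (L0 + c0)); rewrite !inE eqxx !orbT mulrCA => /(_ isT); clear; lra.
have B1 : d * (L1 + c1) <= 2^-1.
  by have := dP (2 * (L1 + c1)); rewrite !inE eqxx !orbT mulrCA => /(_ isT); clear; lra.
have dLC : d * (L + C) < 1 by apply: dP; rewrite !inE eqxx !orbT.
have dc4 : d * c4 < 1 by apply: dP; rewrite !inE eqxx !orbT.
have dE : d * E <= e.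
  have := dP (E / e); rewrite !inE eqxx !orbT => /(_ isT).
  by rewrite mulrA ltr_pdivrMr// mul1r => /ltW.
have dr : d <= r.
  have := dP r^-1; rewrite !inE eqxx !orbT => /(_ isT).
  by rewrite ltr_pdivrMr// mul1r => /ltW.
move=> {dP}.
have h0 := @step_gt0 R n d d0; have [_ hd] := @step_le R n d d0 d1; have N0 := @Np_gt0 R n d d0.
have [a0 a1 ab] := competitor_value N0 h0 hd d0 d1 L00 L10 c00 c10 B0 B1.
rewrite -/C -/L in ab.
set h := step d in h0 hd a0 a1 ab.
have hLC : 0 < 1 - h * (L + C * d).
  rewrite subr_gt0; apply: le_lt_trans dLC; apply: ler_pM => //; first exact: ltW.
    by rewrite addr_ge0// mulr_ge0// ltW.
  by rewrite lerD2l ler_piMr.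
have [f [bf fK fb]] := form_competitor d0 t01 mK0 mK1 mKt K0M K1M KtM KK
  (ctest_bcs cu0) (ctest_bcs cu1) u0K u1K U0 U1 a0 a1 (f0 d d0 d1) (f1 d d0 d1)
  (mulr_gt0 N0 hLC) ab.
have S0 := form_gt0_int d0 bf fb.
have fV x : f x != 0 -> sqnorm x <= n%:R * M ^+ 2.
  move=> fx; apply/sqnorm_le_nrm/KtM; apply: contrapT => /fK fx0.
  by rewrite fx0 eqxx in fx.
have LL : 0 <= L + C * d <= L + C.
  by rewrite addr_ge0 ?mulr_ge0 ?(ltW d0)//= lerD2l ler_piMr.
have [up1 up2] := up d f (L + C * d) d0 d1 bf fV LL (ltW fb).
have [Y0 DY] := ratio_estimate d0 d1 C0 c40 L_0 e0 dc4 dE S0 up1 up2.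
exists d, (weighted d f); split => //; first by rewrite d0.
  exact: bcs_weighted.
by move=> x /fK fx; rewrite /weighted fx mulr0.
Qed.

End minkowski_transfer.

(** * Convexity of the frequency *)

Section convexity.
Context {R : realType} {n : nat}.
Notation rV := 'rV[R]_n.
Implicit Types (Omega : set rV).

Lemma gaussian_frequency_ge0 Omega : (0 <= gaussian_frequency Omega)%E.
Proof.
apply: le_ereal_inf_tmp => _ [v [g [_ _ ->]]]; rewrite lee_fin divr_ge0// Rintegral_ge0// => x _.
  exact: sqnorm_ge0.
exact: sqr_ge0.
Qed.

(** Strict upper bounds take the place of the frequencies themselves, since no minimizer is at hand;
    strictness furnishes the test functions. *)
Lemma gaussian_frequency_minkowski (t l0 l1 : R) Omega0 Omega1 : 0 < t < 1 ->
  open Omega0 -> open Omega1 ->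
  (gaussian_frequency Omega0 < l0%:E)%E -> (gaussian_frequency Omega1 < l1%:E)%E ->
  (gaussian_frequency (minkowski_combination (1 - t) t Omega0 Omega1) <=
    ((1 - t) * l0 + t * l1)%:E)%E.
Proof.
move=> t01 oO0 oO1 f0 f1; have /andP[t0 t1] := t01.
have l00 : 0 <= l0 by rewrite -lee_fin ltW// (le_lt_trans (gaussian_frequency_ge0 _) f0).
have l10 : 0 <= l1 by rewrite -lee_fin ltW// (le_lt_trans (gaussian_frequency_ge0 _) f1).
have [phi0 [tphi0 m0 e0]] := gaussian_frequency_approx oO0 f0.
have [phi1 [tphi1 m1 e1]] := gaussian_frequency_approx oO1 f1.
have [c0 _ _] := test_functionP tphi0; have [c1 _ _] := test_functionP tphi1.
have [_ cK0 KO0] := tphi0; have [_ cK1 KO1] := tphi1.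
have [E0 U0] := schrodinger_transform c0; have [E1 U1] := schrodinger_transform c1.
have cu0 := ctestM (smooth_gexp (- 4^-1)) c0; have cu1 := ctestM (smooth_gexp (- 4^-1)) c1.
set K0 := closure _ in cK0 KO0; set K1 := closure _ in cK1 KO1.
have nK (phi : rV -> R) x : ~ closure [set y | phi y != 0] x -> gexp (- 4^-1) x * phi x = 0.
  move=> Kx; rewrite [phi x](_ : _ = 0) ?mulr0//; apply/eqP/negPn/negP => px.
  by apply: Kx; exact: subset_closure.
set Kt := minkowski_combination (1 - t) t K0 K1.
set Ot := minkowski_combination (1 - t) t Omega0 Omega1.
have oOt : open Ot by apply: minkowski_combination_open => //; rewrite subr_eq0 gt_eqF.
have cKt : compact Kt by exact: minkowski_combination_compact.
have KOt : Kt `<=` Ot by move=> _ [x Kx [y Ky <-]]; exists x; [exact: KO0|exists y => //; exact: KO1].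
have [r r0 KrO] := compact_margin cKt oOt KOt.
(* The shift between the Gaussian quotient and the Dirichlet quotient. It is added to both given
   bounds and, as the weights sum to 1, subtracted once at the end. *)
pose s : R := n%:R / 2; have s0 : 0 <= s by rewrite divr_ge0.
have L0 : 0 <= l0 + s by exact: addr_ge0.
have L1 : 0 <= l1 + s by exact: addr_ge0.
rewrite -/s in E0 E1.
rewrite -U0 in m0 e0 E0; rewrite -U1 in m1 e1 E1.
have D0 : dirichlet (fun x => gexp (- 4^-1) x * phi0 x) <=
    (l0 + s) * Int (fun x => (gexp (- 4^-1) x * phi0 x) ^+ 2).
  by rewrite E0 mulrDl lerD2r.
have D1 : dirichlet (fun x => gexp (- 4^-1) x * phi1 x) <=
    (l1 + s) * Int (fun x => (gexp (- 4^-1) x * phi1 x) ^+ 2).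
  by rewrite E1 mulrDl lerD2r.
apply/lee_addgt0Pr => e ep.
have [d [F [/andP[d0 dr] bF FK Y0 DY]]] := dirichlet_minkowski t01 cK0 cK1 cu0 cu1
  (nK phi0) (nK phi1) m0 m1 L0 L1 D0 D1 ep r0.
(* Multiplication by [gexp 4^-1] inverts the substitution, and d <= r keeps the support inside
   [Ot]. *)
have tphi : test_function Ot (fun x => gexp 4^-1 x * smoothing d F x).
  by apply: (smoothing_test_function _ d0 bF cKt FK) => x z Kx /le_trans zd; exact/KrO/zd.
have [cphi _ _] := test_functionP tphi.
have [Et Ut] := schrodinger_transform cphi.
have uE : (fun x => gexp (- 4^-1) x * (gexp 4^-1 x * smoothing d F x)) = smoothing d F.
  by apply/funext => x; rewrite mulrA /gexp -expRD mulNr addNr expR0 mul1r.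
have Ut' := Ut; rewrite -/s uE in Et.
rewrite (_ : Int _ = Int (fun x => smoothing d F x ^+ 2)) in Ut; last by congr Rintegral;
  apply/funext => x; rewrite -[in RHS]uE.
rewrite -Ut in Et.
have mt : 0 < gmass (fun x => gexp 4^-1 x * smoothing d F x) by rewrite -Ut.
apply: le_trans (frequency_le oOt tphi mt) _.
rewrite -EFinD lee_fin ler_pdivrMr// -Ut.
move: DY; rewrite Et; set Y := Int _; set G := genergy _ => DY.
rewrite -(lerD2r (s * Y)); apply: le_trans DY _.
by rewrite -mulrDl ler_wpM2r// ?(ltW Y0)// le_eqVlt; apply/orP; left; apply/eqP; ring.
Qed.

End convexity.

Theorem theorem1p2 (R : realType) (n : nat) (Omega0 Omega1 : set 'rV[R]_n)
    (t : R) :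
  Omega0 !=set0 -> open Omega0 -> bounded_set Omega0 ->
  Omega1 !=set0 -> open Omega1 -> bounded_set Omega1 ->
  0 <= t <= 1 ->
  (gaussian_frequency (minkowski_combination (1 - t) t Omega0 Omega1) <=
   (1 - t)%:E * gaussian_frequency Omega0 + t%:E * gaussian_frequency Omega1)%E.
Proof.
move=> [x0 Ox0] oO0 _ [x1 Ox1] oO1 _ /andP[t0 t1].
(* At an endpoint, nonemptiness of one set makes the combination equal to the other, and 0 times a
   frequency is 0 even if the frequency is infinite. *)
have [->|tn0] := eqVneq t 0.
  rewrite subr0 mul1e mul0e adde0 (_ : minkowski_combination _ _ _ _ = Omega0)//.
  apply/seteqP; split => [_ [x Ox [y Oy <-]]|x Ox]; first by rewrite scale1r scale0r addr0.
  by exists x => //; exists x1 => //; rewrite scale1r scale0r addr0.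
have [->|tn1] := eqVneq t 1.
  rewrite subrr mul1e mul0e add0e (_ : minkowski_combination _ _ _ _ = Omega1)//.
  apply/seteqP; split => [_ [x Ox [y Oy <-]]|x Ox]; first by rewrite scale1r scale0r add0r.
  by exists x0 => //; exists x => //; rewrite scale1r scale0r add0r.
have {tn0}t0 : 0 < t by rewrite lt_neqAle eq_sym tn0.
have {tn1}t1 : t < 1 by rewrite lt_neqAle tn1.
have t1' : 0 < 1 - t by rewrite subr_gt0.
have t01 : 0 < t < 1 by rewrite t0.
have := fun l0 l1 => @gaussian_frequency_minkowski R n t l0 l1 Omega0 Omega1 t01 oO0 oO1.
have := gaussian_frequency_ge0 Omega0; have := gaussian_frequency_ge0 Omega1.
(* Nonnegativity excludes -oo. If a frequency is +oo, so is the right side, because both weights are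
   positive. *)
move: (gaussian_frequency Omega0) (gaussian_frequency Omega1) => [l0| |] [l1| |] //; last first.
all: rewrite ?gt0_muley ?lte_fin// ?addye// ?addey// ?leey//.
move=> _ _ H; rewrite -!EFinM -EFinD; apply/lee_addgt0Pr => e e0.
have := H (l0 + e) (l1 + e); rewrite !lte_fin !ltrDl => /(_ e0 e0).
by move/le_trans; apply; rewrite -EFinD lee_fin; lra.
Qed.
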